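(* Let $X$ be a Banach space. If $X$ has the graphon representation property, then $X$ has the Radon--Nikodým property.
   Context: All Banach spaces are real; $[0,1]^S$ ($S$ a finite set) carries Lebesgue measure; $\langle\phi,x\rangle:=\phi(x)$ for $\phi\in X^*$, $x\in X$. An $X$-decorated target graph is a pair $\mathbf G=(G,g)$ where $G$ is a finite graph that is complete and completely looped (every two vertices are adjacent and every vertex has a loop) and $g:E(G)\to X$. An $X^*$-decorated test graph is a pair $\mathbf F=(F,f)$ where $F$ is a finite simple graph (without loops) and $f:E(F)\to X^*$. The homomorphism density is $$t(\mathbf F,\mathbf G)=\frac{1}{|V(G)|^{|V(F)|}}\sum_{\varphi:V(F)\to V(G)}\ \prod_{ij\in E(F)}\langle f(ij),g(\varphi(i)\varphi(j))\rangle,$$ the sum being over all maps $\varphi$. For $1\le p<\infty$ put $\|\mathbf G\|_p=\big(|V(G)|^{-2}\sum_{u,v\in V(G)}\|g(uv)\|_X^p\big)^{1/p}$. An $X$-valued Bochner graphon is a Bochner (strongly) measurable function $W:[0,1]^2\to X$ which is symmetric ($W(x,y)=W(y,x)$ for a.e. $(x,y)$) and satisfies $\|W(\cdot,\cdot)\|_X\in L^p([0,1]^2)$ for every $1\le p<\infty$. Its densities are $$t(\mathbf F,W)=\int_{[0,1]^{V(F)}}\prod_{ij\in E(F)}\langle f(ij),W(x_i,x_j)\rangle\prod_{i\in V(F)}dx_i.$$ $X$ has the graphon representation property if: whenever a sequence $(\mathbf G_n)$ of $X$-decorated target graphs satisfies (1) $\sup_n\|\mathbf G_n\|_p<\infty$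 for every $1\le p<\infty$ and (2) $(t(\mathbf F,\mathbf G_n))_n$ converges for every $X^*$-decorated test graph $\mathbf F$, there is an $X$-valued Bochner graphon $W$ with $t(\mathbf F,\mathbf G_n)\to t(\mathbf F,W)$ for every $X^*$-decorated test graph $\mathbf F$. $X$ has the Radon--Nikodým property if for every finite measure space $(\Omega,\Sigma,\mu)$ and every countably additive $\nu:\Sigma\to X$ of bounded variation with $\nu\ll\mu$ there is a Bochner integrable $g\in L^1(\Omega;X)$ with $\nu(A)=\int_A g\,d\mu$ for all $A\in\Sigma$. *)

(* Defs.v *)
From HB Require Import structures.
From mathcomp Require Import all_boot all_order all_algebra.
From mathcomp Require Import all_classical all_reals all_analysis.

Set Implicit Arguments.
Unset Strict Implicit.
Unset Printing Implicit Defensive.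

Import Order.TTheory GRing.Theory Num.Theory.
Import numFieldNormedType.Exports.

Local Open Scope classical_set_scope.
Local Open Scope ring_scope.

(* A Banach space over R : realType is a completeNormedModType R. *)

Record dual (R : realType) (X : normedModType R) := Dual {
  dual_fun :> {linear X -> R^o};
  dual_continuous : continuous dual_fun }.

Section Bochner.
Context d (T : measurableType d) (R : realType) (X : normedModType R).
Implicit Types (mu : {finite_measure set T -> \bar R}) (f s : T -> X).

Definition simple_function s :=
  finite_set (range s) /\ forall x, measurable (s @^-1` [set x]).

Definition simple_integral mu (A : set T) s : X :=
  \sum_(x \in range s) fine (mu (A `&` s @^-1` [set x])) *: x.

(* The approximating functions are measurable for the sigma-algebra of T
   itself, but convergence is only almost everywhere; f need not be Borel. *)
Definition strongly_measurable mu f :=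
  exists s_ : nat -> T -> X,
    (forall n, simple_function (s_ n)) /\
    {ae mu, forall t, s_ n t @[n --> \oo] --> f t}.

Definition bochner_integrable mu f :=
  strongly_measurable mu f /\ (\int[mu]_t (`|f t|)%:E < +oo)%E.

Definition is_bochner_integral mu (A : set T) f (v : X) :=
  exists s_ : nat -> T -> X,
    [/\ forall n, simple_function (s_ n),
        (\int[mu]_(t in A) (`|f t - s_ n t|)%:E)%E @[n --> \oo] --> 0%E
      & simple_integral mu A (s_ n) @[n --> \oo] --> v].

Implicit Type nu : set T -> X.

Definition countably_additive nu :=
  forall A : nat -> set T, (forall i, measurable (A i)) -> trivIset setT A ->
    \sum_(0 <= i < n) nu (A i) @[n --> \oo] --> nu (\bigcup_i A i).

Definition vector_variation nu : \bar R :=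
  ereal_sup [set v | exists n (A : 'I_n -> set T),
    [/\ forall i, measurable (A i), trivIset setT A, \bigcup_i A i = setT
      & v = (\sum_(i < n) `|nu (A i)|)%:E]].

Definition vector_absolutely_continuous mu nu :=
  forall A, measurable A -> mu A = 0%E -> nu A = 0.

End Bochner.

Definition radon_nikodym_property (R : realType) (X : normedModType R) :=
  forall (d : measure_display) (T : measurableType d)
    (mu : {finite_measure set T -> \bar R}) (nu : set T -> X),
    countably_additive nu -> (vector_variation nu < +oo)%E ->
    vector_absolutely_continuous mu nu ->
    exists g : T -> X, bochner_integrable mu g /\
      forall A, measurable A -> is_bochner_integral mu A g (nu A).

Section unit_cube.
Context (R : realType).

(* measurableTypeR R is R with its Borel sigma-algebra, as it appears in the
   type of lebesgue_measure. *)
Definition unit_interval : set (measurableTypeR R) -> \bar R :=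
  mrestr lebesgue_measure (measurable_itv `[0 : R, 1]).

HB.instance Definition _ := Measure.on unit_interval.

Lemma unit_interval_setT : unit_interval setT = 1%E.
Proof.
by rewrite /unit_interval /mrestr setTI lebesgue_measure_itv/= lte01 oppr0 adde0.
Qed.

HB.instance Definition _ :=
  Measure_isProbability.Build _ _ _ unit_interval unit_interval_setT.

Definition unit_square : probability (measurableTypeR R * measurableTypeR R)%type R :=
  (unit_interval \x unit_interval)%E.

Definition tcons n
    (z : measurableTypeR R * n.-tuple (measurableTypeR R)) :
    n.+1.-tuple (measurableTypeR R) :=
  [tuple of z.1 :: z.2].

Lemma measurable_tcons n : measurable_fun setT (@tcons n).
Proof. exact: measurable_cons. Qed.

HB.instance Definition _ n := isMeasurableFun.Build _ _ _ _ _
  (@measurable_tcons n).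

Fixpoint unit_cube n : probability (n.-tuple (measurableTypeR R)) R :=
  match n with
  | 0 => \d_ [tuple]
  | m.+1 => distribution (unit_interval \x unit_cube m)%E (@tcons m)
  end.

Lemma unit_cube_box n (A : 'I_n -> set (measurableTypeR R)) :
  (forall i, measurable (A i)) ->
  unit_cube n [set t | forall i, A i (tnth t i)] =
  (\prod_(i < n) lebesgue_measure (A i `&` `[0%R, 1%R]))%E.
Proof.
elim: n A => [|n IH] A mA /=.
  rewrite big_ord0 /dirac indicE mem_set//= => -[] //.
rewrite big_ord_recl /distribution /pushforward /=.
have mB : @measurable _ (n.-tuple (measurableTypeR R)) [set t | forall i, A (lift ord0 i) (tnth t i)].
  rewrite [X in measurable X](_ : _ = \big[setI/setT]_(i < n) ((fun t => tnth t i) @^-1` A (lift ord0 i))).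
    apply: bigsetI_measurable => i _; rewrite -[X in measurable X]setTI; exact: measurable_tnth.
  rewrite -bigcap_seq/=; apply/seteqP; split => t /= H i; last by apply: H; rewrite /= mem_index_enum.
  by move=> _; exact: H.
rewrite (_ : _ @^-1` _ = A ord0 `*` [set t | forall i, A (lift ord0 i) (tnth t i)]).
  rewrite product_measure1E //=.
  by congr (_ * _)%E; rewrite -(IH (fun i => A (lift ord0 i))).
apply/seteqP; split => -[x t] /=.
  move=> H; split; first by have := H ord0.
  by move=> i; have := H (lift ord0 i); rewrite tnthS.
move=> [H1 H2] i; case: (unliftP ord0 i) => [j ->|->]; last by [].
by rewrite /= tnthS; exact: H2.
Qed.

End unit_cube.

Section graphs.
Context (R : realType) (X : normedModType R).

(* Vertex pairs are ordered and decorations symmetric; since the graph is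
   complete and completely looped, every pair of vertices is an edge. *)
Record target_graph := TargetGraph {
  tg_vertex : finType;
  tg_nonempty : (0 < #|tg_vertex|)%N;
  tg_dec :> tg_vertex -> tg_vertex -> X;
  tg_sym : forall u v, tg_dec u v = tg_dec v u }.

(* The values of te_dec outside the edges are irrelevant. *)
Record test_graph := TestGraph {
  te_vertex : finType;
  te_adj : rel te_vertex;
  te_adj_sym : symmetric te_adj;
  te_adj_irr : irreflexive te_adj;
  te_dec :> te_vertex -> te_vertex -> dual X;
  te_sym : forall i j, te_adj i j -> te_dec i j = te_dec j i }.

(* Each undirected edge of F is listed once, with an arbitrary orientation. *)
Definition edge (F : test_graph) (e : te_vertex F * te_vertex F) : bool :=
  te_adj e.1 e.2 && (enum_rank e.1 < enum_rank e.2)%N.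

Definition target_density (F : test_graph) (G : target_graph) : R :=
  (#|tg_vertex G|%:R ^+ #|te_vertex F|)^-1 *
  \sum_(phi : {ffun te_vertex F -> tg_vertex G})
    \prod_(e | @edge F e) (F e.1 e.2 (G (phi e.1) (phi e.2)) : R).

Definition target_norm (p : R) (G : target_graph) : R :=
  ((#|tg_vertex G|%:R ^+ 2)^-1 *
   \sum_(u : tg_vertex G) \sum_(v : tg_vertex G) `|G u v| `^ p) `^ p^-1.

(* Only the restriction of W to the unit square matters, because
   unit_square R vanishes outside of it. *)
Definition bochner_graphon (W : R * R -> X) :=
  [/\ strongly_measurable (unit_square R) W,
      {ae unit_square R, forall z, W (z.1, z.2) = W (z.2, z.1)}
    & forall p : R, 1 <= p ->
        finite_norm (unit_square R) p%:E (fun z => `|W z|)].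

(* The coordinate of the vertex i is the one of index enum_rank i. *)
Definition graphon_density (F : test_graph) (W : R * R -> X) : R :=
  \int[unit_cube R #|te_vertex F|]_t
    \prod_(e | @edge F e)
      (F e.1 e.2 (W (tnth t (enum_rank e.1), tnth t (enum_rank e.2))) : R).

Definition graphon_representation_property :=
  forall G : nat -> target_graph,
    (forall p : R, 1 <= p ->
       has_ubound (range (fun n => target_norm p (G n)))) ->
    (forall F : test_graph, cvg (target_density F (G n) @[n --> \oo])) ->
    exists W : R * R -> X, bochner_graphon W /\
      forall F : test_graph,
        target_density F (G n) @[n --> \oo] --> graphon_density F W.

End graphs.

(* Main.v *)
(* Let lam be the variation of nu, phi = d lam / d mu, and for a finite measurable
   partition P let x_P be the step function equal to nu(C) / lam(C) on the cell C.
   The crux is that for every e some P satisfies |x_S - x_P|_1 <= e (in L^1(lam))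
   for all refinements S of P. Then the functions psi_n x_{P_n}, with P_n the
   partition obtained for e = 2^-n and psi_n simple, psi_n <= phi, psi_n -> phi,
   are Cauchy in L^1(mu; X), and their limit is the density of nu.

   If the crux fails, there are successive refinements P_n such that consecutive
   x_{P_n} stay at a distance > e. After normalizing to lam(T) = 1 and nu(T) = 0,
   consider the target graphs with decorations g(u) + g(v), where the values of g
   on the vertices are distributed almost like x_{P_n} under lam. Expanding the
   product over the edges reduces their densities to moments
   E prod_j f_j(x_{P_n}), which converge since each f(x_{P_n}) is a bounded scalar
   martingale. Let W represent the limit. Star graphs show that the joint moments
   of the f_i(x_{P_n}) converge to those of w_i(s) = int f_i(W(s, t)) dt. As W is
   strongly measurable, there is a seminorm q <= |.| which is small on finitely
   many vectors, has its small vectors close to a totally bounded set, and is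
   small on average along W. By Weierstrass, E max_i |f_i(x_{P_n})| is eventually
   small uniformly over finite families f_i <= q, so that, E q(x_{P_n}) being
   nondecreasing in n, it is small for all n. Hence |x_{P_{n+1}} - x_{P_n}| is
   controlled on average by finitely many scalar martingales, which are Cauchy
   in L^1: a contradiction. *)

Require Import Defs.
From HB Require Import structures.
From mathcomp Require Import all_boot all_order all_algebra.
From mathcomp Require Import all_classical all_reals all_analysis.
From mathcomp Require Import measurable_realfun ring lra.

Set Implicit Arguments.
Unset Strict Implicit.
Unset Printing Implicit Defensive.

Import Order.TTheory GRing.Theory Num.Theory.
Import numFieldNormedType.Exports.

Local Open Scope classical_set_scope.
Local Open Scope ring_scope.

(** * Hahn-Banach theorem for sublinear functionals *)

(** Every scalar image f(x_P) is a bounded martingale and converges, but x_P itself need not: the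
    obstacle is uniformity over infinitely many functionals, and W serves only to overcome it. The
    step functions are taken with respect to lam because then |x_P| <= 1, which bounds the target
    graphs in every L^p and all scalar moments. The decoration g(u) + g(v) is symmetric and
    additive, so each edge can be moved to one of its endpoints; since nu(T) = 0, averaging over a
    leaf v gives back g(u) up to a vanishing mean. W is never compared with x_P as a function: only
    E max_i |f_i(x_{P_n})| is transferred. The f_i norm q on the cells of a fixed P_{n0} and are
    chosen before n, as moments converge without uniformity in the family; monotonicity then carries
    the bound from n back to n0. Smallness of q does not bound the norm; it places x_P on average
    near a totally bounded set, on which finitely many functionals determine the norm up to a small
    error. W lies only in the L^p with p finite, so boundedness of the w_i, needed for polynomial
    approximation, is deduced from the growth of their even moments. *)

Section sublinear.
Context (R : realType) (X : lmodType R).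
Implicit Types (p q : X -> R).

Definition sublinear p :=
  (forall x y, p (x + y) <= p x + p y) /\
  (forall (a : R) x, 0 <= a -> p (a *: x) = a * p x).

Lemma sublinear0 p : sublinear p -> p 0 = 0.
Proof. by move=> [_ pZ]; rewrite -(scale0r 0) pZ// mul0r. Qed.

Lemma sublinear_lb p q x : sublinear p -> (forall y, p y <= q y) ->
  - q (- x) <= p x.
Proof.
move=> sp pq; have := sp.1 x (- x); rewrite subrr (sublinear0 sp) => h.
by have := pq (- x); lra.
Qed.

(* The infimum of [p (x + t y) - t p y] over [t >= 0] is sublinear, below [p],
   and linear along [y]. *)
Definition shift_inf p y x := inf [set p (x + t *: y) - t * p y | t in [set t | 0 <= t]].

Lemma shift_inf_has_inf p y x : sublinear p ->
  has_inf [set p (x + t *: y) - t * p y | t in [set t | 0 <= t]].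
Proof.
move=> sp; split; first by exists (p (x + 0 *: y) - 0 * p y); exists 0 => /=.
exists (- p (- x)) => _ [t /= t0 <-].
have := sp.1 (x + t *: y) (- x); rewrite addrAC subrr add0r sp.2//; lra.
Qed.

Lemma shift_inf_le p y x t : sublinear p -> 0 <= t ->
  shift_inf p y x <= p (x + t *: y) - t * p y.
Proof.
move=> sp t0; apply: ge_inf; first by have [] := shift_inf_has_inf y x sp.
by exists t.
Qed.

Lemma shift_infP p y x e : sublinear p -> 0 < e ->
  exists2 t, 0 <= t & p (x + t *: y) - t * p y < shift_inf p y x + e.
Proof.
move=> sp e0; have [_ [t /= t0 <-] h] := inf_adherent e0 (shift_inf_has_inf y x sp).
by exists t.
Qed.

Lemma shift_inf_sublinear p y : sublinear p -> sublinear (shift_inf p y).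
Proof.
move=> sp; split=> [x x'|a x].
  apply/ler_addgt0Pr => e e0.
  have e20 : 0 < e / 2 by rewrite divr_gt0.
  have [t t0 ht] := shift_infP y x sp e20.
  have [t' t'0 ht'] := shift_infP y x' sp e20.
  have := shift_inf_le y (x + x') sp (addr_ge0 t0 t'0).
  have := sp.1 (x + t *: y) (x' + t' *: y).
  by rewrite addrACA -scalerDl; lra.
rewrite le_eqVlt => /predU1P[<-|a0].
  rewrite scale0r mul0r; apply/eqP; rewrite eq_le; apply/andP; split.
    by have := shift_inf_le y 0 sp (lexx 0); rewrite add0r scale0r mul0r (sublinear0 sp) subr0.
  apply: lb_le_inf; first by have [] := shift_inf_has_inf y 0 sp.
  by move=> _ [t /= t0 <-]; rewrite add0r sp.2// subrr.
have key (b : R) z : 0 < b -> shift_inf p y (b *: z) <= b * shift_inf p y z.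
  move=> b0; rewrite -ler_pdivrMl//; apply: lb_le_inf.
    by have [] := shift_inf_has_inf y z sp.
  move=> _ [t /= t0 <-]; rewrite ler_pdivrMl//.
  have := shift_inf_le y (b *: z) sp (mulr_ge0 (ltW b0) t0).
  rewrite -scalerA -scalerDr (sp.2 _ _ (ltW b0)); lra.
apply/eqP; rewrite eq_le key//=.
have := key a^-1 (a *: x); rewrite invr_gt0 a0 => /(_ isT).
by rewrite scalerA mulVf ?gt_eqF// scale1r ler_pdivlMl.
Qed.

Lemma shift_inf_below p y x : sublinear p -> shift_inf p y x <= p x.
Proof.
move=> sp; have := shift_inf_le y x sp (lexx 0).
by rewrite scale0r addr0 mul0r subr0.
Qed.

(** Zorn's lemma for the reversed pointwise order [r]. The infimum of a chain is again sublinear: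
    near-minimizers at [x] and at [y] are comparable, and the smaller one serves both points. *)
Lemma minimal_sublinear p : sublinear p ->
  exists q, [/\ sublinear q, forall x, q x <= p x &
    forall q', sublinear q' -> (forall x, q' x <= q x) -> q' = q].
Proof.
move=> sp; pose T := {q | sublinear q /\ forall x, q x <= p x}.
pose r (s t : T) := `[< forall x, sval t x <= sval s x >].
have [||s t /asboolP st /asboolP ts|A totA|[q [sq qp]] qmin] := @Zorn T r.
- by move=> t; apply/asboolP => x.
- move=> t1 t2 t3 /asboolP h1 /asboolP h2; apply/asboolP => x.
  exact: le_trans (h2 x) (h1 x).
- case: s t st ts => [s ?] [t ?] /= st ts.
  by apply/eq_exist/funext => x; apply/eqP; rewrite eq_le st ts.
- have [->|/set0P[t0 At0]] := eqVneq A set0.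
    by exists (exist _ p (conj sp (fun x => lexx (p x)))) => s.
  have hinf x : has_inf [set sval t x | t in A].
    split; first by exists (sval t0 x), t0.
    exists (- p (- x)) => _ [t At <-].
    by apply: sublinear_lb; [exact: (svalP t).1|exact: (svalP t).2].
  pose q x := inf [set sval t x | t in A].
  have qle t x : A t -> q x <= sval t x.
    by move=> At; apply: ge_inf; [have [] := hinf x|exists t].
  have sq : sublinear q.
    split=> [x y|a x a0].
      apply/ler_addgt0Pr => e e0.
      have e20 : 0 < e / 2 by rewrite divr_gt0.
      have [_ [t At <-] ht] := inf_adherent e20 (hinf x).
      have [_ [t' At' <-] ht'] := inf_adherent e20 (hinf y).
      rewrite -/(q x) -/(q y) in ht ht'.
      have [u [Au ut ut']] : exists u, [/\ A u, forall z, sval u z <= sval t z &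
          forall z, sval u z <= sval t' z].
        by have [/asboolP h|/asboolP h] := totA _ _ At At';
          [exists t'|exists t]; split.
      have := qle _ (x + y) Au; have := (svalP u).1.1 x y.
      have := ut x; have := ut' y; lra.
    move: a0; rewrite le_eqVlt => /predU1P[<-|a0].
      rewrite scale0r mul0r /q [X in inf X](_ : _ = [set 0]) ?inf1//.
      apply/seteqP; split=> [_ [t At <-]|_ ->] /=.
        exact: sublinear0 (svalP t).1.
      by exists t0 => //; exact: sublinear0 (svalP t0).1.
    apply/eqP; rewrite eq_le; apply/andP; split.
      rewrite -ler_pdivrMl//; apply: lb_le_inf; first by have [] := hinf x.
      move=> _ [t At <-]; rewrite ler_pdivrMl// -(svalP t).1.2 ?(ltW a0)//.
      exact: qle.
    apply: lb_le_inf; first by have [] := hinf (a *: x).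
    move=> _ [t At <-]; rewrite (svalP t).1.2 ?(ltW a0)// ler_pM2l//.
    exact: qle.
  have qp x : q x <= p x by apply: le_trans (qle _ _ At0) ((svalP t0).2 _).
  by exists (exist _ q (conj sq qp)) => s As; apply/asboolP => x; exact: qle.
- exists q; split=> // q' sq' q'q.
  have q'p x : q' x <= p x by apply: le_trans (q'q x) (qp x).
  have /= := qmin (exist _ q' (conj sq' q'p)).
  have h : r (exist _ q (conj sq qp)) (exist _ q' (conj sq' q'p)) by exact/asboolP.
  by move=> /(_ h) [].
Qed.

(** A minimal sublinear [q] is linear: [shift_inf q y] lies below [q], hence equals it, and this
    yields [q x + q y <= q (x + y)]. Minimizing below [shift_inf p x0] instead of [p] forces
    [q (- x0) <= - p x0], hence equality at [x0]. *)
Lemma hahn_banach_sublinear p x0 : sublinear p ->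
  exists f : {linear X -> R^o}, (forall x, f x <= p x) /\ f x0 = p x0.
Proof.
move=> sp; have [q [sq qp qmin]] := minimal_sublinear (shift_inf_sublinear x0 sp).
have qD x y : q (x + y) = q x + q y.
  apply/eqP; rewrite eq_le sq.1/=.
  have <- := qmin _ (shift_inf_sublinear y sq) (fun x => shift_inf_below y x sq).
  have := shift_inf_le y x sq ler01; rewrite scale1r mul1r.
  by rewrite (qmin _ (shift_inf_sublinear y sq) (fun x => shift_inf_below y x sq)); lra.
have qN x : q (- x) = - q x.
  by apply/eqP; rewrite -subr_eq0 opprK -qD addNr (sublinear0 sq).
have qlin : linear (q : X -> R^o).
  move=> a x y; rewrite qD; congr (_ + _).
  have [a0|/ltW a0] := leP 0 a; first by rewrite sq.2.
  by rewrite -[a *: x]opprK -scaleNr qN sq.2 ?oppr_ge0// -mulNr opprK.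
pose fL := GRing.isLinear.Build _ _ _ _ _ qlin.
pose f : {linear X -> R^o} := HB.pack (q : X -> R^o) fL.
exists f; split=> [x|]; first exact: le_trans (qp x) (shift_inf_below _ _ sp).
apply/eqP; rewrite eq_le; apply/andP; split.
  exact: le_trans (qp x0) (shift_inf_below _ _ sp).
have /= := qp (- x0); rewrite qN.
have := shift_inf_le x0 (- x0) sp ler01.
by rewrite scale1r addNr (sublinear0 sp) mul1r; lra.
Qed.

End sublinear.

(** * Seminorms vanishing approximately on finitely many vectors *)

Section seminorm.
Context (R : realType) (X : normedModType R).
Implicit Types (q : X -> R) (zs : seq X) (z : X) (eta e c : R).

Definition seminorm q :=
  (forall x y, q (x + y) <= q x + q y) /\ (forall (a : R) x, q (a *: x) = `|a| * q x).

Lemma seminormN q x : seminorm q -> q (- x) = q x.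
Proof. by move=> sq; rewrite -scaleN1r sq.2 normrN1 mul1r. Qed.

Lemma seminorm0 q : seminorm q -> q 0 = 0.
Proof. by move=> sq; rewrite -(scale0r 0) sq.2 normr0 mul0r. Qed.

Lemma seminorm_ge0 q x : seminorm q -> 0 <= q x.
Proof.
move=> sq; have := sq.1 x (- x); rewrite subrr (seminorm0 sq) seminormN//; lra.
Qed.

Lemma seminorm_sublinear q : seminorm q -> sublinear q.
Proof.
by move=> sq; split=> [|a x a0]; [exact: sq.1|rewrite sq.2 ger0_norm].
Qed.

Lemma seminorm_normr : seminorm (fun x : X => `|x|).
Proof. by split=> *; [exact: ler_normD|exact: normrZ]. Qed.

(** The infimal convolution of [q] with the gauge of weight [eta] on the line through [z]: moving
    along [z] costs [eta] per unit. *)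
Definition line_inf (eta : R) (z : X) q x := inf (range (fun c : R => q (x - c *: z) + eta * `|c|)).

Lemma line_inf_has_inf eta z q x : 0 <= eta -> seminorm q ->
  has_inf (range (fun c : R => q (x - c *: z) + eta * `|c|)).
Proof.
move=> eta0 sq; split; first by exists (q (x - 0 *: z) + eta * `|0 : R|); exists 0.
by exists 0 => _ [c _ <-]; rewrite addr_ge0 ?mulr_ge0//; exact: seminorm_ge0.
Qed.

Lemma line_inf_le eta z q x c : 0 <= eta -> seminorm q ->
  line_inf eta z q x <= q (x - c *: z) + eta * `|c|.
Proof.
move=> eta0 sq; apply: ge_inf; first by have [] := line_inf_has_inf z x eta0 sq.
by exists c.
Qed.

Lemma line_infP eta z q x e : 0 <= eta -> seminorm q -> 0 < e ->
  exists c : R, q (x - c *: z) + eta * `|c| < line_inf eta z q x + e.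
Proof.
move=> eta0 sq e0.
by have [_ [c _ <-] h] := inf_adherent e0 (line_inf_has_inf z x eta0 sq); exists c.
Qed.

Lemma seminorm_line_inf eta z q : 0 <= eta -> seminorm q ->
  seminorm (line_inf eta z q).
Proof.
move=> eta0 sq.
have D x y : line_inf eta z q (x + y) <= line_inf eta z q x + line_inf eta z q y.
  apply/ler_addgt0Pr => e e0.
  have e20 : 0 < e / 2 by rewrite divr_gt0.
  have [c hc] := line_infP z x eta0 sq e20.
  have [c' hc'] := line_infP z y eta0 sq e20.
  have := line_inf_le z (x + y) (c + c') eta0 sq.
  have := sq.1 (x - c *: z) (y - c' *: z).
  rewrite addrACA -opprD -scalerDl.
  have := ler_wpM2l eta0 (ler_normD c c'); rewrite mulrDr; lra.
have L0 : line_inf eta z q 0 = 0.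
  apply/eqP; rewrite eq_le; apply/andP; split.
    have := line_inf_le z 0 0 eta0 sq.
    by rewrite scale0r subrr normr0 mulr0 (seminorm0 sq) addr0.
  apply: lb_le_inf; first by have [] := line_inf_has_inf z 0 eta0 sq.
  by move=> _ [c _ <-]; rewrite addr_ge0 ?mulr_ge0//; exact: seminorm_ge0.
have S (a : R) x : a != 0 -> line_inf eta z q (a *: x) <= `|a| * line_inf eta z q x.
  move=> a0; rewrite -ler_pdivrMl ?normr_gt0//; apply: lb_le_inf.
    by have [] := line_inf_has_inf z x eta0 sq.
  move=> _ [c _ <-]; rewrite ler_pdivrMl ?normr_gt0//.
  have := line_inf_le z (a *: x) (a * c) eta0 sq.
  by rewrite -scalerA -scalerBr sq.2 normrM mulrDr mulrCA.
split=> // a x; have [->|a0] := eqVneq a 0.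
  by rewrite scale0r L0 normr0 mul0r.
apply/eqP; rewrite eq_le S//=.
have := S a^-1 (a *: x); rewrite invr_eq0 => /(_ a0).
by rewrite scalerA mulVf// scale1r normfV ler_pdivlMl// normr_gt0.
Qed.

(* [net_norm eta zs x] is the infimum of [|x - sum c_i z_i| + eta * sum |c_i|]:
   it is at most [eta] on [zs], while a vector where it is small is close to a
   bounded part of the span of [zs], which is totally bounded. *)
Definition net_norm eta zs := foldr (line_inf eta) (fun x => `|x|) zs.

Lemma seminorm_net_norm eta zs : 0 <= eta -> seminorm (net_norm eta zs).
Proof.
move=> eta0; elim: zs => [|z zs IH] /=; first exact: seminorm_normr.
exact: seminorm_line_inf.
Qed.

Lemma net_norm_le_norm eta zs x : 0 <= eta -> net_norm eta zs x <= `|x|.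
Proof.
move=> eta0; elim: zs => [|z zs IH] //=; apply: le_trans IH.
have := line_inf_le z x 0 eta0 (seminorm_net_norm zs eta0).
by rewrite scale0r subr0 normr0 mulr0 addr0.
Qed.

Lemma net_norm_mem eta zs z : 0 <= eta -> z \in zs -> net_norm eta zs z <= eta.
Proof.
move=> eta0; elim: zs => [|y zs IH] //=; rewrite inE => /predU1P[->|/IH].
  have := line_inf_le y y 1 eta0 (seminorm_net_norm zs eta0).
  by rewrite scale1r subrr normr1 mulr1 (seminorm0 (seminorm_net_norm zs eta0)) add0r.
apply: le_trans.
have := line_inf_le y z 0 eta0 (seminorm_net_norm zs eta0).
by rewrite scale0r subr0 normr0 mulr0 addr0.
Qed.

Lemma real_grid (L d : R) : 0 < d ->
  exists cs : seq R, forall c, `|c| <= L -> exists2 c', c' \in cs & `|c - c'| <= d.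
Proof.
move=> d0; exists [seq i%:R * d - L | i <- iota 0 (Num.truncn (2 * L / d)).+1] => c.
rewrite ler_norml => /andP[Lc cL].
have h0 : 0 <= (c + L) / d by rewrite divr_ge0 ?(ltW d0)//; lra.
exists ((Num.truncn ((c + L) / d))%:R * d - L).
  apply/mapP; exists (Num.truncn ((c + L) / d)) => //.
  rewrite mem_iota add0n ltnS; apply: le_truncn.
  by rewrite ler_pM2r ?invr_gt0//; lra.
have /andP[] := truncn_itv h0.
move: (Num.truncn _) => t; rewrite ler_pdivlMr// ltr_pdivrMr// -natr1 => h1 h2.
rewrite ler_norml; apply/andP; split; nra.
Qed.

(** Induction on [zs]. A nearly optimal coefficient [c] of the first vector satisfies
    [eta * |c| <= r + e], so, [eta] being positive, it lies in a bounded interval, which a finite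
    grid covers; the remainder has seminorm at most [r + e] and is left to the induction
    hypothesis. *)
Lemma net_norm_net eta zs (r e : R) : 0 < eta -> 0 < e ->
  exists Z : seq X, forall x, net_norm eta zs x <= r ->
    exists2 z, z \in Z & `|x - z| <= net_norm eta zs x + e.
Proof.
move=> eta_gt0; have eta0 := ltW eta_gt0.
elim: zs r e => [|y zs IH] r e e0 /=.
  by exists [:: 0] => x _; exists 0; rewrite ?mem_seq1// subr0 lerDl (ltW e0).
have e30 : 0 < e / 3 by rewrite divr_gt0.
have [Z HZ] := IH (r + e) (e / 3) e30.
have d0 : 0 < (e / 3) / (`|y| + 1) by rewrite divr_gt0// ltr_wpDl.
have [cs Hcs] := real_grid ((r + e) / eta) d0.
exists [seq c *: y + z | c <- cs, z <- Z] => x xr.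
have snn := seminorm_net_norm zs eta0.
have [c hc] := line_infP y x eta0 snn e30.
have q0 := seminorm_ge0 (x - c *: y) snn.
have ec0 : 0 <= eta * `|c| by rewrite mulr_ge0.
have [z zZ hz] : exists2 z, z \in Z &
    `|x - c *: y - z| <= net_norm eta zs (x - c *: y) + e / 3.
  by apply: HZ; rewrite -/(net_norm _ _) in hc *; lra.
have [c' c'cs hc'] : exists2 c', c' \in cs & `|c - c'| <= (e / 3) / (`|y| + 1).
  by apply: Hcs; rewrite ler_pdivlMr//; rewrite -/(net_norm _ _) in hc *; lra.
exists (c' *: y + z); first exact: allpairs_f.
have -> : x - (c' *: y + z) = (x - c *: y - z) + (c - c') *: y.
  by rewrite scalerBl opprD [RHS]addrAC !addrA subrK.
apply: le_trans (ler_normD _ _) _; rewrite normrZ.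
have : `|c - c'| * `|y| <= e / 3.
  rewrite -(@divfK _ (`|y| + 1) _ (e / 3)) ?gt_eqF ?ltr_wpDl//.
  by apply: ler_pM => //; rewrite lerDl.
rewrite -/(net_norm _ _) in hc *; lra.
Qed.

Lemma dual_bounded (F : dual X) : exists2 C : R, 0 <= C & forall x, `|F x : R| <= C * `|x|.
Proof.
have /linear_boundedP/pinfty_ex_gt0[C C0 h] : bounded_near F (nbhs (0 : X)).
  by apply/linear_bounded_continuous; exact: dual_continuous.
by exists C => //; exact: ltW.
Qed.

(** Hahn-Banach for [q]: the evenness of [q] turns [F <= q] into [|F| <= q], and domination of [q]
    by the norm gives continuity. *)
Lemma dual_of_seminorm q x0 : seminorm q -> (forall x, q x <= `|x|) ->
  exists F : dual X, (forall x, `|F x : R| <= q x) /\ F x0 = q x0.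
Proof.
move=> sq qn; have [f [fq fx0]] := hahn_banach_sublinear x0 (seminorm_sublinear sq).
have fn x : `|f x : R| <= q x.
  rewrite ler_norml fq andbT lerNl -(seminormN x sq).
  by apply: le_trans (fq _); rewrite linearN.
have fc : continuous f.
  apply/linear_bounded_continuous/linear_boundedP; near=> r => x.
  apply: le_trans (fn x) _; apply: le_trans (qn x) _.
  by rewrite ler_peMl//; near: r; exact: nbhs_pinfty_ge.
by exists (Dual fc).
Unshelve. all: by end_near. Qed.

(** Take the functionals that norm the points of a finite net. If [z] is the net point close to [y],
    then [|y| <= |y - z| + |z|] and [|z| = F z <= |F y| + |y - z|], so the distance to the net is
    paid twice. *)
Lemma net_norm_finite_test eta zs (r e : R) : 0 < eta -> 0 < e ->
  exists k (Phi : 'I_k -> dual X), (forall i x, `|Phi i x : R| <= `|x|) /\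
    forall y, net_norm eta zs y <= r ->
      `|y| <= 2 * net_norm eta zs y + \sum_(i < k) `|Phi i y : R| + e.
Proof.
move=> eta0 e0; have e20 : 0 < e / 2 by rewrite divr_gt0.
have [Z HZ] := net_norm_net zs r eta0 e20.
have /choice[F HF] (z : X) : exists F : dual X, (forall x, `|F x : R| <= `|x|) /\ F z = `|z|.
  by apply: dual_of_seminorm => //; exact: seminorm_normr.
exists (size Z), (fun i => F (nth 0 Z i)); split=> [i x|y yr]; first exact: (HF _).1.
have [z zZ hz] := HZ y yr.
have h1 : `|F z y : R| <= \sum_(i < size Z) `|F (nth 0 Z i) y : R|.
  have zs_lt : (index z Z < size Z)%N by rewrite index_mem.
  rewrite (bigD1 (Ordinal zs_lt))//= nth_index// lerDl sumr_ge0//.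
have h2 := (HF z).1 (z - y); rewrite distrC in h2.
have h3 : `|z| <= `|F z y : R| + `|F z (z - y) : R|.
  apply: le_trans (ler_normD _ _); rewrite -linearD addrC subrK (HF z).2.
  exact: ler_norm.
have h4 : `|y| <= `|y - z| + `|z| by apply: le_trans (ler_normD _ _); rewrite subrK.
have h5 : `|F z (z - y) : R| <= `|y - z| by [].
lra.
Qed.

End seminorm.

(** * Moments and maximum norms *)

Section polynomial_approximation.
Context (R : realType) (k : nat).
Implicit Types (p phi psi : ('I_k -> R) -> R) (a : 'I_k -> R) (r e : R).

(** Closure rules rather than a polynomial ring: boundedness, measurability and convergence of
    averages are each proved by induction on them. *)
Inductive polyf : (('I_k -> R) -> R) -> Prop :=
| polyf_cst c : polyf (fun=> c)
| polyf_proj i : polyf (fun a => a i)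
| polyf_add p q : polyf p -> polyf q -> polyf (fun a => p a + q a)
| polyf_mul p q : polyf p -> polyf q -> polyf (fun a => p a * q a).

Lemma polyf_bounded r p : polyf p ->
  exists2 B, 0 < B & forall a, (forall i, `|a i| <= r) -> `|p a| <= B.
Proof.
elim=> [c|i|{}p q _ [B B0 pB] _ [C C0 qC]|{}p q _ [B B0 pB] _ [C C0 qC]].
- by exists (`|c| + 1) => [|a _]; rewrite ?ltr_wpDl// lerDl.
- exists (`|r| + 1) => [|a ar]; first by rewrite ltr_wpDl.
  by apply: le_trans (ar i) _; apply: le_trans (ler_norm r) _; rewrite lerDl.
- exists (B + C) => [|a ar]; first by rewrite addr_gt0.
  by apply: le_trans (ler_normD _ _) _; rewrite lerD ?pB ?qC.
- exists (B * C) => [|a ar]; first by rewrite mulr_gt0.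
  by rewrite normrM ler_pM ?pB ?qC.
Qed.

(* Newton-like iteration [s + (t^2 - s^2) / 2], converging to [|t|] on [-1, 1]. *)
Fixpoint abs_approx (j : nat) (t : R) : R :=
  if j is i.+1 then abs_approx i t + (t ^+ 2 - abs_approx i t ^+ 2) / 2 else 0.

(** With [x = |t|] and error [u = x - s], one step gives the error [u * (1 - (x + s) / 2)], which is
    at most [u * (1 - u / 2)] because [s >= 0]. This recursion decays like [2 / n]. *)
Lemma abs_approx_itv j t : `|t| <= 1 ->
  [/\ 0 <= abs_approx j t, abs_approx j t <= `|t| &
      (`|t| - abs_approx j t) * j.+1%:R <= 2].
Proof.
move=> t1; elim: j => [|j [s0 st us]] /=; first by split=> //; rewrite subr0 mulr1; lra.
move: (abs_approx j t) s0 st us => s s0; rewrite -(real_normK (num_real t)).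
move: (normr_ge0 t) t1; move: `|t| => x x0 x1 st us.
have h1 : (x ^+ 2 - s ^+ 2) = (x - s) * (x + s) by ring.
have h2 : 0 <= (x - s) * (x + s) by rewrite mulr_ge0//; lra.
have h3 : (x - s) * (x + s) <= (x - s) * 2 by rewrite ler_wpM2l//; lra.
rewrite h1; split; [lra|lra|].
rewrite -[j.+2%:R]natr1; move: us; set n : R := j.+1%:R => us.
have n1 : 1 <= n by rewrite /n ler1n.
set u := x - s; have u0 : 0 <= u by rewrite /u; lra.
have u1 : u <= 1 by rewrite /u; lra.
have -> : x - (s + u * (x + s) / 2) = u * (1 - (x + s) / 2) by rewrite /u; ring.
have h4 : u * (1 - (x + s) / 2) <= u * (1 - u / 2) by rewrite ler_wpM2l//; rewrite /u; lra.
apply: (@le_trans _ _ (u * (1 - u / 2) * (n + 1))).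
  by rewrite ler_wpM2r//; lra.
have us' : u * n <= 2 by [].
(* For [n > 2] the map [u * (1 - u / 2)] is increasing on [0, 1], so [u] may be replaced by
   [v = 2 / n], where the product with [n + 1] is [2 - 2 / n ^ 2]. For [n <= 2] the value [1 / 2] at
   [u = 1] suffices. *)
have [n2|n2] := leP n 2.
  by have := sqr_ge0 (1 - u); nra.
pose v := 2 / n; have n0 : n != 0 by rewrite gt_eqF//; lra.
have vn : v * n = 2 by rewrite /v divfK.
have uv : u <= v by rewrite /v ler_pdivlMr//; lra.
have v1 : v <= 1 by rewrite /v ler_pdivrMr//; lra.
have : v * (1 - v / 2) * (n + 1) = v * n + v - v * (v * n) / 2 - v ^+ 2 / 2 by field.
rewrite vn.
have : 0 <= (v - u) * (1 - (u + v) / 2) * (n + 1) by rewrite !mulr_ge0//; lra.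
have := sqr_ge0 v; lra.
Qed.

Definition approximable r phi := forall e, 0 < e ->
  exists2 p, polyf p & forall a, (forall i, `|a i| <= r) -> `|p a - phi a| <= e.

Lemma approximableD r phi psi : approximable r phi -> approximable r psi ->
  approximable r (fun a => phi a + psi a).
Proof.
move=> h1 h2 e e0; have e20 : 0 < e / 2 by rewrite divr_gt0.
have [p pp hp] := h1 _ e20; have [q pq hq] := h2 _ e20.
exists (fun a => p a + q a); first exact: polyf_add.
move=> a ar; rewrite opprD addrACA; apply: le_trans (ler_normD _ _) _.
by have := hp a ar; have := hq a ar; lra.
Qed.

Lemma approximableZ r c phi : approximable r phi -> approximable r (fun a => c * phi a).
Proof.
move=> h1 e e0; have c1 : 0 < `|c| + 1 by rewrite ltr_wpDl.
have [p pp hp] := h1 (e / (`|c| + 1)) (divr_gt0 e0 c1).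
exists (fun a => c * p a); first by apply: polyf_mul => //; exact: polyf_cst.
move=> a ar; rewrite -mulrBr normrM.
rewrite -(@divfK _ (`|c| + 1) _ e) ?gt_eqF// mulrC ler_pM ?hp//.
by rewrite lerDl.
Qed.

Lemma polyf_abs_approx p j : polyf p -> polyf (fun a => abs_approx j (p a)).
Proof.
move=> pp; elim: j => [|j IH] /=; first exact: polyf_cst.
apply: polyf_add => //; apply: polyf_mul; last exact: polyf_cst.
apply: polyf_add; first exact: polyf_mul.
have -> : (fun a => - abs_approx j (p a) ^+ 2) =
    (fun a => (-1) * (abs_approx j (p a) * abs_approx j (p a))).
  by apply/funext => a; rewrite mulN1r expr2.
by apply: polyf_mul; [exact: polyf_cst|exact: polyf_mul].
Qed.

Lemma approximable_norm r phi : approximable r phi ->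
  approximable r (fun a => `|phi a|).
Proof.
move=> h e e0; have e20 : 0 < e / 2 by rewrite divr_gt0.
have [p pp hp] := h _ e20; have [B B0 pB] := polyf_bounded r pp.
(* After division by [B] the values of [p] lie in [-1, 1], where the iteration has error at most
   [2 / (j + 1)]; this [j] makes [2 * B / (j + 1)] at most [e / 2]. *)
pose j := Num.truncn (4 * B / e).
exists (fun a => B * abs_approx j (B^-1 * p a)).
  apply: polyf_mul; first exact: polyf_cst.
  by apply: polyf_abs_approx; apply: polyf_mul => //; exact: polyf_cst.
move=> a ar; have t1 : `|B^-1 * p a| <= 1.
  by rewrite normrM gtr0_norm ?invr_gt0// ler_pdivrMl// mulr1 pB.
have [s0 st us] := abs_approx_itv j t1.
have BV : B * B^-1 = 1 by rewrite mulfV ?gt_eqF.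
have pE : `|p a| = B * `|B^-1 * p a|.
  by rewrite normrM gtr0_norm ?invr_gt0// mulrA BV mul1r.
have h4 : 0 <= 4 * B / e by rewrite divr_ge0 ?mulr_ge0 ?(ltW B0) ?(ltW e0).
have j4 : 4 * B / e < j.+1%:R by have /andP[] := truncn_itv h4.
have j0 : (0 : R) < j.+1%:R by rewrite ltr0n.
have h5 : B * (`|B^-1 * p a| - abs_approx j (B^-1 * p a)) <= e / 2.
  rewrite -(ler_pM2r j0) -mulrA.
  apply: (@le_trans _ _ (B * 2)); first by rewrite ler_pM2l.
  by move: j4; rewrite ltr_pdivrMr//; lra.
have h6 : `| `|p a| - `|phi a| | <= e / 2 := le_trans (ler_dist_dist _ _) (hp a ar).
have h7 : 0 <= B * (`|B^-1 * p a| - abs_approx j (B^-1 * p a)).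
  by rewrite mulr_ge0 ?(ltW B0) ?subr_ge0.
move: h6; rewrite !ler_norml => /andP[h8 h9]; apply/andP.
by move: h5 h7; rewrite mulrBr -pE => h5 h7; split; lra.
Qed.

Lemma approximable_max r phi psi : approximable r phi -> approximable r psi ->
  approximable r (fun a => Num.max (phi a) (psi a)).
Proof.
move=> h1 h2.
rewrite (_ : (fun a => _) = (fun a => 2^-1 * ((phi a + psi a) + `|phi a + (-1) * psi a|))).
  apply: approximableZ; apply: approximableD; first exact: approximableD.
  by apply: approximable_norm; apply: approximableD => //; exact: approximableZ.
by apply/funext => a; rewrite maxr_absE mulN1r mulrC.
Qed.

Definition max_norm a := \big[Num.max/0]_(i < k) `|a i|.

Lemma approximable_max_norm r : approximable r max_norm.
Proof.
rewrite /max_norm; elim: (index_enum _) => [|i s IH].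
  move=> e e0; exists (fun=> 0); first exact: polyf_cst.
  by move=> a _; rewrite big_nil subrr normr0 ltW.
under eq_fun do rewrite big_cons; apply: approximable_max => //.
apply: approximable_norm => e e0; exists (fun a => a i); first exact: polyf_proj.
by move=> a _; rewrite subrr normr0 ltW.
Qed.

End polynomial_approximation.

Lemma eq_cvgn (R : realType) (v u : nat -> R) (l : R) :
  (forall n, u n = v n) -> v @ \oo --> l -> u @ \oo --> l.
Proof. by move=> /funext ->. Qed.

Section average.
Context (R : realType) (V : finType).
Implicit Types (f g : V -> R) (e : R).

Definition average f : R := (#|V|%:R)^-1 * \sum_v f v.

Lemma averageD f g : average (fun v => f v + g v) = average f + average g.
Proof. by rewrite /average big_split/= mulrDr. Qed.

Lemma averageZ c f : average (fun v => c * f v) = c * average f.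
Proof. by rewrite /average -mulr_sumr mulrCA. Qed.

Lemma average_cst c : (0 < #|V|)%N -> average (fun=> c) = c.
Proof.
move=> V0; rewrite /average sumr_const -[c *+ _]mulr_natl mulrA mulVf ?mul1r//.
by rewrite pnatr_eq0 -lt0n.
Qed.

Lemma le_average f g : (forall v, f v <= g v) -> average f <= average g.
Proof. by move=> fg; rewrite /average ler_wpM2l ?invr_ge0// ler_sum. Qed.

Lemma eq_average f g : f =1 g -> average f = average g.
Proof. by move=> fg; rewrite /average (eq_bigr _ (fun v _ => fg v)). Qed.

Lemma le_averageD e f g : (0 < #|V|)%N -> (forall v, f v <= g v + e) ->
  average f <= average g + e.
Proof.
move=> V0 fg; apply: le_trans (le_average fg) _.
by rewrite averageD average_cst.
Qed.

End average.

Lemma Rintegral_probability_cst d (T : measurableType d) (R : realType)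
  (P : probability T R) (c : R) : \int[P]_t c = c.
Proof.
rewrite Rintegral_cst// -[RHS]mulr1; congr (_ * _).
exact: (congr1 fine (@probability_setT _ _ _ P)).
Qed.

(** * From convergence of moments to the mean of the maximum norm *)

Section moments.
Context d (T : measurableType d) (R : realType) (P : probability T R).
Context (k : nat) (r : R) (V : nat -> finType).
Context (a : forall n, V n -> 'I_k -> R) (w : T -> 'I_k -> R).
Arguments a : clear implicits.
Hypothesis V0 : forall n, (0 < #|V n|)%N.
Hypothesis ar : forall n v i, `|a n v i| <= r.
Hypothesis mw : forall i, measurable_fun setT (fun t => w t i).

Let bounded_integrable (f : T -> R) : measurable_fun setT f ->
  (exists B, forall t, `|f t| <= B) -> P.-integrable setT (EFin \o f).
Proof.
move=> mf [B fB]; apply: measurable_bounded_integrable => //.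
  by apply: le_lt_trans (ltry 1); exact: probability_le1.
exists B; split; first exact: num_real.
by move=> x xB t _ /=; apply: le_trans (fB t) _; exact: ltW.
Qed.

Let polyf_measurable p : polyf p -> measurable_fun setT (fun t => p (w t)).
Proof.
elim=> [c|i|p1 p2 _ h1 _ h2|p1 p2 _ h1 _ h2].
- exact: measurable_cst.
- exact: mw.
- exact: measurable_funD.
- exact: measurable_funM.
Qed.

Let monomial (s : seq 'I_k) (b : 'I_k -> R) := \prod_(i <- s) b i.

Let polyf_monomial s : polyf (monomial s).
Proof.
rewrite /monomial; elim: s => [|i s IH].
  by under eq_fun do rewrite big_nil; exact: polyf_cst.
under eq_fun do rewrite big_cons; apply: polyf_mul => //; exact: polyf_proj.
Qed.

Section bounded.
Context (r' : R).
Hypothesis rr' : r <= r'.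
Hypothesis wr : forall t i, `|w t i| <= r'.
Hypothesis moments : forall s : seq 'I_k,
  average (fun v => \prod_(i <- s) a n v i) @[n --> \oo] -->
  \int[P]_t \prod_(i <- s) w t i.

(** Testing against all monomials makes the predicate stable under multiplication by a coordinate,
    which is absorbed into [s]. *)
Let good (psi : ('I_k -> R) -> R) := forall s,
  average (fun v => monomial s (a n v) * psi (a n v)) @[n --> \oo] -->
  \int[P]_t (monomial s (w t) * psi (w t)).

Let polyf_integrable p : polyf p -> P.-integrable setT (EFin \o (fun t => p (w t))).
Proof.
move=> pp; apply: bounded_integrable; first exact: polyf_measurable.
have [B B0 pB] := polyf_bounded r' pp; exists B => t; exact: pB.
Qed.

(* Multiplication by a polynomial preserves [good]; stating this for every
   multiplier makes the product case of the induction a composition. *)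
Let polyf_good p : polyf p -> forall psi, polyf psi -> good psi ->
  good (fun b => p b * psi b).
Proof.
elim=> [c|i|p1 p2 pp1 h1 pp2 h2|p1 p2 pp1 h1 pp2 h2] psi ppsi gpsi.
- move=> s; have ipsi := polyf_integrable (polyf_mul (polyf_monomial s) ppsi).
  apply: (@eq_cvgn _ (fun n => c * average (fun v => monomial s (a n v) * psi (a n v)))).
    by move=> n; rewrite -averageZ; apply: eq_average => v; rewrite mulrCA.
  under eq_Rintegral do rewrite mulrCA.
  by rewrite RintegralZl//; apply: cvgMr; exact: gpsi.
- move=> s; have E b : monomial s b * (b i * psi b) = monomial (i :: s) b * psi b.
    by rewrite /monomial big_cons mulrCA mulrA.
  apply: (eq_cvgn (fun n => eq_average (fun v => E (a n v)))).
  by under eq_Rintegral do rewrite E; exact: gpsi.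
- move=> s.
  apply: (@eq_cvgn _ (fun n => average (fun v => monomial s (a n v) * (p1 (a n v) * psi (a n v))) +
      average (fun v => monomial s (a n v) * (p2 (a n v) * psi (a n v))))).
    by move=> n; rewrite -averageD; apply: eq_average => v; rewrite mulrDl mulrDr.
  under eq_Rintegral do rewrite mulrDl mulrDr.
  rewrite RintegralD//; first by apply: cvgD; [exact: h1|exact: h2].
    by apply: polyf_integrable (polyf_mul (polyf_monomial s) (polyf_mul pp1 ppsi)).
  by apply: polyf_integrable (polyf_mul (polyf_monomial s) (polyf_mul pp2 ppsi)).
- rewrite (_ : (fun b => _) = (fun b => p1 b * (p2 b * psi b))); last first.
    by apply/funext => b; rewrite mulrA.
  by apply: h1; [exact: polyf_mul|exact: h2].
Qed.

(** The maximum norm is replaced by a polynomial on the cube of radius [r'], on the vertices and on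
    [T]; these two replacements and the convergence of the polynomial averages cost [e / 3] each. *)
Lemma average_max_norm_bounded e : 0 < e ->
  \forall n \near \oo,
    average (fun v => max_norm (a n v)) <= \int[P]_t max_norm (w t) + e.
Proof.
move=> e0; have e30 : 0 < e / 3 by rewrite divr_gt0.
have [p pp hp] := @approximable_max_norm R k r' _ e30.
have gp : average (fun v => p (a n v)) @[n --> \oo] --> \int[P]_t p (w t).
  have g1 : good (fun=> 1).
    move=> s; apply: (eq_cvgn (fun n => eq_average (fun v => mulr1 _))).
    by under eq_Rintegral do rewrite mulr1; exact: moments.
  have E b : p b = monomial [::] b * (p b * 1) by rewrite /monomial big_nil mul1r mulr1.
  apply: (eq_cvgn (fun n => eq_average (fun v => E (a n v)))).
  under eq_Rintegral do rewrite E.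
  have good_p := polyf_good pp (polyf_cst k 1) g1.
  exact: (good_p [::]).
have mmax : measurable_fun setT (fun t => max_norm (w t)).
  rewrite /max_norm; elim: (index_enum _) => [|i s IH].
    by under eq_fun do rewrite big_nil; exact: measurable_cst.
  under eq_fun do rewrite big_cons; apply: measurable_maxr => //.
  by apply: measurableT_comp => //; exact: mw.
have [B B0 pB] := polyf_bounded r' pp.
have imax : P.-integrable setT (EFin \o (fun t => max_norm (w t))).
  apply: bounded_integrable => //; exists (B + e / 3) => t.
  have := hp _ (wr t); have := pB _ (wr t); rewrite !ler_norml => /andP[? ?] /andP[? ?].
  by apply/andP; split; lra.
have h1 : \int[P]_t p (w t) <= \int[P]_t max_norm (w t) + e / 3.
  have -> : e / 3 = \int[P]_t (e / 3).
    by rewrite Rintegral_probability_cst.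
  rewrite -RintegralD//; last exact: finite_measure_integrable_cst.
  apply: le_Rintegral => //; first exact: polyf_integrable.
    exact: (integrableD measurableT imax (finite_measure_integrable_cst _ (e / 3) measurableT)).
  by move=> t _; have := hp _ (wr t); rewrite ler_norml => /andP[? ?]; lra.
have /cvgrPdist_le/(_ _ e30) := gp.
apply: filterS => n; rewrite ler_norml => /andP[? ?].
have : average (fun v => max_norm (a n v)) <= average (fun v => p (a n v)) + e / 3.
  apply: le_averageD => // v.
  have : `|p (a n v) - max_norm (a n v)| <= e / 3.
    by apply: hp => i; apply: le_trans rr'; exact: ar.
  by rewrite ler_norml => /andP[? ?]; lra.
lra.
Qed.

End bounded.
End moments.

Section unbounded_moments.
Context d (T : measurableType d) (R : realType) (P : probability T R).
Context (k : nat) (r : R) (V : nat -> finType).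
Context (a : forall n, V n -> 'I_k -> R) (w : T -> 'I_k -> R).
Arguments a : clear implicits.
Hypothesis V0 : forall n, (0 < #|V n|)%N.
Hypothesis ar : forall n v i, `|a n v i| <= r.
Hypothesis mw : forall i, measurable_fun setT (fun t => w t i).
Hypothesis iw : forall s : seq 'I_k,
  P.-integrable setT (EFin \o (fun t => \prod_(i <- s) w t i)).
Hypothesis moments : forall s : seq 'I_k,
  average (fun v => \prod_(i <- s) a n v i) @[n --> \oo] -->
  \int[P]_t \prod_(i <- s) w t i.

Let r' := `|r| + 1.
Let r'0 : 0 < r'. Proof. by rewrite /r' ltr_wpDl. Qed.


Lemma power_moment_le i j : (\int[P]_t ((w t i ^+ 2) ^+ j)%:E <= ((`|r| ^+ 2) ^+ j)%:E)%E.
Proof.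
have E (b : 'I_k -> R) : \prod_(l <- nseq (2 * j) i) b l = (b i ^+ 2) ^+ j.
  by rewrite big_nseq iter_mulr_1 exprM.
have iE : P.-integrable setT (EFin \o (fun t => (w t i ^+ 2) ^+ j)).
  by have := iw (nseq (2 * j) i); under [in X in integrable _ _ X]eq_fun do rewrite E.
have -> : (\int[P]_t ((w t i ^+ 2) ^+ j)%:E = (\int[P]_t (w t i ^+ 2) ^+ j)%:E)%E.
  by rewrite /Rintegral fineK//; exact: integrable_fin_num.
have := @moments (nseq (2 * j) i); under eq_Rintegral do rewrite E.
move=> /cvgr_to_le; rewrite lee_fin; apply; near=> n.
rewrite -[leRHS](average_cst _ (V0 n)); apply: le_average => v; rewrite E.
rewrite lerXn2r ?nnegrE ?sqr_ge0//.
by rewrite -real_normK ?num_real// lerXn2r ?nnegrE// (le_trans (ar v i))// ler_norm.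
Unshelve. all: by end_near. Qed.

Let A i := [set t | r' <= `|w t i|].

Let mA i : measurable (A i).
Proof.
rewrite [X in measurable X](_ : _ = setT `&` (fun t => `|w t i|) @^-1` `[r', +oo[%classic).
  by apply: (measurableT_comp _ (mw i)) => //; exact: measurable_itv.
by rewrite setTI; apply/seteqP; split=> t /=; rewrite in_itv/= andbT.
Qed.

(** Chebyshev with all even powers: [r' ^ (2 * j) * P (A i) <= |r| ^ (2 * j)] for every [j], and the
    margin 1 in [r'] makes the ratio less than 1. *)
Lemma large_values_null i : P (A i) = 0%E.
Proof.
have fA : P (A i) \is a fin_num by exact: fin_num_measure.
have PA j : (r' ^+ 2) ^+ j * fine (P (A i)) <= (`|r| ^+ 2) ^+ j.
  rewrite -lee_fin EFinM fineK//; apply: le_trans (power_moment_le i j).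
  rewrite -integral_cst//; apply: (@le_trans _ _ (\int[P]_(t in A i) ((w t i ^+ 2) ^+ j)%:E)%E).
    apply: ge0_le_integral => //.
    - by move=> t _; rewrite lee_fin exprn_ge0// sqr_ge0.
    - by apply/measurable_EFinP/measurable_funX/measurable_funX/measurable_funTS.
    - move=> t At; rewrite lee_fin lerXn2r ?nnegrE ?sqr_ge0//.
      by rewrite -(@real_normK _ (w t i)) ?num_real// lerXn2r ?nnegrE// (ltW r'0).
  apply: ge0_subset_integral => //.
    by apply/measurable_EFinP/measurable_funX/measurable_funX.
  by move=> t _; rewrite lee_fin exprn_ge0// sqr_ge0.
pose q := (`|r| ^+ 2) / r' ^+ 2.
have r20 : 0 < r' ^+ 2 by rewrite exprn_gt0.
have q1 : `|q| < 1.
  rewrite ger0_norm ?divr_ge0 ?sqr_ge0// ltr_pdivrMr// mul1r.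
  by rewrite ltrXn2r ?nnegrE// ?(ltW r'0)// /r' ltrDl.
have : fine (P (A i)) <= 0.
  have /cvgr_to_ge := cvg_expr q1; apply; near=> j.
  rewrite /q expr_div_n ler_pdivlMr ?exprn_gt0// mulrC; exact: PA.
rewrite -lee_fin fineK// => h; apply/eqP; rewrite eq_le h/=; exact: measure_ge0.
Unshelve. all: by end_near. Qed.

(** Clipping [w] to [[- r', r']] changes it only on a null set, so the moments are kept and the
    bounded case applies. *)
Lemma average_max_norm_near M e : 0 < e ->
  (\int[P]_t (max_norm (w t))%:E <= M%:E)%E ->
  \forall n \near \oo, average (fun v => max_norm (a n v)) <= M + e.
Proof.
move=> e0 wM; pose w' t i := Num.max (- r') (Num.min r' (w t i)).
have mw' i : measurable_fun setT (fun t => w' t i).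
  by apply: measurable_maxr => //; apply: measurable_minr.
have w'r t i : `|w' t i| <= r'.
  rewrite /w' ler_norml le_max lexx/= ge_max; apply/andP; split.
    by rewrite ge0_cp ?(ltW r'0).
  by rewrite ge_min lexx.
have w'w t i : `|w' t i| <= `|w t i|.
  have [wr|rw] := leP `|w t i| r'; last exact: le_trans (w'r t i) (ltW rw).
  by move: wr; rewrite ler_norml /w' => /andP[h1 h2]; rewrite min_r// max_r.
have w'E : {ae P, forall t, forall i, w' t i = w t i}.
  apply: filter_forall => i; exists (A i); split => //; first exact: large_values_null.
  move=> t /= h; rewrite /A/= leNgt; apply/negP => /ltW; rewrite ler_norml => /andP[h1 h2].
  by apply: h; rewrite /w' min_r// max_r.
have mmax (v : T -> 'I_k -> R) : (forall i, measurable_fun setT (fun t => v t i)) ->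
    measurable_fun setT (fun t => max_norm (v t)).
  move=> mv; rewrite /max_norm; elim: (index_enum _) => [|i s IH].
    by under eq_fun do rewrite big_nil; exact: measurable_cst.
  under eq_fun do rewrite big_cons; apply: measurable_maxr => //.
  by apply: measurableT_comp => //; exact: mv.
have rr' : r <= r' by apply: le_trans (ler_norm r) _; rewrite /r' lerDl.
have moments' (s : seq 'I_k) : average (fun v => \prod_(i <- s) a n v i) @[n --> \oo] -->
    \int[P]_t \prod_(i <- s) w' t i.
  rewrite (_ : \int[P]_t _ = \int[P]_t \prod_(i <- s) w t i); first exact: moments.
  congr fine; apply: ae_eq_integral => //.
  - apply/measurable_EFinP; apply: measurable_prod => i _; exact: mw'.
  - apply/measurable_EFinP; apply: measurable_prod => i _; exact: mw.
  - by apply: filterS w'E => t h _; congr EFin; apply: eq_bigr => i _.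
have := average_max_norm_bounded V0 ar mw' rr' w'r moments' e0.
apply: filterS => n /le_trans; apply; rewrite lerD2r.
have h : (\int[P]_t (max_norm (w' t))%:E <= M%:E)%E.
  apply: le_trans wM; apply: ge0_le_integral => //.
  - by move=> t _; rewrite lee_fin /max_norm; elim/big_ind: _ => // x y x0 y0; rewrite le_max x0.
  - by apply/measurable_EFinP; exact: mmax.
  - by apply/measurable_EFinP; exact: mmax.
  - move=> t _; rewrite lee_fin /max_norm.
    elim/big_ind2: _ => // x1 x2 y1 y2 h1 h2.
    by rewrite ge_max !le_max h1 h2 orbT.
rewrite -lee_fin /Rintegral fineK//.
rewrite ge0_fin_numE; first exact: le_lt_trans h (ltry _).
apply: integral_ge0 => t _; rewrite lee_fin /max_norm.
by elim/big_ind: _ => // x y x0 y0; rewrite le_max x0.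
Qed.

End unbounded_moments.

(** * Partitions into cells and scalar martingales *)

Lemma cauchy_real_cvg (R : realType) (u : nat -> R) :
  (forall e, 0 < e -> exists N, forall n m, (N <= n)%N -> (n <= m)%N -> `|u m - u n| <= e) ->
  cvg (u n @[n --> \oo]).
Proof.
move=> h; apply: cauchy_cvg; apply: cauchy_exP => e e0.
have e20 : 0 < e / 2 by rewrite divr_gt0.
have [N hN] := h _ e20; exists (u N).
exists N => // m /= Nm; rewrite /ball/= distrC.
by apply: le_lt_trans (hN _ _ (leqnn N) Nm) _; lra.
Qed.

Section cells.
Context d (T : measurableType d).
Implicit Types (P S : seq (set T)) (A C : set T).

(** A partition is represented by a list of generating sets; its cells are all the intersections of
    these sets or their complements, empty ones included. Concatenating two lists then generates the
    common refinement. *)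
Fixpoint cells P : seq (set T) :=
  if P is A :: P' then
    [seq A `&` C | C <- cells P'] ++ [seq ~` A `&` C | C <- cells P']
  else [:: setT].

Definition all_measurable P := forall A, A \in P -> measurable A.

Lemma all_measurable_cat P S : all_measurable P -> all_measurable S ->
  all_measurable (S ++ P).
Proof. by move=> mP mS A; rewrite mem_cat => /orP[/mS|/mP]. Qed.

Lemma all_measurable_cons P A : all_measurable (A :: P) ->
  measurable A /\ all_measurable P.
Proof.
move=> mAP; split; first by apply: mAP; rewrite mem_head.
by move=> B BP; apply: mAP; rewrite inE BP orbT.
Qed.

Lemma measurable_cells P C : all_measurable P -> C \in cells P -> measurable C.
Proof.
elim: P C => [|A P IH] C /= mP; first by rewrite inE => /eqP ->; exact: measurableT.
have [mA {}mP] := all_measurable_cons mP.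
by rewrite mem_cat => /orP[] /mapP[D DP ->]; apply: measurableI => //;
  [exact: IH|exact: measurableC|exact: IH].
Qed.

Lemma cells_cat P S : cells (S ++ P) = [seq D `&` C | D <- cells S, C <- cells P].
Proof.
elim: S => [|A S IH] /=.
  by rewrite cats0 -[LHS]map_id; apply: eq_map => C; rewrite setTI.
rewrite IH allpairs_cat !allpairs_mapl !map_allpairs.
by congr (_ ++ _); apply: eq_allpairs => D C; rewrite setIA.
Qed.

Lemma big_cells_cat (V : nmodType) P S (F : set T -> V) :
  \sum_(B <- cells (S ++ P)) F B =
  \sum_(C <- cells P) \sum_(D <- cells S) F (D `&` C).
Proof. by rewrite cells_cat big_allpairs_dep/= exchange_big. Qed.

(** Stated as splitting [C] along [A], the form in which [cells] adds one generator. *)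
Definition finitely_additive (V : zmodType) (f : set T -> V) :=
  forall A C, measurable A -> measurable C -> f C = f (A `&` C) + f (~` A `&` C).

Lemma sum_cells (V : zmodType) (f : set T -> V) P C :
  finitely_additive f -> all_measurable P -> measurable C ->
  \sum_(D <- cells P) f (D `&` C) = f C.
Proof.
move=> fA + mC; elim: P => [|A P IH] mP /=; first by rewrite big_seq1 setTI.
have [mA {}mP] := all_measurable_cons mP.
rewrite big_cat/= !big_map -big_split/= -[RHS](IH mP).
apply: eq_big_seq => D DP /=.
by rewrite -!setIA -fA//; apply: measurableI => //; exact: measurable_cells DP.
Qed.

End cells.

(** On the unit ball a product of functionals is bounded and Lipschitz in its factors, so closeness
    in L^1 of each scalar martingale passes to mixed moments. One constant serves for both bounds,
    which keeps the induction simple. *)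
Lemma prod_diff_bound (R : realType) (X : normedModType R) (s : seq (dual X)) :
  exists2 K : R, 0 <= K & forall u v : X, `|u| <= 1 -> `|v| <= 1 ->
    `|\prod_(F <- s) (F u : R)| <= K /\
    `|\prod_(F <- s) (F u : R) - \prod_(F <- s) (F v : R)| <=
      K * \sum_(F <- s) `|F u - F v : R|.
Proof.
elim: s => [|F s [K K0 IH]].
  by exists 1 => // u v _ _; rewrite !big_nil subrr normr0 mulr0 normr1.
have [C C0 FC] := dual_bounded F.
exists (K * (1 + C)); first by rewrite mulr_ge0// addr_ge0.
move=> u v u1 v1; have [h1 h2] := IH u v u1 v1; rewrite !big_cons.
have Fw w : `|w| <= 1 -> `|F w : R| <= C.
  by move=> w1; apply: le_trans (FC w) _; rewrite ler_piMr.
split.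
  rewrite normrM mulrC ler_pM//; apply: le_trans (Fw _ u1) _; lra.
set A := \prod_(_ <- s) _ in h1 h2 *; set B := \prod_(_ <- s) _ in h2 *.
have -> : (F u : R) * A - (F v : R) * B = (F u - F v) * A + (F v : R) * (A - B).
  rewrite /=; ring.
apply: le_trans (ler_normD _ _) _; rewrite !normrM.
have s0 : 0 <= \sum_(F <- s) `|F u - F v : R| by rewrite sumr_ge0.
have e1 : `|F u - F v : R| * `|A| <= `|F u - F v : R| * K by rewrite ler_wpM2l.
have e2 : `|F v : R| * `|A - B| <= C * (K * \sum_(F <- s) `|F u - F v : R|).
  by rewrite ler_pM// Fw.
have e3 : 0 <= K * C * `|F u - F v : R| by rewrite !mulr_ge0.
have e4 : 0 <= K * \sum_(F <- s) `|F u - F v : R| by rewrite mulr_ge0.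
nra.
Qed.

Section martingale.
Context d (T : measurableType d) (R : realType) (X : normedModType R).
Variables (l : set T -> R) (nu : set T -> X).
Hypothesis l_add : finitely_additive l.
Hypothesis l_ge0 : forall A, measurable A -> 0 <= l A.
Hypothesis l_T : l setT = 1.
Hypothesis nu_add : finitely_additive nu.
Hypothesis nu_l : forall A, measurable A -> `|nu A| <= l A.
Implicit Types (P S : seq (set T)) (A C : set T) (F : dual X).

(** When [l C = 0] the inverse is 0 and so is the density; this is consistent with [nu], as
    [|nu C| <= l C] makes [nu C] vanish too. *)
Definition density C : X := (l C)^-1 *: nu C.

Lemma densityE C : measurable C -> l C *: density C = nu C.
Proof.
move=> mC; rewrite /density scalerA; have [lC|lC] := eqVneq (l C) 0.
  by rewrite lC mul0r scale0r; apply/esym/eqP; rewrite -normr_le0 -lC nu_l.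
by rewrite mulfV// scale1r.
Qed.

Lemma density_le1 C : measurable C -> `|density C| <= 1.
Proof.
move=> mC; rewrite /density normrZ.
have [lC|lC] := eqVneq (l C) 0; first by rewrite lC invr0 normr0 mul0r.
have lC0 : 0 < l C by rewrite lt_neqAle eq_sym lC l_ge0.
by rewrite gtr0_norm ?invr_gt0// ler_pdivrMl// mulr1 nu_l.
Qed.

Lemma sum_cells_l P : all_measurable P -> \sum_(C <- cells P) l C = 1.
Proof.
move=> mP; rewrite -l_T -(sum_cells l_add mP (@measurableT _ T)).
by apply: eq_bigr => C _; rewrite setIT.
Qed.

Definition expect P (g : set T -> R) := \sum_(C <- cells P) l C * g C.

(** The L^1(l) distance between two terms of a scalar martingale, the values of [F] along [P] and
    along its refinement [S ++ P]; [gap2] is the squared L^2 distance. *)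
Definition gap1 F S P := \sum_(C <- cells P) \sum_(D <- cells S)
  l (D `&` C) * `|F (density (D `&` C)) - F (density C) : R|.

Let gap2 F S P := \sum_(C <- cells P) \sum_(D <- cells S)
  l (D `&` C) * (F (density (D `&` C)) - F (density C) : R) ^+ 2.

Let sumD_l S C : all_measurable S -> measurable C ->
  \sum_(D <- cells S) l (D `&` C) = l C.
Proof. exact: sum_cells. Qed.

Let cells_ge0 P C : all_measurable P -> C \in cells P -> 0 <= l C.
Proof. by move=> mP CP; apply: l_ge0; exact: measurable_cells CP. Qed.

Let measI P S C D : all_measurable P -> all_measurable S ->
  C \in cells P -> D \in cells S -> measurable (D `&` C).
Proof.
by move=> mP mS CP DS; apply: measurableI;
  [exact: measurable_cells DS|exact: measurable_cells CP].
Qed.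

(** Orthogonality of martingale increments: on each cell [C] the mean of the finer values is the
    coarser one, so the cross term cancels. *)
Let gap2E F S P : all_measurable P -> all_measurable S ->
  gap2 F S P = expect (S ++ P) (fun B => (F (density B) : R) ^+ 2) -
    expect P (fun B => (F (density B) : R) ^+ 2).
Proof.
move=> mP mS; rewrite /expect big_cells_cat -sumrB; apply: eq_big_seq => C CP.
have mC := measurable_cells mP CP.
set y := F (density C) : R.
pose z D := F (density (D `&` C)) : R.
have lz D : D \in cells S -> l (D `&` C) * z D = F (nu (D `&` C)) :> R.
  by move=> DS; rewrite -[in RHS](densityE (measI mP mS CP DS)) linearZ.
transitivity (\sum_(D <- cells S) (l (D `&` C) * z D ^+ 2 - 2 * y * (l (D `&` C) * z D)
    + y ^+ 2 * l (D `&` C))).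
  by apply: eq_bigr => D _; rewrite -/(z D) -/y; ring.
have slz : \sum_(D <- cells S) l (D `&` C) * z D = l C * y.
  by rewrite (eq_big_seq _ lz) -linear_sum sum_cells// -densityE// linearZ.
by rewrite big_split/= sumrB -!mulr_sumr sumD_l// slz; ring.
Qed.

Let expect_sqr_bounded F : exists K, forall P, all_measurable P ->
  expect P (fun B => (F (density B) : R) ^+ 2) <= K.
Proof.
have [C C0 FC] := dual_bounded F; exists (C ^+ 2) => P mP.
rewrite -[leRHS]mul1r -(sum_cells_l mP) mulr_suml.
rewrite /expect big_seq [leRHS]big_seq; apply: ler_sum => B BP.
rewrite ler_wpM2l ?(cells_ge0 mP)// -real_normK ?num_real//.
rewrite lerXn2r ?nnegrE//; apply: le_trans (FC _) _.
by rewrite ler_piMr// density_le1//; exact: measurable_cells BP.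
Qed.

(* AM-GM: [|x| <= e + x^2 / e] *)
Let gap1_le F S P e : all_measurable P -> all_measurable S -> 0 < e ->
  gap1 F S P <= e + e^-1 * gap2 F S P.
Proof.
move=> mP mS e0; rewrite -[X in _ <= X + _]mulr1 -(sum_cells_l mP) !mulr_sumr -big_split/=.
rewrite /gap1 big_seq [leRHS]big_seq; apply: ler_sum => C CP.
rewrite -(sumD_l mS (measurable_cells mP CP)) !mulr_sumr -big_split/=.
rewrite big_seq [leRHS]big_seq; apply: ler_sum => D DS.
set t := _ - _; have lD : 0 <= l (D `&` C) by apply/l_ge0/(measI mP mS).
rewrite mulrCA [e * _]mulrC -mulrDr ler_wpM2l// -(@real_normK _ t) ?num_real//.
set s := `|t|; rewrite -(ler_pM2l e0) mulrDr mulVKf ?gt_eqF//.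
by have := sqr_ge0 (s - e); have := sqr_ge0 (s + e); nra.
Qed.

Section refining.
Variables (P_ S_ : nat -> seq (set T)).
Hypothesis mS : forall n, all_measurable (S_ n).
Hypothesis P0 : P_ 0%N = [::].
Hypothesis PS : forall n, P_ n.+1 = S_ n ++ P_ n.

Lemma refining_measurable n : all_measurable (P_ n).
Proof.
by elim: n => [|n IH]; [rewrite P0|rewrite PS; exact: all_measurable_cat].
Qed.

Lemma refining_cat n m : (n <= m)%N ->
  exists2 S, all_measurable S & P_ m = S ++ P_ n.
Proof.
elim: m => [|m IH]; first by rewrite leqn0 => /eqP ->; exists [::].
rewrite leq_eqVlt => /predU1P[->|]; first by exists [::].
rewrite ltnS => /IH[S mS' PmE]; exists (S_ m ++ S); first exact: all_measurable_cat.
by rewrite PS PmE catA.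
Qed.

Lemma gap1_refining F e : 0 < e -> exists N, forall n m S,
  (N <= n)%N -> (n <= m)%N -> all_measurable S -> P_ m = S ++ P_ n ->
  gap1 F S (P_ n) <= e.
Proof.
move=> e0; pose E n := expect (P_ n) (fun B => (F (density B) : R) ^+ 2).
have E_mono : nondecreasing_seq E.
  move=> n m /refining_cat[S mS' PE]; rewrite -subr_ge0 /E PE.
  rewrite -gap2E//; last exact: refining_measurable.
  rewrite /gap2 big_seq sumr_ge0// => C CP; rewrite big_seq sumr_ge0// => D DS.
  rewrite mulr_ge0 ?sqr_ge0//.
  by apply/l_ge0/(measI (@refining_measurable n) mS' CP DS).
have E_cvg : cvgn E.
  apply: nondecreasing_is_cvgn => //; have [K EK] := expect_sqr_bounded F.
  by exists K => _ [n _ <-]; apply: EK; exact: refining_measurable.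
(* The inequality of [gap1_le] at [e / 2] needs [E m - E n <= (e / 2) ^ 2]; each of the two terms is
   put within half of that from the limit. *)
have d0 : 0 < (e / 2) ^+ 2 / 2 by rewrite divr_gt0// exprn_gt0// divr_gt0.
have /cvgrPdist_le/(_ _ d0)[N _ hN] := E_cvg.
exists N => n m S Nn nm mS' PE.
have e20 : 0 < e / 2 by rewrite divr_gt0.
apply: le_trans (gap1_le F (@refining_measurable n) mS' e20) _.
have := hN n Nn; have := hN m (leq_trans Nn nm).
rewrite gap2E//; last exact: refining_measurable.
rewrite -PE -/(E n) -/(E m) !ler_norml => /andP[? ?] /andP[? ?].
have h : E m - E n <= (e / 2) ^+ 2 by lra.
suff : (e / 2)^-1 * (E m - E n) <= e / 2 by lra.
by rewrite ler_pdivrMl// -expr2.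
Qed.

(** The sequence is Cauchy: by [prod_diff_bound], the change from [P_ n] to a refinement is at most
    a constant times the sum of the scalar gaps. *)
Lemma expect_prod_cvg (s : seq (dual X)) :
  cvg (expect (P_ n) (fun C => \prod_(F <- s) (F (density C) : R)) @[n --> \oo]).
Proof.
have [K K0 HK] := prod_diff_bound s.
have small e : 0 < e -> exists N, forall n m S,
    (N <= n)%N -> (n <= m)%N -> all_measurable S -> P_ m = S ++ P_ n ->
    \sum_(F <- s) gap1 F S (P_ n) <= e.
  elim: (s) e => [|F s' IH] e e0; first by exists 0%N => *; rewrite big_nil ltW.
  have e20 : 0 < e / 2 by rewrite divr_gt0.
  have [N1 h1] := gap1_refining F e20; have [N2 h2] := IH _ e20.
  exists (maxn N1 N2) => n m S; rewrite geq_max => /andP[Nn1 Nn2] nm mS' PE.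
  by rewrite big_cons; have := h1 _ _ _ Nn1 nm mS' PE; have := h2 _ _ _ Nn2 nm mS' PE; lra.
apply: cauchy_real_cvg => e e0.
have K1 : 0 < K + 1 by rewrite ltr_wpDl.
have [N hN] := small _ (divr_gt0 e0 K1).
exists N => n m Nn nm; have [S mS' PE] := refining_cat nm.
have mP := @refining_measurable n.
apply: (@le_trans _ _ (K * \sum_(F <- s) gap1 F S (P_ n))); last first.
  apply: (@le_trans _ _ ((K + 1) * \sum_(F <- s) gap1 F S (P_ n))).
    rewrite ler_wpM2r ?lerDl// sumr_ge0// => F _.
    rewrite /gap1 big_seq sumr_ge0// => C CP; rewrite big_seq sumr_ge0// => D DS.
    by rewrite mulr_ge0//; apply/l_ge0/(measI mP mS' CP DS).
  by rewrite -ler_pdivlMl// mulrC; exact: hN Nn nm mS' PE.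
rewrite PE /expect big_cells_cat -sumrB.
have -> : \sum_(F <- s) gap1 F S (P_ n) = \sum_(C <- cells (P_ n)) \sum_(D <- cells S)
    l (D `&` C) * \sum_(F <- s) `|F (density (D `&` C)) - F (density C) : R|.
  rewrite /gap1 exchange_big/=; apply: eq_bigr => C _.
  by rewrite exchange_big/=; apply: eq_bigr => D _; rewrite mulr_sumr.
rewrite mulr_sumr; apply: le_trans (ler_norm_sum _ _ _) _.
rewrite big_seq [leRHS]big_seq; apply: ler_sum => C CP.
have mC := measurable_cells mP CP.
rewrite -(sumD_l mS' mC) mulr_suml -sumrB mulr_sumr.
apply: le_trans (ler_norm_sum _ _ _) _.
rewrite big_seq [leRHS]big_seq; apply: ler_sum => D DS.
have mDC := measI mP mS' CP DS.
rewrite -mulrBr normrM ger0_norm ?l_ge0// mulrCA ler_wpM2l ?l_ge0//.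
by have [] := HK _ _ (density_le1 mDC) (density_le1 mC).
Qed.

(** The monotonicity under refinement behind two arguments: the transfer of the seminorm bound from
    late to early partitions, and the variation of [nu]. *)
Lemma sum_cells_subadditive (phi : X -> R) P S :
  (forall x y, phi (x + y) <= phi x + phi y) -> phi 0 = 0 ->
  all_measurable P -> all_measurable S ->
  \sum_(C <- cells P) phi (nu C) <= \sum_(B <- cells (S ++ P)) phi (nu B).
Proof.
move=> phiD phi0 mP mS'; rewrite big_cells_cat big_seq [leRHS]big_seq.
apply: ler_sum => C CP; rewrite -(sum_cells nu_add mS' (measurable_cells mP CP)).
by elim/big_rec2: _ => [|D x y _ h]; [rewrite phi0|apply: le_trans (phiD _ _) _; rewrite lerD2l].
Qed.

End refining.
End martingale.

(** * Densities of sum graphs and star graphs *)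

(** Label [i] gets [k i] vertices, the integer part of [N * p i] plus one, so the excesses [th i]
    lie in [0, 1] and [#|V| >= N]. The total error is at most [2 * #|I| / N], which the choice of
    [N] makes [1 / (n + 1)]. *)
Lemma uniform_labelling (R : realType) (I : finType)
    (p : I -> R) (n : nat) :
  (forall i, 0 <= p i) -> \sum_i p i = 1 ->
  exists (V : finType) (lab : V -> I), (0 < #|V|)%N /\
    forall (X : normedModType R) (g : I -> X) B, (forall i, `|g i| <= B) ->
      `|(#|V|%:R)^-1 *: (\sum_v g (lab v)) - \sum_i p i *: g i| <= B / n.+1%:R.
Proof.
move=> p0 p1.
have [i0 _] : exists i : I, true.
  apply: contrapT => /forallNP h; move: p1; rewrite big1 => [|i _].
    by move/eqP; rewrite eq_sym oner_eq0.
  by case: (h i).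
have I0 : (0 < #|I|)%N by apply/card_gt0P; exists i0.
pose N := (2 * #|I| * n.+1)%N.
have N0 : (0 : R) < N%:R by rewrite ltr0n !muln_gt0 I0.
pose k i := (Num.truncn (N%:R * p i)).+1.
pose V : finType := {i : I & 'I_(k i)}.
have sumV (M : zmodType) (g : I -> M) : \sum_(v : V) g (tag v) = \sum_i g i *+ k i.
  rewrite -(@sig_big_dep _ _ _ _ (fun i => 'I_(k i)) xpredT (fun=> xpredT) (fun i _ => g i))/=.
  by apply: eq_bigr => i _; rewrite sumr_const card_ord.
pose th i : R := (k i)%:R - N%:R * p i.
have th_itv i : 0 <= th i <= 1.
  have Np0 : 0 <= N%:R * p i by rewrite mulr_ge0 ?(ltW N0).
  have /andP[] := truncn_itv Np0; rewrite /th /k -natr1; lra.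
have cardV : #|V|%:R = N%:R + \sum_i th i :> R.
  rewrite -sum1_card natr_sum (sumV R (fun=> 1)) /th sumrB -mulr_sumr p1 mulr1.
  by rewrite addrC subrK; apply: eq_bigr => i _.
have th0 : 0 <= \sum_i th i by rewrite sumr_ge0// => i _; have /andP[] := th_itv i.
have thI : \sum_i th i <= #|I|%:R.
  rewrite -sum1_card natr_sum; apply: ler_sum => i _.
  by have /andP[] := th_itv i.
have V0 : (0 : R) < #|V|%:R by rewrite cardV; lra.
exists V, (@tag I _); split; first by rewrite -(ltr0n R).
move=> X g B gB.
have B0 : 0 <= B by apply: le_trans (gB i0).
rewrite sumV scaler_sumr -sumrB.
have -> : \sum_i ((#|V|%:R)^-1 *: (g i *+ k i) - p i *: g i) =
    \sum_i ((#|V|%:R)^-1 * (th i - (\sum_j th j) * p i)) *: g i.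
  apply: eq_bigr => i _; rewrite -[g i *+ _]scaler_nat scalerA -scalerBl; congr (_ *: _).
  have -> : th i - (\sum_j th j) * p i = (k i)%:R - #|V|%:R * p i.
    by rewrite cardV /th; ring.
  by rewrite mulrBr mulKf// gt_eqF.
apply: le_trans (ler_norm_sum _ _ _) _.
apply: (@le_trans _ _ (\sum_i (#|V|%:R^-1 * (th i + (\sum_j th j) * p i)) * B)).
  apply: ler_sum => i _; rewrite normrZ ler_pM// normrM ger0_norm ?invr_ge0//.
  rewrite ler_wpM2l ?invr_ge0//; apply: le_trans (ler_normB _ _) _.
  by have /andP[? _] := th_itv i; rewrite !ger0_norm// mulr_ge0.
rewrite -mulr_suml -mulr_sumr big_split/= -mulr_sumr p1 mulr1 mulrC ler_wpM2l//.
rewrite ler_pdivrMl// ler_pdivlMr ?ltr0n// cardV.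
have -> : N%:R = 2 * #|I|%:R * n.+1%:R :> R by rewrite !natrM.
have n1 : (1 : R) <= n.+1%:R by rewrite ler1n.
have := ler_wpM2r (ler0n R n.+1) thI.
move: th0 n1; set y := \sum_i _; lra.
Qed.

Lemma eq_is_cvgn (R : realType) (v u : nat -> R) :
  (forall n, u n = v n) -> cvg (v @ \oo) -> cvg (u @ \oo).
Proof. by move=> /funext ->. Qed.

Section sum_graph.
Context (R : realType) (X : normedModType R).

Definition sum_graph (V : finType) (V0 : (0 < #|V|)%N) (g : V -> X) : target_graph X :=
  TargetGraph V0 (fun u v => addrC (g u) (g v)).

Lemma average_ffun_prod (I V : finType) (H : I -> V -> R) :
  (#|V|%:R ^+ #|I|)^-1 * \sum_(phi : {ffun I -> V}) \prod_i H i (phi i) =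
  \prod_i average (H i).
Proof.
rewrite -(bigA_distr_bigA H) /average big_split/= prodr_const; congr (_ * _).
by rewrite exprVn.
Qed.

(** An intermediate stage of the expansion: the edges in [es] still carry a sum, while [L i]
    collects the functionals already moved to vertex [i]. *)
Let edge_density (I V : finType) (g : V -> X) (es : seq (I * I * dual X))
    (L : I -> seq (dual X)) : R :=
  (#|V|%:R ^+ #|I|)^-1 * \sum_(phi : {ffun I -> V})
    (\prod_(e <- es) ((e.2 (g (phi e.1.1)) : R) + (e.2 (g (phi e.1.2)) : R)) *
     \prod_i \prod_(F <- L i) (F (g (phi i)) : R)).

Let add_at (I : finType) (i : I) (F : dual X) (L : I -> seq (dual X)) j :=
  if j == i then F :: L j else L j.

Let prod_add_at (I : finType) (i : I) F L (x : I -> X) :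
  \prod_j \prod_(G <- add_at i F L j) (G (x j) : R) =
  (F (x i) : R) * \prod_j \prod_(G <- L j) (G (x j) : R).
Proof.
rewrite (bigD1 i)//= [in RHS](bigD1 i)//= mulrA; congr (_ * _).
  by rewrite /add_at eqxx big_cons.
by apply: eq_bigr => j /negbTE ji; rewrite /add_at ji.
Qed.

(* Expanding the sum at one edge moves its decoration to one of its endpoints. *)
Let edge_density_cvg (I : finType) (V : nat -> finType) (g : forall n, V n -> X) :
  (forall s : seq (dual X), cvg (average (fun v => \prod_(F <- s) (F (g n v) : R)) @[n --> \oo])) ->
  forall (es : seq (I * I * dual X)) (L : I -> seq (dual X)),
    cvg (edge_density (@g n) es L @[n --> \oo]).
Proof.
move=> h; elim=> [|[[i j] F] es IH] L.
  apply: (@eq_is_cvgn _ (fun n => \prod_i average (fun v => \prod_(F <- L i) (F (g n v) : R)))).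
    move=> n; rewrite -average_ffun_prod /edge_density; congr (_ * _).
    by apply: eq_bigr => phi _; rewrite big_nil mul1r.
  elim: (index_enum I) => [|i s IH].
    apply: (@eq_is_cvgn _ (fun=> 1)); last exact: is_cvg_cst.
    by move=> n; rewrite big_nil.
  apply: (@eq_is_cvgn _ (fun n => average (fun v => \prod_(F <- L i) (F (g n v) : R)) *
      \prod_(j <- s) average (fun v => \prod_(F <- L j) (F (g n v) : R)))).
    by move=> n; rewrite big_cons.
  exact: (is_cvgM (h (L i)) IH).
have -> : (fun n => edge_density (@g n) ((i, j, F) :: es) L) =
    (fun n => edge_density (@g n) es (add_at i F L) + edge_density (@g n) es (add_at j F L)).
  apply/funext => n; rewrite /edge_density -mulrDr -big_split/=; congr (_ * _).
  by apply: eq_bigr => phi _; rewrite big_cons !prod_add_at/=; ring.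
by apply: is_cvgD; exact: IH.
Qed.

Lemma sum_graph_density_cvg (V : nat -> finType) (V0 : forall n, (0 < #|V n|)%N)
    (g : forall n, V n -> X) :
  (forall s : seq (dual X), cvg (average (fun v => \prod_(F <- s) (F (g n v) : R)) @[n --> \oo])) ->
  forall F : test_graph X, cvg (target_density F (sum_graph (V0 n) (@g n)) @[n --> \oo]).
Proof.
move=> h F.
pose es := [seq (e, F e.1 e.2) | e <- index_enum _ & @edge _ _ F e].
have := @edge_density_cvg _ _ _ h es (fun=> [::]).
rewrite (_ : (fun n => edge_density _ _ _) =
  (fun n => target_density F (sum_graph (V0 n) (@g n))))//.
apply/funext => n; rewrite /edge_density /target_density; congr (_ * _).
apply: eq_bigr => phi _; rewrite [X in _ * X]big1 ?mulr1 => [|i _]; last by rewrite big_nil.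
by rewrite /es big_map big_filter; apply: eq_bigr => e _; rewrite linearD.
Qed.

End sum_graph.

(** * Star graphs: conditioning on the image of the centre *)

Section star.
Context (R : realType) (X : normedModType R).
Variables (r : nat) (f : 'I_r -> dual X) (f0 : dual X).

(** The centre is [ord0] and the leaves are [lift ord0 j]; [f0] supplies the value of [leaf] at the
    centre. *)
Let leaf (i : 'I_r.+1) : dual X := if unlift ord0 i is Some k then f k else f0.

Let star_adj (i j : 'I_r.+1) := (i == ord0) (+) (j == ord0).

Let star_dec (i j : 'I_r.+1) := if i == ord0 then leaf j else leaf i.

Let star_adj_sym : symmetric star_adj.
Proof. by move=> i j; rewrite /star_adj addbC. Qed.

Let star_adj_irr : irreflexive star_adj.
Proof. by move=> i; rewrite /star_adj addbb. Qed.

Let star_sym i j : star_adj i j -> star_dec i j = star_dec j i.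
Proof.
by rewrite /star_adj /star_dec; case: (eqVneq i ord0) => _; case: (eqVneq j ord0) => _.
Qed.

Definition star : test_graph X :=
  TestGraph star_adj_sym star_adj_irr star_sym.

(** The centre has rank 0, so every edge is listed with the centre first. The weight [Phi] is
    abstract in order to cover both target graphs and graphons. *)
Lemma prod_star_edge (Phi : 'I_r.+1 -> 'I_r.+1 -> dual X -> R) :
  \prod_(e | @edge _ _ star e) Phi e.1 e.2 (star e.1 e.2) =
  \prod_(j < r) Phi ord0 (lift ord0 j) (f j).
Proof.
rewrite -(pair_big_dep xpredT (fun i j => @edge _ _ star (i, j))
  (fun i j => Phi i j (star i j)))/=.
rewrite big_ord_recl/= [X in _ * X]big1 ?mulr1 => [|i _]; last first.
  apply: big1 => j; rewrite /edge/= /star_adj /= !enum_rank_ord/=.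
  by have [->|] := eqVneq j ord0; rewrite ?ltn0 ?andbF.
rewrite big_mkcond big_ord_recl/= {1}/edge/= /star_adj/= mul1r.
apply: eq_bigr => j _; rewrite /edge/= /star_adj/= !enum_rank_ord/=.
by rewrite /star_dec/= /leaf liftK.
Qed.

Lemma star_target_density (G : target_graph X) :
  target_density star G =
  average (fun u => \prod_(j < r) average (fun v => (f j (G u v) : R))).
Proof.
rewrite /target_density.
under eq_bigr => phi _ do
  rewrite (prod_star_edge (fun i j F => (F (G (phi i) (phi j)) : R))).
(* Conditioning on the image [u] of the centre is written as an indicator factor at the centre, so
   that the sum over all maps factorizes over the vertices. *)
pose H u (i : 'I_r.+1) v : R :=
  if unlift ord0 i is Some k then (f k (G u v) : R) else (v == u)%:R.
have HE u (phi : {ffun 'I_r.+1 -> tg_vertex G}) : \prod_i H u i (phi i) =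
    (phi ord0 == u)%:R * \prod_(j < r) (f j (G u (phi (lift ord0 j))) : R).
  rewrite big_ord_recl /H unlift_none; congr (_ * _).
  by apply: eq_bigr => j _; rewrite liftK.
have -> : \sum_(phi : {ffun 'I_r.+1 -> tg_vertex G})
    \prod_(j < r) (f j (G (phi ord0) (phi (lift ord0 j))) : R) =
    \sum_u \sum_(phi : {ffun 'I_r.+1 -> tg_vertex G}) \prod_i H u i (phi i).
  rewrite exchange_big/=; apply: eq_bigr => phi _.
  rewrite (bigD1 (phi ord0))//= HE eqxx mul1r [X in _ = _ + X]big1 ?addr0// => u.
  by rewrite HE eq_sym => /negbTE ->; rewrite mul0r.
rewrite mulr_sumr.
under eq_bigr => u _ do rewrite average_ffun_prod.
rewrite /average mulr_sumr; apply: eq_bigr => u _.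
rewrite big_ord_recl; congr (_ * _).
  rewrite /H unlift_none (bigD1 u)//= eqxx big1 ?addr0 ?mulr1// => v.
  by move=> /negbTE ->.
by apply: eq_bigr => j _; rewrite /H liftK.
Qed.

Lemma star_graphon_density (W : R * R -> X) :
  graphon_density star W =
  \int[unit_cube R r.+1]_t \prod_(j < r)
    (f j (W (tnth t ord0, tnth t (lift ord0 j))) : R).
Proof.
rewrite /graphon_density /=.
(* The dimension of the cube is a cardinal equal to [r.+1] only propositionally; abstracting it
   together with the ranks allows substitution. *)
have key n (rk : 'I_r.+1 -> 'I_n) : n = r.+1 -> (forall i, rk i = i :> nat) ->
    \int[unit_cube R n]_t \prod_(e | @edge _ _ star e)
      (star e.1 e.2 (W (tnth t (rk e.1), tnth t (rk e.2))) : R) =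
    \int[unit_cube R r.+1]_t \prod_(j < r)
      (f j (W (tnth t ord0, tnth t (lift ord0 j))) : R).
  move=> nr; subst n => rkE; have -> : rk = id by apply/funext => i; apply: val_inj; exact: rkE.
  congr fine; apply: eq_integral => t _; congr EFin.
  exact: (prod_star_edge (fun i j F => (F (W (tnth t i, tnth t j)) : R))).
apply: key; first exact: card_ord.
by move=> i; rewrite enum_rank_ord.
Qed.

End star.

(** * Marginals of Bochner graphons *)

Section product_integral.
Context d1 d2 (T1 : measurableType d1) (T2 : measurableType d2) (R : realType).
Variables (m1 : {sigma_finite_measure set T1 -> \bar R})
  (m2 : {sigma_finite_measure set T2 -> \bar R}).
Variables (f : T1 -> R) (g : T2 -> R).
Hypotheses (intf : m1.-integrable setT (EFin \o f)) (intg : m2.-integrable setT (EFin \o g)).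

Let mf : measurable_fun setT f. Proof. by apply/measurable_EFinP; exact: measurable_int intf. Qed.
Let mg : measurable_fun setT g. Proof. by apply/measurable_EFinP; exact: measurable_int intg. Qed.

Lemma integrable_product :
  (m1 \x m2)%E.-integrable setT (EFin \o (fun z => f z.1 * g z.2)).
Proof.
have mfg : measurable_fun setT (EFin \o (fun z : T1 * T2 => f z.1 * g z.2)).
  by apply/measurable_EFinP; apply: measurable_funM; exact: measurableT_comp.
apply/(integrable12ltyP _ _ mfg) => /=.
rewrite (eq_integral (fun x => `|f x|%:E * \int[m2]_y `|(g y)%:E|)%E); last first.
  move=> x _; rewrite -ge0_integralZl//; last by do 2 apply: measurableT_comp => //.
  by apply: eq_integral => y _; rewrite normrM EFinM.
rewrite ge0_integralZr//; last 2 first.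
  by do 2 apply: measurableT_comp => //.
  by apply: integral_ge0.
have /integrableP[_ f1] := intf; have /integrableP[_ g1] := intg.
apply: lte_mul_pinfty => //; first exact: integral_ge0.
by rewrite ge0_fin_numE//; exact: integral_ge0.
Qed.

Lemma Rintegral_product :
  \int[(m1 \x m2)%E]_z (f z.1 * g z.2) = \int[m1]_x f x * \int[m2]_y g y.
Proof.
rewrite /Rintegral -(integral12_prod_meas1 integrable_product) /fubini_F/=.
rewrite (eq_integral (fun x => (f x)%:E * (\int[m2]_y g y)%:E)%E); last first.
  move=> x _; rewrite /Rintegral fineK; last exact: integrable_fin_num.
  by rewrite -integralZl//.
by rewrite integralZr// fineM//; exact: integrable_fin_num.
Qed.

End product_integral.

Section unit_cube_integral.
Context (R : realType).
Local Notation U := (@unit_interval R).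
Local Notation T := (measurableTypeR R).

Lemma unit_cube_coordinate r (j : 'I_r) (A : set T) : measurable A ->
  unit_cube R r [set t | A (tnth t j)] = U A.
Proof.
move=> mA; pose B i := if i == j then A else setT.
have -> : [set t : r.-tuple T | A (tnth t j)] = [set t | forall i, B i (tnth t i)].
  apply/seteqP; split=> t /=; last by move/(_ j); rewrite /B eqxx.
  by move=> At i; rewrite /B; case: eqP => [->|].
rewrite unit_cube_box; last by move=> i; rewrite /B; case: eqP.
rewrite (bigD1 j)//= {1}/B eqxx big1 ?mule1// => i /negbTE ij.
by rewrite /B ij setTI lebesgue_measure_itv/= lte01 oppr0 adde0.
Qed.

Lemma integral_unit_cube_prod r (b : 'I_r -> T -> R) :
  (forall j, U.-integrable setT (EFin \o b j)) ->
  (unit_cube R r).-integrable setT (EFin \o (fun t => \prod_j b j (tnth t j))) /\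
  \int[unit_cube R r]_t (\prod_j b j (tnth t j)) = \prod_j \int[U]_x b j x.
Proof.
elim: r b => [|r IH] b ib.
  split; first by under eq_fun do rewrite big_ord0; exact: finite_measure_integrable_cst.
  by rewrite big_ord0; under eq_Rintegral do rewrite big_ord0; rewrite Rintegral_probability_cst.
have [iB EB] := IH (fun j => b (lift ord0 j)) (fun j => ib _).
have mb j : measurable_fun setT (b j).
  by apply/measurable_EFinP; exact: measurable_int (ib j).
have mprod : measurable_fun setT
    (EFin \o (fun t : r.+1.-tuple T => \prod_j b j (tnth t j))).
  apply/measurable_EFinP; apply: measurable_prod => j _.
  by apply: measurableT_comp => //; exact: measurable_tnth.
have E : (EFin \o (fun t : r.+1.-tuple T => \prod_j b j (tnth t j))) \o @tcons R r =
    EFin \o (fun z => b ord0 z.1 * \prod_j b (lift ord0 j) (tnth z.2 j)).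
  apply/funext => z /=; rewrite big_ord_recl; congr (_ * _)%:E.
  by apply: eq_bigr => j _; rewrite tnthS.
have iE := integrable_product (ib ord0) iB.
split.
  by apply: integrable_pushforward => //; rewrite ?preimage_setT ?E.
rewrite big_ord_recl -EB -(Rintegral_product (ib ord0) iB) /Rintegral.
by rewrite integral_pushforward//; rewrite preimage_setT E.
Qed.

Definition pair_coordinate r (j : 'I_r) (z : T * r.-tuple T) : T * T := (z.1, tnth z.2 j).

Lemma measurable_pair_coordinate r (j : 'I_r) : measurable_fun setT (pair_coordinate j).
Proof.
apply: measurable_fun_pair => //.
exact: (measurableT_comp (@measurable_tnth _ _ _ j) measurable_snd).
Qed.

HB.instance Definition _ r (j : 'I_r) := isMeasurableFun.Build _ _ _ _ _
  (@measurable_pair_coordinate r j).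

(** The centre and one leaf are jointly uniform on the square; it suffices to check rectangles. *)
Lemma prod_pair_coordinate r (j : 'I_r) (A : set (T * T)) : measurable A ->
  (U \x unit_cube R r)%E (pair_coordinate j @^-1` A) = unit_square R A.
Proof.
move=> mA; apply/esym.
apply: (@product_measure_unique _ _ _ _ _ U U
  (distribution (U \x unit_cube R r)%E (@pair_coordinate r j))) => // B C mB mC.
rewrite /pushforward/=.
have -> : pair_coordinate j @^-1` (B `*` C) = B `*` [set t | C (tnth t j)].
  by apply/seteqP; split=> -[].
rewrite product_measure1E//; first by congr (_ * _)%E; exact: unit_cube_coordinate.
by rewrite -[X in measurable X]setTI; exact: measurable_tnth.
Qed.

Lemma integrable_pair_coordinate r (j : 'I_r) (h : T * T -> R) :
  (unit_square R).-integrable setT (EFin \o h) ->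
  (U \x unit_cube R r)%E.-integrable setT (EFin \o (h \o pair_coordinate j)).
Proof.
move=> ih; have mh : measurable_fun setT h.
  by apply/measurable_EFinP; exact: measurable_int ih.
have /integrableP[_ hoo] := ih.
apply/integrableP; split.
  by apply/measurable_EFinP; apply: measurableT_comp => //; exact: measurable_pair_coordinate.
apply: le_lt_trans hoo; rewrite le_eqVlt; apply/orP; left; apply/eqP.
rewrite [RHS](_ : _ = \int[distribution (U \x unit_cube R r)%E (@pair_coordinate r j)]_x
    `|(h x)%:E|)%E; last first.
  by apply: eq_measure_integral => A mA _; exact: (esym (prod_pair_coordinate j mA)).
rewrite ge0_integral_pushforward//=.
by apply/measurable_EFinP; apply: measurableT_comp => //; exact: mh.
Qed.

(** Dominates a star integrand by separate edge terms, whose integrability follows from that of all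
    powers of the norm of the graphon. The summand 1 covers [r = 0]. *)
Lemma prod_norm_le r (c : 'I_r -> R) :
  `|\prod_j c j| <= 1 + \sum_j `|c j| ^+ r.
Proof.
pose M := \big[Num.max/0]_j `|c j|.
have cM j : `|c j| <= M by rewrite /M; exact: le_bigmax.
have M0 : 0 <= M by rewrite /M; exact: bigmax_ge_id.
have h1 : `|\prod_j c j| <= M ^+ r.
  rewrite normr_prod -[r in leRHS]card_ord -prodr_const.
  by apply: ler_prod => j _; rewrite normr_ge0 cM.
apply: le_trans h1 _.
have s0 : 0 <= \sum_j `|c j| ^+ r by rewrite sumr_ge0// => j _; rewrite exprn_ge0.
have [r0|r0] := posnP r; first by rewrite [X in M ^+ X]r0 expr0 lerDl.
have [Mc|[j Mj]] : M = 0 \/ exists j, M = `|c j|.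
- rewrite /M; elim/big_rec: _ => [|j x _ [->|[i ->]]]; first by left.
    by rewrite maxElt; case: ifP => _; [left|right; exists j].
  by right; rewrite maxElt; case: ifP => _; [exists i|exists j].
- by rewrite Mc expr0n gtn_eqF//= addr_ge0.
- by rewrite Mj (bigD1 j)//= addrCA lerDl addr_ge0// sumr_ge0// => i _; rewrite exprn_ge0.
Qed.

Section star_integral.
Variables (r : nat) (a : 'I_r -> T * T -> R).
Hypothesis ma : forall j, measurable_fun setT (a j).
Hypothesis ia : forall j p,
  (unit_square R).-integrable setT (EFin \o (fun z => `|a j z| ^+ p)).

Let Phi (z : T * r.-tuple T) := \prod_j a j (z.1, tnth z.2 j).

Let mPhi : measurable_fun setT Phi.
Proof.
apply: measurable_prod => j _.
exact: (measurableT_comp (ma j) (measurable_pair_coordinate j)).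
Qed.

Let iPhi : (U \x unit_cube R r)%E.-integrable setT (EFin \o Phi).
Proof.
pose b j y := `|a j y| ^+ r.
apply: (@le_integrable _ _ _ _ _ measurableT _
    (EFin \o (fun z => 1 + \sum_j b j (pair_coordinate j z)))).
- exact/measurable_EFinP.
- move=> z _; rewrite /= lee_fin; apply: le_trans (ler_norm _).
  exact: (prod_norm_le (fun j => a j (z.1, tnth z.2 j))).
- rewrite (_ : EFin \o _ = (cst 1%:E \+ (fun z => \sum_j
      (EFin \o (b j \o pair_coordinate j)) z)))%E; last first.
    by apply/funext => z /=; rewrite EFinD -sumEFin.
  apply: integrableD => //.
    pose P : probability _ R := (U \x unit_cube R r)%E.
    exact: (@finite_measure_integrable_cst _ _ R P setT 1 measurableT).
  apply: integrable_sum => // j _.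
  by apply: integrable_pair_coordinate; exact: ia.
Qed.

Let w j x := \int[U]_y a j (x, y).

Lemma measurable_star_marginal j : measurable_fun setT (w j).
Proof.
have ij : (unit_square R).-integrable setT (EFin \o a j).
  apply/integrableP; split; first exact/measurable_EFinP.
  have /integrableP[_] := ia j 1.
  by under eq_integral do rewrite /= expr1 normr_id.
apply: measurableT_comp => //; exact: (measurable_fubini_F ij).
Qed.

Let wE : {ae U, forall x, \int[unit_cube R r]_t (Phi (x, t))%:E = (\prod_j w j x)%:E}%E.
Proof.
have : {ae U, forall x, forall j, U.-integrable setT (fun y => (a j (x, y))%:E)}.
  apply: filter_forall => j.
  have ij : (unit_square R).-integrable setT (EFin \o a j).
    apply/integrableP; split; first exact/measurable_EFinP.
    have /integrableP[_] := ia j 1.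
    by under eq_integral do rewrite /= expr1 normr_id.
  exact: (ae_integrable1 ij).
apply: filterS => x ix.
have [h1 h2] := integral_unit_cube_prod (b := fun j y => a j (x, y)) ix.
rewrite -h2 /Rintegral fineK//; exact: integrable_fin_num.
Qed.

Lemma integrable_star_marginal : U.-integrable setT (EFin \o (fun x => \prod_j w j x)).
Proof.
have mw : measurable_fun setT (EFin \o (fun x => \prod_j w j x)).
  by apply/measurable_EFinP; apply: measurable_prod => j _; exact: measurable_star_marginal.
have iF := integrable_fubini_F iPhi.
apply/integrableP; split => //.
have /integrableP[mF] := iF; apply: le_lt_trans.
rewrite le_eqVlt; apply/orP; left; apply/eqP; apply: ae_eq_integral => //.
- exact: measurableT_comp.
- exact: measurableT_comp.
- by apply: filterS wE => x h _; congr abse; exact: (esym h).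
Qed.

(** For a fixed centre [x] the leaf coordinates are independent, so the inner integral is a product
    of marginals. This holds for almost every [x] only, since Fubini gives integrable sections
    almost everywhere. *)
Lemma star_integral :
  \int[unit_cube R r.+1]_t \prod_j a j (tnth t ord0, tnth t (lift ord0 j)) =
  \int[U]_x \prod_j w j x.
Proof.
have mprod : measurable_fun setT (EFin \o (fun t : r.+1.-tuple T =>
    \prod_j a j (tnth t ord0, tnth t (lift ord0 j)))).
  apply/measurable_EFinP; apply: measurable_prod => j _.
  apply: measurableT_comp => //; apply: measurable_fun_pair; exact: measurable_tnth.
have E : (EFin \o (fun t : r.+1.-tuple T =>
    \prod_j a j (tnth t ord0, tnth t (lift ord0 j)))) \o @tcons R r = EFin \o Phi.
  apply/funext => z /=; congr EFin; apply: eq_bigr => j _.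
  by rewrite tnthS.
rewrite /Rintegral integral_pushforward//; last by rewrite preimage_setT E.
rewrite preimage_setT E; congr fine.
rewrite -(integral12_prod_meas1 iPhi); apply: ae_eq_integral => //.
- exact: (measurable_fubini_F iPhi).
- exact: (measurable_int _ integrable_star_marginal).
- by apply: filterS wE => x h _.
Qed.

End star_integral.
End unit_cube_integral.

(** * Integrals of functions that need not be measurable *)

Section nonmeasurable_integrands.
Context d (T : measurableType d) (R : realType) (mu : {measure set T -> \bar R}).
Local Open Scope ereal_scope.
Import HBNNSimple.

(** The integral of a nonnegative function is a supremum over the simple functions below it, hence
    monotone without measurability. This matters for norms of functions that are limits of simple
    functions only almost everywhere. *)
Lemma ge0_le_integral_nonmeasurable (D : set T) (f g : T -> \bar R) :
  (forall x, 0 <= f x) -> (forall x, f x <= g x) ->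
  \int[mu]_(x in D) f x <= \int[mu]_(x in D) g x.
Proof.
move=> f0 fg; rewrite integral_mkcond [leRHS]integral_mkcond.
have f0' x : 0 <= (f \_ D) x by rewrite patchE; case: ifP.
have fg' x : (f \_ D) x <= (g \_ D) x by rewrite !patchE; case: ifP.
have g0' x : 0 <= (g \_ D) x by exact: le_trans (f0' x) (fg' x).
rewrite !ge0_integralTE//; apply: le_ereal_sup => _ [h hf <-].
exists h => // x.
exact: le_trans (hf x) (fg' x).
Qed.

(** A simple function below [f], set to 0 on [N], keeps its integral and lies below [g]. *)
Let ge0_eq_integral_null (N : set T) (f g : T -> \bar R) :
  measurable N -> mu N = 0 -> (forall x, 0 <= f x) -> (forall x, 0 <= g x) ->
  (forall x, ~ N x -> f x = g x) -> \int[mu]_x f x = \int[mu]_x g x.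
Proof.
move=> mN N0; move: f g.
suff le f g : (forall x, 0 <= f x) -> (forall x, 0 <= g x) ->
    (forall x, ~ N x -> f x = g x) -> \int[mu]_x f x <= \int[mu]_x g x.
  move=> f g f0 g0 fg; apply/eqP; rewrite eq_le le//= le// => x Nx.
  exact/esym/fg.
move=> f0 g0 fg; rewrite !ge0_integralTE//; apply: ge_ereal_sup => _ [h hf <-].
pose h' := proj_nnsfun h (measurableC mN).
have -> : sintegral mu h = sintegral mu h'.
  rewrite -!integralT_nnsfun; apply: ge0_ae_eq_integral => //.
  - by apply/measurable_EFinP.
  - by apply/measurable_EFinP.
  - by move=> x _; rewrite lee_fin.
  - by move=> x _; rewrite lee_fin.
  - exists N; split => // x /= hx; apply: contrapT => Nx; apply: hx => _.
    by rewrite /= mindicE mem_set// mulr1.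
apply: ereal_sup_ubound; exists h' => // x /=.
have [Nx|Nx] := pselect (N x).
  by rewrite mindicE memNset ?mulr0//=; apply.
by rewrite mindicE mem_set// mulr1 -fg.
Qed.

Lemma eq_integral_null (N : set T) (f g : T -> \bar R) :
  measurable N -> mu N = 0 -> (forall x, ~ N x -> f x = g x) ->
  \int[mu]_x f x = \int[mu]_x g x.
Proof.
move=> mN N0 fg; rewrite integralE [RHS]integralE; congr (_ - _).
  apply: (ge0_eq_integral_null mN N0) => // x Nx; by rewrite !funeposE fg.
apply: (ge0_eq_integral_null mN N0) => // x Nx; by rewrite !funenegE fg.
Qed.

End nonmeasurable_integrands.

Section simple_preimage.
Context d (T : measurableType d) (R : realType) (X : normedModType R).
Implicit Types s : T -> X.

Lemma simple_preimage s (B : set X) : simple_function s -> measurable (s @^-1` B).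
Proof.
move=> [fs ms].
have -> : s @^-1` B = \bigcup_(x in range s `&` B) s @^-1` [set x].
  apply/seteqP; split=> [t Bt|t [x [_ Bx] /= ->]]//.
  by exists (s t) => //; split => //; exists t.
apply: fin_bigcup_measurable => // ; exact: finite_setIl.
Qed.

End simple_preimage.

Section simple_functions.
Context d (T : measurableType d) (R : realType) (X : normedModType R).
Implicit Types s : T -> X.

Lemma simple_preimage2 (Y : normedModType R) (Z : Type) (h : X -> Y -> Z) s
    (s' : T -> Y) (B : set Z) :
  simple_function s -> simple_function s' ->
  measurable ((fun t => h (s t) (s' t)) @^-1` B).
Proof.
move=> ss ss'.
have -> : (fun t => h (s t) (s' t)) @^-1` B =
    \bigcup_(x in range s) (s @^-1` [set x] `&` s' @^-1` [set y | B (h x y)]).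
  apply/seteqP; split=> [t Bt|t [x _ [/= <-]]]//.
  by exists (s t) => //; exists t.
apply: fin_bigcup_measurable => [|x _]; first exact: ss.1.
by apply: measurableI; exact: simple_preimage.
Qed.

Lemma measurable_simple2 (h : X -> X -> R) s s' :
  simple_function s -> simple_function s' ->
  measurable_fun setT (fun t => h (s t) (s' t)).
Proof. by move=> ss ss' _ B mB; rewrite setTI; exact: simple_preimage2. Qed.

Lemma measurable_simple (h : X -> R) s :
  simple_function s -> measurable_fun setT (h \o s).
Proof. by move=> ss; exact: (measurable_simple2 (fun x _ => h x) ss ss). Qed.

Lemma simple_function2 (Y Z : normedModType R) (h : X -> Y -> Z) s (s' : T -> Y) :
  simple_function s -> simple_function s' -> simple_function (fun t => h (s t) (s' t)).
Proof.
move=> ss ss'; split=> [|x]; last exact: simple_preimage2.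
apply: (@sub_finite_set _ _ ((fun z => h z.1 z.2) @` (range s `*` range s'))).
  by move=> _ [t _ <-]; exists (s t, s' t) => //; split; exists t.
apply: finite_image; apply: finite_setX; [exact: ss.1|exact: ss'.1].
Qed.

Lemma simple_function_restrict s (N : set T) : measurable N -> simple_function s ->
  simple_function (fun t => if t \in N then 0 else s t).
Proof.
move=> mN ss; split=> [|x].
  apply: (@sub_finite_set _ _ ([set 0] `|` range s)).
    by move=> _ [t _ <-]; case: ifP => _; [left|right; exists t].
  by rewrite finite_setU; split => //; exact: ss.1.
have -> : (fun t => if t \in N then 0 else s t) @^-1` [set x] =
    (N `&` [set t | 0 = x]) `|` (~` N `&` s @^-1` [set x]).
  apply/seteqP; split=> t /=.
    by case: ifPn => [/set_mem Nt ->|/negP Nt ->]; [left|right; split => // /mem_set].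
  by case=> -[Nt <-]; [rewrite mem_set|rewrite memNset].
apply: measurableU; last by apply: measurableI; [exact: measurableC|exact: ss.2].
have [->|x0] := eqVneq x 0.
  by rewrite (_ : [set t | _] = setT) ?setIT//; apply/seteqP; split.
rewrite (_ : [set t | _] = set0) ?setI0//; apply/seteqP; split => // t /= /esym/eqP.
by rewrite (negbTE x0).
Qed.

(** Setting everything to 0 on the exceptional null set makes convergence hold everywhere, so that
    continuous functions of the new limit are measurable. *)
Lemma strongly_measurable_approx (mu : {finite_measure set T -> \bar R}) (f : T -> X) :
  strongly_measurable mu f -> exists N (s_ : nat -> T -> X),
    [/\ measurable N, mu N = 0%E, forall n, simple_function (s_ n) &
      forall t, s_ n t @[n --> \oo] --> (if t \in N then 0 else f t)].
Proof.
move=> [s_ [ss [N [mN N0 Ncvg]]]].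
exists N, (fun n t => if t \in N then 0 else s_ n t); split => //.
  by move=> n; exact: simple_function_restrict.
move=> t; case: ifPn => [_|/negP Nt]; first exact: cvg_cst.
by apply: contrapT => h; apply: Nt; apply/mem_set/Ncvg.
Qed.

End simple_functions.

Section graphon_marginals.
Context (R : realType) (X : normedModType R).
Local Notation U := (@unit_interval R).
Local Notation T := (measurableTypeR R).
Local Notation U2 := (unit_square R).
Variable W : R * R -> X.
Hypothesis Wgraphon : bochner_graphon W.

Variables (N : set (T * T)) (s_ : nat -> T * T -> X).
Hypotheses (mN : measurable N) (N0 : U2 N = 0%E).
Hypothesis ss : forall n, simple_function (s_ n).

Let W' (z : T * T) : X := if z \in N then 0 else W z.

Hypothesis sW : forall z, s_ n z @[n --> \oo] --> W' z.

Lemma measurable_continuous_comp (h : X -> R) : continuous h -> measurable_fun setT (h \o W').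
Proof.
move=> ch; apply: (@measurable_fun_cvg _ _ _ _ (fun n => h \o s_ n)) => [n|z _].
  exact: measurable_simple.
by apply: continuous_cvg; [exact: ch|exact: sW].
Qed.

Lemma integrable_norm_power p : U2.-integrable setT (EFin \o (fun z => `|W' z| ^+ p)).
Proof.
have mp : measurable_fun setT (EFin \o (fun z => `|W' z| ^+ p)).
  apply/measurable_EFinP/measurable_funX.
  by apply: (measurable_continuous_comp (h := fun x => `|x|)) => x; exact: norm_continuous.
case: p mp => [|p] mp.
  by rewrite (_ : EFin \o _ = EFin \o cst 1)//; exact: finite_measure_integrable_cst.
apply/integrableP; split => //.
have [_ _ /(_ p.+1%:R)] := Wgraphon; rewrite ler1n => /(_ isT) fin.
have p0 : p.+1%:R != 0 :> R by rewrite pnatr_eq0.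
have := powR_Lnorm U2 (EFin \o (fun z => `|W z|)) p0.
have := poweR_lty p.+1%:R fin.
move=> /[swap] -> ; apply: le_lt_trans.
(* The norm of [W] itself may fail to be measurable; only its modification [W'] is known to have
   measurable norm. *)
apply: ge0_le_integral_nonmeasurable => // z.
rewrite /= !normr_id powR_mulrn// lee_fin ger0_norm ?exprn_ge0//.
rewrite /W'; case: ifP => _; last by [].
by rewrite normr0 lerXn2r// nnegrE.
Qed.

Let w (F : dual X) x : R := \int[U]_y (F (W' (x, y)) : R).

Let mF (F : dual X) : measurable_fun setT (fun z => F (W' z) : R).
Proof. by apply: (measurable_continuous_comp (h := F)); exact: dual_continuous. Qed.

Let iF (F : dual X) p : U2.-integrable setT (EFin \o (fun z => `|F (W' z) : R| ^+ p)).
Proof.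
have [C C0 FC] := dual_bounded F.
apply: (@le_integrable _ _ _ _ _ measurableT _ (EFin \o (fun z => C ^+ p * `|W' z| ^+ p))).
- apply/measurable_EFinP/measurable_funX.
  by apply: measurableT_comp => //; exact: mF.
- move=> z _; rewrite /= lee_fin normrX normr_id [leRHS]ger0_norm ?mulr_ge0 ?exprn_ge0//.
  by rewrite -exprMn lerXn2r ?nnegrE ?mulr_ge0//; exact: FC.
- exact: (integrableZl measurableT (C ^+ p) (integrable_norm_power p)).
Qed.

Lemma graphon_density_star r (f : 'I_r -> dual X) f0 :
  graphon_density (star f f0) W = \int[U]_x \prod_j w (f j) x.
Proof.
rewrite star_graphon_density.
have := star_integral (a := fun j z => f j (W' z) : R) (fun j => mF (f j)) (fun j => iF (f j)).
move=> /= <-; rewrite /Rintegral; congr fine.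
(* [W] and [W'] give different integrands only where some pair of centre and leaf falls in [N]; each
   such event is null since the pair is uniform on the square. *)
pose M := \big[setU/set0]_(j < r) ((fun t : r.+1.-tuple T => (tnth t ord0, tnth t (lift ord0 j))) @^-1` N).
have mpair j : measurable_fun setT (fun t : r.+1.-tuple T => (tnth t ord0, tnth t (lift ord0 j))).
  exact: (measurable_fun_pair (@measurable_tnth _ T r.+1 ord0)
    (@measurable_tnth _ T r.+1 (lift ord0 j))).
have mj j : measurable ((fun t : r.+1.-tuple T => (tnth t ord0, tnth t (lift ord0 j))) @^-1` N).
  by rewrite -[X in measurable X]setTI; exact: mpair.
have [mM M0] : measurable M /\ unit_cube R r.+1 M = 0%E.
  pose null A := measurable A /\ unit_cube R r.+1 A = 0%E.
  apply: (big_ind null) => [|A B [mA A0] [mB B0]|j _].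
  - by split => //; exact: measure0.
  - split; first exact: measurableU.
    apply/eqP; rewrite -measure_le0.
    by apply: le_trans (measureU2 _ mA mB) _; rewrite [X in (X + _)%E]A0 [X in (_ + X)%E]B0 adde0.
  - split; first exact: mj.
    rewrite /= /distribution /pushforward.
    rewrite -[RHS]N0 -(prod_pair_coordinate j mN); congr (_ _).
    by apply/seteqP; split=> -[x t]; rewrite /tcons /pair_coordinate/= tnthS.
apply: (eq_integral_null mM M0).
move=> t Mt; congr EFin; apply: eq_bigr => j _; congr (f j _).
  rewrite /W' memNset//= => Nt; apply: Mt.
  by rewrite /M -bigcup_seq; exists j => //; exact: mem_index_enum.
Qed.

Lemma integrable_marginals r (f : 'I_r -> dual X) :
  U.-integrable setT (EFin \o (fun x => \prod_j w (f j) x)).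
Proof.
exact: (integrable_star_marginal (a := fun j z => f j (W' z) : R)
  (fun j => mF (f j)) (fun j => iF (f j))).
Qed.

Lemma measurable_marginal F : measurable_fun setT (w F).
Proof.
exact: (measurable_star_marginal (r := 1) (a := fun j z => F (W' z) : R)
  (fun j => mF F) (fun j => iF F) ord0).
Qed.

Lemma marginal_max_norm k (f : 'I_k -> dual X) (b : T * T -> R) :
  measurable_fun setT b -> (forall z, 0 <= b z) ->
  (forall i z, `|f i (W' z) : R| <= b z) ->
  (\int[U]_x (max_norm (fun i => w (f i) x))%:E <= \int[U2]_z (b z)%:E)%E.
Proof.
move=> mb b0 fb.
have mbE : measurable_fun setT (EFin \o b) by apply/measurable_EFinP.
have b0E z : (0 <= (EFin \o b) z)%E by rewrite lee_fin.
rewrite (_ : (\int[U2]_z (b z)%:E = \int[U]_x fubini_F U (EFin \o b) x)%E); last first.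
  exact: (@fubini_tonelli1 _ _ _ _ _ U U _ mbE b0E).
apply: ge0_le_integral_nonmeasurable => x.
  by rewrite lee_fin /max_norm; elim/big_ind: _ => // u v u0 v0; rewrite le_max u0.
have F0 : (0 <= fubini_F U (EFin \o b) x)%E by apply: integral_ge0.
have mx (h : T * T -> R) : measurable_fun setT h -> measurable_fun setT (fun y => h (x, y)).
  by move=> mh; apply: (measurableT_comp mh); exact: measurable_pair1.
rewrite /max_norm; elim/big_ind: _ => // [u v hu hv|i _].
  by rewrite EFin_max ge_max hu.
apply: (@le_trans _ _ (`|\int[U]_y (f i (W' (x, y)) : R)%:E|)%E).
  (* [fine] sends an infinite integral to 0, so the bound survives at points [x] whose section is
     not integrable. *)
  by rewrite /w /Rintegral; case: (integral _ _ _) => //= ; rewrite normr0 leey.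
apply: (@le_trans _ _ (\int[U]_y `|(f i (W' (x, y)) : R)%:E|)%E).
  by apply: le_abse_integral => //; apply/measurable_EFinP; exact: mx (mF (f i)).
apply: ge0_le_integral_nonmeasurable => y //.
by rewrite /= lee_fin.
Qed.

End graphon_marginals.

(** Here strong measurability is used: [zs] is the range of a simple function [s_ n] close to [W']
    in the mean. The seminorm is at most [eps] on that range, hence at most [b n z + eps] at [W' z],
    and each of the two summands integrates to at most [eps]. *)
Lemma graphon_star_marginals (R : realType) (X : normedModType R) (W : R * R -> X) (eps : R) :
  bochner_graphon W -> 0 < eps ->
  exists (zs : seq X) (w : dual X -> measurableTypeR R -> R),
    [/\ forall F, measurable_fun setT (w F),
      forall r (f : 'I_r -> dual X),
        (@unit_interval R).-integrable setT (EFin \o (fun x => \prod_j w (f j) x)),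
      forall r (f : 'I_r -> dual X) f0,
        graphon_density (star f f0) W = \int[@unit_interval R]_x \prod_j w (f j) x
    & forall k (f : 'I_k -> dual X),
        (forall i x, `|f i x : R| <= net_norm eps zs x) ->
        (\int[@unit_interval R]_x (max_norm (fun i => w (f i) x))%:E <= (2 * eps)%:E)%E].
Proof.
move=> Wg eps0.
have [smW _ _] := Wg.
have [N [s_ [mN N0 ss sW]]] := strongly_measurable_approx smW.
pose W' z : X := if z \in N then 0 else W z.
(* The functions [s_] come without a majorant; the minimum with the norm of [W'] provides one for
   dominated convergence, and the seminorm stays below the norm anyway. *)
pose b n z := Num.min `|W' z| `|W' z - s_ n z|.
have mnorm : measurable_fun setT (fun z => `|W' z|).
  by apply: (measurable_continuous_comp ss sW (h := fun x => `|x|)) => x; exact: norm_continuous.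
have mb n : measurable_fun setT (b n).
  apply: measurable_minr => //.
  apply: (@measurable_fun_cvg _ _ _ _ (fun k z => `|s_ k z - s_ n z|)) => [k|z _].
    exact: (measurable_simple2 (fun x y => `|x - y|) (ss k) (ss n)).
  apply: cvg_norm; apply: cvgB; [exact: sW|exact: cvg_cst].
have b0 n z : 0 <= b n z by rewrite /b le_min !normr_ge0.
have inorm : (unit_square R).-integrable setT (EFin \o (fun z => `|W' z|)).
  have := integrable_norm_power Wg ss sW 1.
  by rewrite (_ : (fun z => _ ^+ 1) = (fun z => `|W' z|)).
have [n hn] : exists n, (\int[unit_square R]_z (b n z)%:E <= eps%:E)%E.
  have [|||||_ _ h] := @dominated_convergence _ _ _ (unit_square R) setT measurableT
    (fun n => EFin \o b n) (cst 0%E) (EFin \o (fun z => `|W' z|)).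
  - by move=> n; apply/measurable_EFinP.
  - exact: measurable_cst.
  - apply: aeW => z _; apply: cvg_EFin; first by near=> n.
    apply: (@squeeze_cvgr _ _ _ _ (fun=> 0) (fun n => `|W' z - s_ n z|)).
    + by near=> n; rewrite b0 /b ge_min lexx orbT.
    + exact: cvg_cst.
    + rewrite -(normr0 X) -(subrr (W' z)).
      by apply: cvg_norm; apply: cvgB; [exact: cvg_cst|exact: sW].
  - exact: inorm.
  - by apply: aeW => z n _ /=; rewrite lee_fin ger0_norm// /b ge_min lexx.
  have h0 : (fun n => \int[unit_square R]_z (b n z)%:E)%E @ \oo --> 0%E.
    by move: h; rewrite integral_cst// mul0e.
  have /fine_cvgP[fin h1] := h0.
  have /cvgrPdist_le/(_ _ eps0) h2 := h1.
  near \oo => n; exists n.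
  have nfin : (\int[unit_square R]_z (b n z)%:E)%E \is a fin_num by near: n.
  rewrite -(fineK nfin) lee_fin.
  have : `|0 - fine (\int[unit_square R]_z (b n z)%:E)%E| <= eps by near: n.
  by rewrite sub0r normrN; apply: le_trans; exact: ler_norm.
have [/finite_seqP[zs zsE] _] := ss n.
exists zs, (fun F x => \int[@unit_interval R]_y (F (W' (x, y)) : R)); split.
- exact: measurable_marginal.
- exact: integrable_marginals.
- exact: graphon_density_star.
- move=> k f fq.
  have fb i z : `|f i (W' z) : R| <= b n z + eps.
    apply: le_trans (fq _ _) _; have snn := seminorm_net_norm zs (ltW eps0).
    have h1 := net_norm_le_norm zs (W' z) (ltW eps0).
    have h2 : net_norm eps zs (W' z) <= `|W' z - s_ n z| + eps.
      rewrite -[X in net_norm _ _ X](subrK (s_ n z)); apply: le_trans (snn.1 _ _) _.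
      apply: lerD; first exact: net_norm_le_norm (ltW eps0).
      apply: net_norm_mem (ltW eps0) _.
      have : range (s_ n) (s_ n z) by exists z.
      by rewrite zsE.
    by rewrite /b /Num.min; case: ifP => _; lra.
  have mbe : measurable_fun setT (fun z => b n z + eps) by exact: measurable_funD.
  have be0 z : 0 <= b n z + eps by rewrite addr_ge0// (ltW eps0).
  apply: le_trans (marginal_max_norm ss sW mbe be0 fb) _.
  under eq_integral do rewrite EFinD.
  rewrite ge0_integralD//; last 3 first.
  - by move=> z _; rewrite lee_fin.
  - by apply/measurable_EFinP.
  - by move=> z _; rewrite lee_fin (ltW eps0).
  have -> : 2 * eps = eps + eps by ring.
  rewrite EFinD leeD// integral_cst// -[leRHS]mule1 lee_pmul2l// ?lte_fin//.
  exact: probability_le1.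
Unshelve. all: by end_near. Qed.

(** * Small gaps along refinements *)

Lemma ler_bigmax_shift (R : realType) (k : nat) (a b : 'I_k -> R) (c : R) :
  0 <= c -> (forall i, `|a i - b i| <= c) -> max_norm a <= max_norm b + c.
Proof.
move=> c0 h; rewrite /max_norm; elim: (index_enum _) => [|i s IH].
  by rewrite !big_nil add0r.
rewrite !big_cons ge_max; apply/andP; split.
  apply: (@le_trans _ _ (`|b i| + c)); last by rewrite lerD2r le_max lexx.
  by rewrite -lerBlDl; apply: le_trans (lerB_dist _ _) (h i).
by apply: le_trans IH _; rewrite lerD2r le_max lexx orbT.
Qed.

Lemma max_normZ (R : realType) (k : nat) (c : R) (a : 'I_k -> R) : 0 <= c ->
  max_norm (fun i => c * a i) = c * max_norm a.
Proof.
move=> c0; rewrite /max_norm; elim: (index_enum _) => [|i s IH].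
  by rewrite !big_nil mulr0.
by rewrite !big_cons IH normrM (ger0_norm c0) maxr_pMr.
Qed.

Lemma max_normD (R : realType) (k : nat) (a b : 'I_k -> R) :
  max_norm (fun i => a i + b i) <= max_norm a + max_norm b.
Proof.
rewrite /max_norm; elim: (index_enum _) => [|i s IH].
  by rewrite !big_nil addr0.
rewrite !big_cons ge_max; apply/andP; split.
  by apply: le_trans (ler_normD _ _) _; rewrite lerD// le_max lexx.
by apply: le_trans IH _; rewrite lerD// le_max lexx orbT.
Qed.

Lemma max_norm_ge (R : realType) (k : nat) (a : 'I_k -> R) i : `|a i| <= max_norm a.
Proof. exact: le_bigmax. Qed.

Lemma max_norm_le (R : realType) (k : nat) (a : 'I_k -> R) c :
  0 <= c -> (forall i, `|a i| <= c) -> max_norm a <= c.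
Proof. by move=> c0 h; apply: bigmax_le. Qed.

Section gap.
Context d (T : measurableType d) (R : realType) (X : normedModType R).
Hypothesis GRP : graphon_representation_property X.
Variables (l : set T -> R) (nu : set T -> X).
Hypothesis l_add : finitely_additive l.
Hypothesis l_ge0 : forall A, measurable A -> 0 <= l A.
Hypothesis l_T : l setT = 1.
Hypothesis nu_add : finitely_additive nu.
Hypothesis nu_l : forall A, measurable A -> `|nu A| <= l A.
Hypothesis nu_T : nu setT = 0.

Local Notation x := (density l nu).

Definition gap (S P : seq (set T)) := \sum_(C <- cells P) \sum_(D <- cells S)
  l (D `&` C) * `|x (D `&` C) - x C|.

Variables (P_ S_ : nat -> seq (set T)).
Hypothesis mS : forall n, all_measurable (S_ n).
Hypothesis P0 : P_ 0%N = [::].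
Hypothesis PS : forall n, P_ n.+1 = S_ n ++ P_ n.

Let mP n : all_measurable (P_ n).
Proof. exact: refining_measurable mS P0 PS n. Qed.

Let cell n (i : 'I_(size (cells (P_ n)))) := tnth (in_tuple (cells (P_ n))) i.

Let mcell n i : measurable (@cell n i).
Proof. by apply: (measurable_cells (@mP n)); exact: mem_tnth. Qed.

Let sum_cell n (V : nmodType) (h : set T -> V) :
  \sum_i h (@cell n i) = \sum_(C <- cells (P_ n)) h C.
Proof. by rewrite [RHS]big_tnth. Qed.

(** Quantified over all normed modules because it is applied both to real functions of the cells and
    to the vector density itself. *)
Let labelling n : {Vl : {V : finType & V -> 'I_(size (cells (P_ n)))} |
  (0 < #|projT1 Vl|)%N /\
  forall (Y : normedModType R) (g : set T -> Y) B,
    (forall C, C \in cells (P_ n) -> `|g C| <= B) ->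
    `|(#|projT1 Vl|%:R)^-1 *: (\sum_v g (cell (projT2 Vl v))) -
      \sum_(C <- cells (P_ n)) l C *: g C| <= B / n.+1%:R}.
Proof.
apply: cid.
have [||V [lab [V0 h]]] := @uniform_labelling R _ (fun i => l (@cell n i)) n.
- by move=> i; apply: l_ge0; exact: mcell.
- by rewrite (sum_cell n l); exact: sum_cells_l.
exists (existT _ V lab); split => // Y g B gB.
rewrite -(sum_cell n (fun C => l C *: g C)); apply: (h _ (fun i => g (cell i))) => i.
by apply: gB; exact: mem_tnth.
Qed.

Let V n : finType := projT1 (sval (labelling n)).
Let V0 n : (0 < #|V n|)%N := (svalP (labelling n)).1.
Let lab n (v : V n) : set T := cell (projT2 (sval (labelling n)) v).

Let mlab n v : measurable (@lab n v).
Proof. exact: mcell. Qed.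

Let average_expect n (h : set T -> R) B : (forall C, measurable C -> `|h C| <= B) ->
  `|average (fun v => h (@lab n v)) - expect l (P_ n) h| <= B / n.+1%:R.
Proof.
move=> hB; apply: ((svalP (labelling n)).2 R^o h B) => C CP.
by apply: hB; exact: measurable_cells CP.
Qed.

Let g n (v : V n) : X := x (lab v).

Let g1 n v : `|@g n v| <= 1.
Proof. by apply: density_le1 => //; exact: mlab. Qed.

Let mean n : X := (#|V n|%:R)^-1 *: \sum_v @g n v.

(** The exact mean of the density is [nu setT = 0], so only the labelling error remains. *)
Let mean_le n : `|mean n| <= 1 / n.+1%:R.
Proof.
have h : `|mean n - \sum_(C <- cells (P_ n)) l C *: x C| <= 1 / n.+1%:R.
  apply: (svalP (labelling n)).2 => C CP.
  by apply: density_le1 => //; exact: measurable_cells CP.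
suff E : \sum_(C <- cells (P_ n)) l C *: x C = 0 by move: h; rewrite E subr0.
transitivity (nu setT) => //; rewrite -(sum_cells nu_add (@mP n) (@measurableT _ T)).
by apply: eq_big_seq => C CP; rewrite setIT densityE//; exact: measurable_cells CP.
Qed.

Let G n : target_graph X := sum_graph (V0 n) (@g n).

Let G_cvg F : cvg (target_density F (G n) @[n --> \oo]).
Proof.
apply: sum_graph_density_cvg => s.
have [K K0 HK] := prod_diff_bound s.
pose h C := \prod_(F <- s) (F (x C) : R).
have hK C : measurable C -> `|h C| <= K.
  by move=> mC; have [] := HK _ _ (density_le1 l_ge0 nu_l mC) (density_le1 l_ge0 nu_l mC).
have /cvg_ex[y hy] := expect_prod_cvg (s := s) l_add l_ge0 l_T nu_add nu_l mS P0 PS.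
apply/cvg_ex; exists y; apply/cvgrPdist_le => e e0.
have e20 : 0 < e / 2 by rewrite divr_gt0.
have /cvgrPdist_le/(_ _ e20) h1 := hy.
have : K * harmonic n @[n --> \oo] --> K * 0 by apply: cvgMr; exact: cvg_harmonic.
rewrite mulr0 => /cvgrPdist_le/(_ _ e20) h2.
near=> n.
have h3 : `|y - expect l (P_ n) h| <= e / 2 by near: n.
have h4 : `|0 - K * harmonic n| <= e / 2 by near: n.
have h5 := @average_expect n h K hK.
rewrite -(subrK (expect l (P_ n) h) y) -addrA; apply: le_trans (ler_normD _ _) _.
rewrite distrC in h5.
have h6 : K / n.+1%:R <= e / 2.
  by apply: le_trans h4; rewrite sub0r normrN; exact: ler_norm.
by have := le_trans h5 h6; rewrite /h /lab /g in h3 *; lra.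
Unshelve. all: by end_near. Qed.

Let G_norm (p : R) : 1 <= p -> has_ubound (range (fun n => target_norm p (G n))).
Proof.
move=> p1; have p0 : 0 < p by apply: lt_le_trans p1.
exists 2 => _ [n _ <-]; rewrite /target_norm.
have -> : (2 : R) = (2 `^ p) `^ p^-1 by rewrite -powRrM mulfV ?gt_eqF// powRr1.
have c0 : (0 : R) < #|V n|%:R by rewrite ltr0n.
apply: ge0_ler_powR; rewrite ?nnegrE ?invr_ge0 ?(ltW p0)//.
  by rewrite mulr_ge0// sumr_ge0// => u _; rewrite sumr_ge0// => v _; exact: powR_ge0.
rewrite ler_pdivrMl ?exprn_gt0//.
have -> : (#|V n|%:R ^+ 2 * 2 `^ p : R) = \sum_(u : V n) \sum_(v : V n) 2 `^ p.
  by rewrite !sumr_const -mulrnA -[RHS]mulr_natl natrM expr2.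
apply: ler_sum => u _; apply: ler_sum => v _.
apply: ge0_ler_powR; rewrite ?nnegrE ?(ltW p0)//=.
by apply: le_trans (ler_normD _ _) _; have := g1 u; have := g1 v; lra.
Qed.

Let zero_dual : {F : dual X | forall y, F y = 0 :> R}.
Proof.
apply: cid; have [||F [hF _]] := @dual_of_seminorm R X (fun=> 0) 0.
- by split=> *; rewrite ?addr0 ?mulr0.
- by move=> y; exact: normr_ge0.
exists F => y; apply/eqP; rewrite -normr_le0; exact: hF.
Qed.

(** Averaging [g u + g v] over the leaf [v] leaves [g u + mean n], so stars compute the joint
    moments of [g] up to a vanishing shift. *)
Let star_average r (f : 'I_r -> dual X) n :
  target_density (star f (sval zero_dual)) (G n) =
  average (fun v : V n => \prod_j (f j (g v + mean n) : R)).
Proof.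
rewrite star_target_density; apply: eq_average => u; apply: eq_bigr => j _.
transitivity (average (fun v : V n => (f j (g u) : R)) + average (fun v : V n => (f j (g v) : R))).
  by rewrite -averageD; apply: eq_average => v; rewrite /= linearD.
rewrite average_cst; last exact: V0.
by rewrite linearD; congr (_ + _); rewrite /mean linearZ linear_sum.
Qed.

(* Since [P |-> \sum_(C <- cells P) q (nu C)] increases under refinement, its
   limit along the graphs bounds all its terms. *)
Let sum_net_norm eps : 0 < eps -> exists zs, forall n,
  \sum_(C <- cells (P_ n)) net_norm eps zs (nu C) <= 3 * eps.
Proof.
move=> eps0; have [W [Wg GW]] := GRP G_norm G_cvg.
have [zs [w [mw iw dw ww]]] := graphon_star_marginals Wg eps0.
exists zs => n0.
have sq := seminorm_net_norm zs (ltW eps0).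
have qn y : net_norm eps zs y <= `|y| := net_norm_le_norm zs y (ltW eps0).
(* One functional per cell of [P_ n0], norming the seminorm at the value of [nu] there. The family
   is fixed before [n], as required by the convergence of moments. *)
have /choice[f hf] (i : 'I_(size (cells (P_ n0)))) : exists F : dual X,
    (forall y, `|F y : R| <= net_norm eps zs y) /\
    F (nu (cell i)) = net_norm eps zs (nu (cell i)) by exact: dual_of_seminorm.
have fn i y : `|f i y : R| <= `|y| := le_trans ((hf i).1 y) (qn y).
pose a n (v : V n) i : R := f i (g v + mean n).
have a2 n v i : `|a n v i| <= 2.
  apply: le_trans (fn _ _) _; apply: le_trans (ler_normD _ _) _.
  have h : 1 / n.+1%:R <= 1 :> R by rewrite ler_pdivrMr ?ltr0n// mul1r ler1n.
  exact: lerD (g1 v) (le_trans (mean_le n) h).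
have moments (s : seq 'I_(size (cells (P_ n0)))) :
    average (fun v => \prod_(i <- s) a n v i) @[n --> \oo] -->
    \int[@unit_interval R]_t \prod_(i <- s) w (f i) t.
  under eq_Rintegral do rewrite big_tnth.
  have := GW (star (fun j => f (tnth (in_tuple s) j)) (sval zero_dual)).
  rewrite dw.
  rewrite (_ : (fun n => target_density _ _) =
    (fun n => average (fun v => \prod_(i <- s) a n v i)))//.
  apply/funext => n; rewrite star_average; apply: eq_average => v.
  by rewrite [RHS]big_tnth.
have e20 : 0 < eps / 2 by rewrite divr_gt0.
have near1 := average_max_norm_near V0 a2 (fun i => mw (f i)) _ moments e20 (ww _ f (fun i => (hf i).1)).
have : harmonic n @[n --> \oo] --> (0 : R) by exact: cvg_harmonic.
have e40 : 0 < eps / 4 by rewrite divr_gt0.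
move=> /cvgrPdist_le/(_ _ e40) near2.
(* The total will be [2 * eps + eps / 2] plus two errors [1 / (n + 1)], from the shift by [mean n]
   and from the labelling, hence at most [3 * eps]. *)
have [n [n0n h1 h2]] : exists n, [/\ (n0 <= n)%N,
    average (fun v => max_norm (a n v)) <= 2 * eps + eps / 2 & 1 / n.+1%:R <= eps / 4].
  near \oo => n; exists n; split; first by near: n; exact: nbhs_infty_ge.
    near: n; apply: near1 => s.
    have := iw _ (fun j => f (tnth (in_tuple s) j)).
    rewrite (_ : (fun x => \prod_j _) = (fun x => \prod_(i <- s) w (f i) x))//.
    by apply/funext => t; rewrite [RHS]big_tnth.
  have : `|0 - harmonic n| <= eps / 4 by near: n.
  by rewrite sub0r normrN div1r; apply: le_trans; exact: ler_norm.
(* [M] is subadditive, hence increases along refinements, and it dominates the seminorm at the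
   values of [nu] on the cells of [P_ n0]. *)
pose M (y : X) := max_norm (fun i => f i y : R).
have M0 : M 0 = 0.
  apply/eqP; rewrite eq_le max_norm_le//=; last by move=> i; rewrite linear0 normr0.
  exact: bigmax_ge_id.
have MD y z : M (y + z) <= M y + M z.
  rewrite /M; apply: le_trans (max_normD _ _).
  by rewrite le_eqVlt; apply/orP; left; apply/eqP; congr max_norm; apply/funext => i; rewrite linearD.
have h3 : \sum_(C <- cells (P_ n0)) M (nu C) <= \sum_(C <- cells (P_ n)) M (nu C).
  have [S mS' ->] := refining_cat mS PS n0n.
  exact: sum_cells_subadditive.
have h4 : \sum_(C <- cells (P_ n)) M (nu C) = expect l (P_ n) (fun C => M (x C)).
  rewrite /expect; apply: eq_big_seq => C CP; have mC := measurable_cells (@mP n) CP.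
  rewrite -(densityE nu_l mC) /M -max_normZ ?l_ge0//.
  by congr max_norm; apply/funext => i; rewrite linearZ.
have Mx1 C : measurable C -> `|M (x C)| <= 1.
  move=> mC; rewrite ger0_norm; last exact: bigmax_ge_id.
  apply: max_norm_le => // i; apply: le_trans (fn _ _) _.
  exact: density_le1.
have h5 : `|average (fun v : V n => M (g v)) - expect l (P_ n) (fun C => M (x C))| <= 1 / n.+1%:R.
  exact: average_expect.
have h6 : average (fun v : V n => M (g v)) <= average (fun v => max_norm (a n v)) + 1 / n.+1%:R.
  apply: le_averageD => // v; apply: ler_bigmax_shift => [|i]; first by rewrite divr_ge0.
  rewrite /a linearD opprD addrA subrr sub0r normrN.
  by apply: le_trans (fn _ _) _; exact: mean_le.
have h7 : \sum_(C <- cells (P_ n0)) net_norm eps zs (nu C) <= \sum_(C <- cells (P_ n0)) M (nu C).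
  rewrite -(sum_cell n0 (fun C => net_norm eps zs (nu C))) -(sum_cell n0 (fun C => M (nu C))).
  apply: ler_sum => i _; rewrite -(hf i).2; apply: le_trans (ler_norm _) _.
  exact: (max_norm_ge (fun j => f j (nu (cell i)) : R) i).
move: h5; rewrite ler_norml => /andP[h5 _].
apply: le_trans h7 _; apply: le_trans h3 _; rewrite h4.
by move: h5 h6 h1 h2; set r := 1 / n.+1%:R; lra.
Unshelve. all: by end_near. Qed.

(** The finite test is applied to the increments of the density, of norm at most 2: the seminorm
    part is small at both partitions, and the finitely many functionals [Phi i] give scalar
    martingales, whose gaps vanish along the sequence. *)
Lemma gap_small e : 0 < e -> exists n, gap (S_ n) (P_ n) <= e.
Proof.
(* The seminorm terms contribute [2 * 3 * eps] twice, that is [e / 4]; the functionals and the error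
   of the finite test add [e / 4] each. *)
move=> e0; pose eps := e / 48.
have eps0 : 0 < eps by rewrite divr_gt0.
have e40 : 0 < e / 4 by rewrite divr_gt0.
have [zs hzs] := sum_net_norm eps0.
have sq := seminorm_net_norm zs (ltW eps0).
have [k [Phi [_ hPhi]]] := net_norm_finite_test zs 2 eps0 e40.
have [N hN] : exists N, forall n, (N <= n)%N ->
    \sum_(i < k) gap1 l nu (Phi i) (S_ n) (P_ n) <= e / 4.
  elim: k Phi {hPhi} (e / 4) e40 => [|k IH] Phi a a0.
    by exists 0%N => n _; rewrite big_ord0 (ltW a0).
  have a20 : 0 < a / 2 by rewrite divr_gt0.
  have [N1 h1] := gap1_refining l_add l_ge0 l_T nu_add nu_l mS P0 PS (Phi ord_max) a20.
  have [N2 h2] := IH (fun i => Phi (widen_ord (leqnSn k) i)) _ a20.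
  exists (maxn N1 N2) => n; rewrite geq_max => /andP[n1 n2].
  rewrite big_ord_recr/=.
  by have := h1 n n.+1 (S_ n) n1 (leqnSn n) (@mS n) (PS n); have := h2 n n2; lra.
exists N; have := hN N (leqnn N); set P := P_ N; set S := S_ N => hS.
have mPN : all_measurable P := @mP N.
have mSN : all_measurable S := @mS N.
have h1 : \sum_(C <- cells P) \sum_(D <- cells S) net_norm eps zs (nu (D `&` C)) <= 3 * eps.
  by have := hzs N.+1; rewrite PS big_cells_cat.
have h2 := hzs N; rewrite -/P in h2.
have qE C : measurable C -> l C * net_norm eps zs (x C) = net_norm eps zs (nu C).
  by move=> mC; rewrite -[in RHS](densityE nu_l mC) sq.2 ger0_norm// l_ge0.
have key C D : C \in cells P -> D \in cells S ->
    l (D `&` C) * `|x (D `&` C) - x C| <=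
    2 * net_norm eps zs (nu (D `&` C)) + 2 * (l (D `&` C) * net_norm eps zs (x C)) +
    \sum_(i < k) l (D `&` C) * `|Phi i (x (D `&` C)) - Phi i (x C) : R| + e / 4 * l (D `&` C).
  move=> CP DS; have mC := measurable_cells mPN CP.
  have mDC : measurable (D `&` C) by apply: measurableI => //; exact: measurable_cells DS.
  rewrite -(qE _ mDC) -mulr_sumr.
  have qy : net_norm eps zs (x (D `&` C) - x C) <= net_norm eps zs (x (D `&` C)) + net_norm eps zs (x C).
    by apply: le_trans (sq.1 _ _) _; rewrite seminormN.
  have q2 : net_norm eps zs (x (D `&` C) - x C) <= 2.
    apply: le_trans (net_norm_le_norm _ _ (ltW eps0)) _; apply: le_trans (ler_normB _ _) _.
    by apply: lerD; exact: density_le1.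
  have h := hPhi _ q2; have lD := l_ge0 mDC.
  apply: le_trans (ler_wpM2l lD h) _.
  under eq_bigr do rewrite linearB.
  have := ler_wpM2l lD qy; move: (\sum_(i < k) _) => s; nra.
apply: (@le_trans _ _ (\sum_(C <- cells P) \sum_(D <- cells S)
    (2 * net_norm eps zs (nu (D `&` C)) + 2 * (l (D `&` C) * net_norm eps zs (x C)) +
    \sum_(i < k) l (D `&` C) * `|Phi i (x (D `&` C)) - Phi i (x C) : R| + e / 4 * l (D `&` C)))).
  rewrite /gap big_seq [leRHS]big_seq; apply: ler_sum => C CP.
  by rewrite big_seq [leRHS]big_seq; apply: ler_sum => D DS; exact: key.
have sumD C : C \in cells P -> \sum_(D <- cells S) l (D `&` C) = l C.
  by move=> CP; apply: sum_cells => //; exact: measurable_cells CP.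
rewrite (eq_big_seq (fun C => 2 * (\sum_(D <- cells S) net_norm eps zs (nu (D `&` C))) +
    2 * net_norm eps zs (nu C) + \sum_(i < k) \sum_(D <- cells S)
      l (D `&` C) * `|Phi i (x (D `&` C)) - Phi i (x C) : R| + e / 4 * l C)); last first.
  move=> C CP; rewrite !big_split/=; congr (_ + _ + _ + _).
  - by rewrite mulr_sumr.
  - by rewrite -mulr_sumr -mulr_suml sumD// qE//; exact: measurable_cells CP.
  - by rewrite exchange_big.
  - by rewrite -mulr_sumr sumD.
rewrite !big_split/= -[X in X + _ + _ + _]mulr_sumr -[X in _ + X + _ + _]mulr_sumr.
rewrite -[X in _ + _ + _ + X]mulr_sumr (sum_cells_l l_add l_T mPN) [X in _ + _ + X + _]exchange_big/= mulr1.
have h3 : \sum_(i < k) \sum_(C <- cells P) \sum_(D <- cells S)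
   l (D `&` C) * `|Phi i (x (D `&` C)) - Phi i (x C) : R| <= e / 4 by exact: hS.
move: h1 h2 h3; rewrite /eps; lra.
Qed.

End gap.

Section small_gap.
Context d (T : measurableType d) (R : realType) (X : normedModType R).
Hypothesis GRP : graphon_representation_property X.
Variables (l : set T -> R) (nu : set T -> X).
Hypothesis l_add : finitely_additive l.
Hypothesis l_ge0 : forall A, measurable A -> 0 <= l A.
Hypothesis nu_add : finitely_additive nu.
Hypothesis nu_l : forall A, measurable A -> `|nu A| <= l A.

Let l_mono A C : measurable A -> measurable C -> l (A `&` C) <= l C.
Proof.
move=> mA mC; rewrite [leRHS](l_add mA mC) lerDl l_ge0//.
by apply: measurableI => //; exact: measurableC.
Qed.

Lemma small_gap e : 0 < e -> exists2 P, all_measurable P &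
  forall S, all_measurable S -> gap l nu S P <= e.
Proof.
move=> e0; apply: contrapT => hn.
have {}hn P : all_measurable P -> exists2 S, all_measurable S & e < gap l nu S P.
  move=> mP; apply: contrapT => h; apply: hn; exists P => // S mS.
  by rewrite leNgt; apply/negP => eS; apply: h; exists S.
have /choice[S_ hS] P : exists S, all_measurable P -> all_measurable S /\ e < gap l nu S P.
  have [mP|nmP] := pselect (all_measurable P); last by exists [::].
  by have [S mS h] := hn _ mP; exists S.
pose P_ := fix P_ n := if n is m.+1 then S_ (P_ m) ++ P_ m else [::].
have mP n : all_measurable (P_ n).
  by elim: n => [|n IH] //=; apply: all_measurable_cat => //; have [] := hS _ IH.
have mS n : all_measurable (S_ (P_ n)) by have [] := hS _ (mP n).
pose L := l setT.
have l_le A : measurable A -> l A <= L.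
  by move=> mA; rewrite -[A in leLHS]setIT l_mono.
(* If the total mass were 0, every cell would have weight 0 and the gap could not exceed [e]. *)
have L0 : 0 < L.
  have LT : 0 <= L by apply: l_ge0.
  rewrite lt_neqAle LT andbT; apply/negP => /eqP L0.
  have := (hS _ (mP 0%N)).2; rewrite /gap big_seq big1 ?ltNge ?(ltW e0)// => C CP.
  rewrite big_seq big1// => D DS.
  have mDC : measurable (D `&` C).
    by apply: measurableI; [exact: measurable_cells DS|exact: measurable_cells CP].
  have : l (D `&` C) <= 0 by rewrite L0 l_le.
  by have := l_ge0 mDC => h1 h2; rewrite (le_anti (_ : l (D `&` C) <= 0 <= l (D `&` C))) ?mul0r// h2.
pose l' A := L^-1 * l A.
(* Subtracting [l' A *: nu setT] makes the total value 0; the centred measure is bounded by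
   [2 * l A], whence the factor 2. *)
pose nu' A := (2 * L)^-1 *: (nu A - (l' A) *: nu setT).
have l'_add : finitely_additive l'.
  by move=> A C mA mC; rewrite /l' (l_add mA mC) mulrDr.
have l'_ge0 A : measurable A -> 0 <= l' A.
  by move=> mA; rewrite mulr_ge0 ?invr_ge0 ?(ltW L0)// l_ge0.
have l'_T : l' setT = 1 by rewrite /l' mulVf// gt_eqF.
have nu'_add : finitely_additive nu'.
  move=> A C mA mC; rewrite /nu' -scalerDr addrACA -opprD -scalerDl -l'_add//.
  by rewrite -nu_add.
have nu'_l A : measurable A -> `|nu' A| <= l' A.
  move=> mA; rewrite /nu' normrZ ger0_norm ?invr_ge0 ?mulr_ge0 ?(ltW L0)//.
  rewrite ler_pdivrMl ?mulr_gt0//; apply: le_trans (ler_normB _ _) _.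
  rewrite normrZ ger0_norm ?l'_ge0//.
  have h1 : l' A * `|nu setT| <= l A.
    rewrite /l' -mulrA ler_pdivrMl// [leRHS]mulrC ler_wpM2l ?l_ge0//.
    exact: nu_l.
  have -> : 2 * L * l' A = l A + l A by rewrite /l' -mulrA mulVKf ?gt_eqF//; ring.
  by apply: lerD => //; exact: nu_l.
have nu'_T : nu' setT = 0 by rewrite /nu' l'_T scale1r subrr scaler0.
have P0 : P_ 0%N = [::] by [].
have PS n : P_ n.+1 = S_ (P_ n) ++ P_ n by [].
have eL : 0 < e / (2 * L) by rewrite divr_gt0// mulr_gt0.
have [n hn'] := gap_small GRP l'_add l'_ge0 l'_T nu'_add nu'_l nu'_T mS P0 PS eL.
have [_] := hS _ (mP n); rewrite ltNge => /negP; apply.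
suff E : gap l nu (S_ (P_ n)) (P_ n) = 2 * L * gap l' nu' (S_ (P_ n)) (P_ n).
  by rewrite E -ler_pdivlMl ?mulr_gt0// mulrC.
rewrite /gap mulr_sumr; apply: eq_big_seq => C CP.
rewrite mulr_sumr; apply: eq_big_seq => D DS.
have mC : measurable C by exact: measurable_cells CP.
have mD : measurable D by exact: measurable_cells DS.
have mDC : measurable (D `&` C) by exact: measurableI.
have [lDC|lDC] := eqVneq (l (D `&` C)) 0; first by rewrite /l' lDC mulr0 !mul0r mulr0.
have lC : l C != 0.
  apply: contraNneq lDC => lC; apply/eqP/le_anti.
  by rewrite -{1}lC l_mono//= l_ge0.
(* The centring shifts all densities by the same vector, so it cancels in the differences and the
   gap is merely rescaled. *)
have densE A : l A != 0 -> density l' nu' A = 2^-1 *: (density l nu A - L^-1 *: nu setT).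
  move=> lA; rewrite /density /nu' /l' !scalerBr !scalerA.
  by congr (_ *: _ - _ *: _); field; rewrite lA gt_eqF.
rewrite !densE// -scalerBr opprB addrA subrK normrZ ger0_norm ?invr_ge0// /l'.
by field; rewrite gt_eqF.
Qed.

End small_gap.

(** * Variation of a vector measure *)

Lemma cvgn_unique (R : realType) (X : normedModType R) (u : nat -> X) (a b : X) :
  u @ \oo --> a -> u @ \oo --> b -> a = b.
Proof. exact: (@norm_cvg_unique _ _ (u @ \oo) _ a b). Qed.

Section cells_partition.
Context d (T : measurableType d) (R : realType).
Implicit Types (P : seq (set T)).

(** [sum_cells] for the point mass at [t]: exactly one entry of the list contains [t], which yields
    both disjointness and covering. *)
Lemma sum_cells_indic P t : all_measurable P ->
  \sum_(C <- cells P) (\1_C t : R) = 1.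
Proof.
move=> mP; have fa : finitely_additive (fun C : set T => \1_C t : R).
  move=> A C _ _; rewrite !indicE !in_setI in_setC.
  by case: (t \in A); case: (t \in C); rewrite /= ?addr0 ?add0r.
transitivity (\1_[set: T] t : R); last by rewrite indicE in_setT.
rewrite -(sum_cells fa mP (@measurableT _ T)).
by apply: eq_bigr => C _; rewrite setIT.
Qed.

Lemma cells_trivIset P : all_measurable P ->
  trivIset setT (fun i : 'I_(size (cells P)) => tnth (in_tuple (cells P)) i).
Proof.
move=> mP; apply/trivIsetP => i j _ _ ij; apply/seteqP; split => // t [ti tj].
have := sum_cells_indic t mP.
rewrite big_tnth (bigD1 i)//= (bigD1 j)/= 1?eq_sym// !indicE !mem_set//.
have : 0 <= \sum_(k | (k != i) && (k != j)) (\1_(tnth (in_tuple (cells P)) k) t : R).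
  by rewrite sumr_ge0// => k _; rewrite indicE.
by rewrite !mulr1n; move: (\sum_(k | _) _) => s; lra.
Qed.

Lemma cells_cover P : all_measurable P ->
  \bigcup_(i in setT) tnth (in_tuple (cells P)) i = setT.
Proof.
move=> mP; apply/seteqP; split => // t _.
apply: contrapT => h; have := sum_cells_indic t mP.
rewrite big_tnth big1 => [/eqP|i _]; first by rewrite eq_sym oner_eq0.
by rewrite indicE memNset// => ti; apply: h; exists i.
Qed.

End cells_partition.

Section variation.
Context d (T : measurableType d) (R : realType) (X : normedModType R).
Variable nu : set T -> X.
Hypothesis nu_ca : countably_additive nu.
Hypothesis nu_bv : (vector_variation nu < +oo)%E.
Implicit Types (P S : seq (set T)) (A B C : set T).

Lemma countably_additive_set0 : nu set0 = 0.
Proof.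
have tr : trivIset setT (fun _ : nat => set0 : set T).
  by apply/trivIsetP => i j _ _ _; rewrite setI0.
have := nu_ca (fun _ => measurable0) tr; rewrite bigcup0// => h.
have h' : \sum_(0 <= i < n.+1) nu set0 @[n --> \oo] --> nu set0.
  by rewrite -(@cvg_shiftS _ (fun n => \sum_(0 <= i < n) nu set0)) in h.
have E : (fun n => \sum_(0 <= i < n.+1) nu set0) - (fun n => \sum_(0 <= i < n) nu set0) =
    cst (nu set0).
  by apply/funext => n; rewrite [LHS]/GRing.add/= big_nat_recr//= addrC addKr.
have h0 : cst (nu set0) @ \oo --> nu set0 - nu set0 by rewrite -E; exact: cvgB.
rewrite -[RHS](subrr (nu set0)); apply: (cvgn_unique _ h0); exact: cvg_cst.
Qed.

Lemma countably_additiveU A B : measurable A -> measurable B -> A `&` B = set0 ->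
  nu (A `|` B) = nu A + nu B.
Proof.
move=> mA mB AB; pose F := bigcup2 A B.
have mF i : measurable (F i) by rewrite /F; case: i => [|[|i]] //=.
have tF : trivIset setT F by rewrite -trivIset_bigcup2.
have := nu_ca mF tF; rewrite bigcup2E => h.
apply: (cvgn_unique h).
apply: cvg_near_cst; near=> n.
have n2 : (2 <= n)%N by near: n; exact: nbhs_infty_ge.
rewrite -(subnKC n2) /index_iota subn0 iotaD big_cat/= big_cons big_cons big_nil.
rewrite addr0 big1_seq ?addr0// => i /andP[_]; rewrite mem_iota => /andP[i2 _].
by case: i i2 => [|[|i]] //= _; exact: countably_additive_set0.
Unshelve. all: by end_near. Qed.

Lemma countably_additive_finitely : finitely_additive nu.
Proof.
move=> A C mA mC; rewrite -countably_additiveU.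
- by rewrite -setIUl setUv setTI.
- exact: measurableI.
- by apply: measurableI => //; exact: measurableC.
- by rewrite setIACA setICr set0I.
Qed.

Definition cell_variation P A : R := \sum_(C <- cells P) `|nu (C `&` A)|.

(** Only partitions generated by lists are used: any two have the common refinement [P ++ Q], and
    each is admissible for [vector_variation]. *)
Definition variation A : \bar R :=
  ereal_sup [set (cell_variation P A)%:E | P in [set P | all_measurable P]].

Lemma cell_variation_le P A : all_measurable P ->
  ((cell_variation P A)%:E <= variation A)%E.
Proof. by move=> mP; apply: ereal_sup_ubound; exists P. Qed.

Lemma variation_ge0 A : (0 <= variation A)%E.
Proof.
apply: le_trans (cell_variation_le (P := [::]) A _) => //.
by rewrite lee_fin sumr_ge0.
Qed.

Lemma variation_lty A : measurable A -> (variation A < +oo)%E.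
Proof.
move=> mA; apply: le_lt_trans nu_bv; apply: ge_ereal_sup => _ [P mP <-].
(* The cells of [A :: P] inside [A] are the traces on [A] of the cells of [P], so a partition of [T]
   bounds the variation on [A]. *)
have mAP : all_measurable (A :: P).
  by move=> B; rewrite inE => /predU1P[->|/mP].
apply: (@le_trans _ _ (\sum_(C <- cells (A :: P)) `|nu C|)%:E).
  rewrite lee_fin /cell_variation big_cat/= !big_map.
  under eq_bigr do rewrite setIC; rewrite lerDl sumr_ge0//.
apply: ereal_sup_ubound.
exists (size (cells (A :: P))), (fun i => tnth (in_tuple (cells (A :: P))) i).
split; [|exact: cells_trivIset|exact: cells_cover|by rewrite [in LHS]big_tnth].
by move=> i; apply: (measurable_cells mAP); exact: mem_tnth.
Qed.

Let restr_add A : measurable A -> finitely_additive (fun C => nu (C `&` A)).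
Proof.
move=> mA B C mB mC; rewrite -!setIA; apply: countably_additive_finitely => //.
exact: measurableI.
Qed.

Lemma cell_variation_cat P S A : measurable A -> all_measurable P -> all_measurable S ->
  cell_variation P A <= cell_variation (S ++ P) A.
Proof.
move=> mA mP mS.
exact: (sum_cells_subadditive (restr_add mA) (@ler_normD _ X) (normr0 X) mP mS).
Qed.

Lemma cell_variation_catC P S A : cell_variation (S ++ P) A = cell_variation (P ++ S) A.
Proof.
rewrite /cell_variation !big_cells_cat exchange_big; apply: eq_bigr => C _.
by apply: eq_bigr => D _; rewrite [C `&` D]setIC.
Qed.

(** Partitions nearly optimal for [A] and for [B] are merged, and the generator [A] is added to
    split each cell of the union into its two traces. *)
Lemma variationU A B : measurable A -> measurable B -> A `&` B = set0 ->
  (variation A + variation B <= variation (A `|` B))%E.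
Proof.
move=> mA mB AB.
have finA : variation A \is a fin_num by rewrite ge0_fin_numE ?variation_lty ?variation_ge0.
have finB : variation B \is a fin_num by rewrite ge0_fin_numE ?variation_lty ?variation_ge0.
rewrite -leeBrDr//; apply: ge_ereal_sup => _ [P mP <-].
rewrite leeBrDr// addeC -leeBrDr//; apply: ge_ereal_sup => _ [Q mQ <-].
rewrite leeBrDr// -EFinD.
have mPQ : all_measurable (A :: P ++ Q).
  move=> C; rewrite inE => /predU1P[->//|]; exact: all_measurable_cat.
apply: le_trans (cell_variation_le _ mPQ); rewrite lee_fin.
have h1 := cell_variation_cat mB mQ mP.
have h2 := cell_variation_cat mA mP mQ; rewrite cell_variation_catC in h2.
rewrite [leRHS](_ : _ = cell_variation (P ++ Q) A + cell_variation (P ++ Q) B).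
  by rewrite addrC; exact: lerD.
rewrite /cell_variation big_cat/= !big_map; congr (_ + _); apply: eq_bigr => C _.
  congr (`|nu _|); rewrite [A `&` C]setIC -setIA; congr (_ `&` _).
  by rewrite setIUr setIid AB setU0.
congr (`|nu _|); rewrite [~` A `&` C]setIC -setIA; congr (_ `&` _).
rewrite setIUr setICl set0U; apply/seteqP; split => [t []//|t Bt]; split => // At.
by have : (A `&` B) t by []; rewrite AB.
Qed.

Lemma variation_le A B : measurable A -> measurable B -> A `<=` B ->
  (variation A <= variation B)%E.
Proof.
move=> mA mB AB; rewrite -[B](setDUK AB).
apply: le_trans (variationU _ _ _) => //; last by rewrite setDIK.
- by rewrite leeDl// variation_ge0.
- exact: measurableD.
Qed.

Lemma variation0 : variation set0 = 0%E.
Proof.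
apply/eqP; rewrite eq_le variation_ge0 andbT; apply: ge_ereal_sup => _ [P mP <-].
rewrite lee_fin /cell_variation big1// => C _.
by rewrite setI0 countably_additive_set0 normr0.
Qed.

Lemma sum_variation_le (F : nat -> set T) n : (forall i, measurable (F i)) ->
  trivIset setT F ->
  (\sum_(0 <= i < n) variation (F i) <= variation (\big[setU/set0]_(0 <= i < n) F i))%E.
Proof.
move=> mF tF; elim: n => [|n IH]; first by rewrite !big_nil variation0.
rewrite !big_nat_recr//=; apply: le_trans (variationU _ _ _) => //.
- by rewrite leeD2r.
- by apply: bigsetU_measurable.
- rewrite big_mkord -bigcup_mkord; apply/seteqP; split => // t [[i /= ni Fi] Fn].
  have /trivIsetP/(_ i n I I) := tF; rewrite (ltn_eqF ni) => /(_ isT) E.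
  by have : (F i `&` F n) t by []; rewrite E.
Qed.

(** For a fixed [P], countable additivity of [nu] on every cell and continuity of the norm make the
    cell variation of the union a limit of finite sums, each bounded by the series of variations. *)
Lemma variation_bigcup_le (F : nat -> set T) : (forall i, measurable (F i)) ->
  trivIset setT F ->
  (variation (\bigcup_i F i) <= \sum_(0 <= i <oo) variation (F i))%E.
Proof.
move=> mF tF; apply: ge_ereal_sup => _ [P mP <-].
pose u n := \sum_(C <- cells P) `|\sum_(0 <= i < n) nu (C `&` F i)|.
have u_cvg : u n @[n --> \oo] --> cell_variation P (\bigcup_i F i).
  rewrite /u /cell_variation.
  have : forall C, C \in cells P -> measurable C by move=> C; exact: measurable_cells.
  elim: (cells P) => [|C s IH] ms.
    rewrite big_nil; rewrite (_ : (fun n => _) = cst 0); first exact: cvg_cst.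
    by apply/funext => n; rewrite big_nil.
  rewrite big_cons (_ : (fun n => _) = (fun n => `|\sum_(0 <= i < n) nu (C `&` F i)|) \+
    (fun n => \sum_(C <- s) `|\sum_(0 <= i < n) nu (C `&` F i)|)); last first.
    by apply/funext => n; rewrite big_cons.
  apply: cvgD; last by apply: IH => B Bs; apply: ms; rewrite inE Bs orbT.
  apply: cvg_norm; rewrite setI_bigcupr; apply: nu_ca.
  - by move=> i; apply: measurableI => //; apply: ms; rewrite mem_head.
  - exact: trivIset_setIl.
have uS n : ((u n)%:E <= \sum_(0 <= i <oo) variation (F i))%E.
  apply: (@le_trans _ _ (\sum_(0 <= i < n) variation (F i))%E); last first.
    by apply: nneseries_lim_ge => i _ _; exact: variation_ge0.
  apply: (@le_trans _ _ (\sum_(0 <= i < n) (cell_variation P (F i))%:E)%E).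
    rewrite sumEFin lee_fin /u /cell_variation exchange_big/=.
    by apply: ler_sum => C _; exact: ler_norm_sum.
  by apply: lee_sum => i _; exact: cell_variation_le.
have := nneseries_ge0 (fun i _ _ => variation_ge0 (F i)) : (0 <= \sum_(0 <= i <oo) variation (F i))%E.
case E : (\sum_(0 <= i <oo) variation (F i))%E uS => [c| |] uS; last by [].
- move=> _; rewrite lee_fin; apply: (cvgr_to_le u_cvg); near=> n.
  by have := uS n; rewrite lee_fin.
- by move=> _; rewrite leey.
Unshelve. all: by end_near. Qed.

Lemma variation_semi_sigma_additive : semi_sigma_additive variation.
Proof.
move=> F mF tF mUF.
have -> : variation (\bigcup_n F n) = (\sum_(0 <= i <oo) variation (F i))%E.
  apply/eqP; rewrite eq_le variation_bigcup_le//=.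
  apply: lime_le; first by apply: is_cvg_nneseries => i _ _; exact: variation_ge0.
  near=> n; apply: le_trans (sum_variation_le n mF tF) _.
  apply: variation_le => //; first by apply: bigsetU_measurable.
  by rewrite big_mkord; exact: bigsetU_bigcup.
by apply: is_cvg_nneseries => i _ _; exact: variation_ge0.
Unshelve. all: by end_near. Qed.

Lemma variation_measure : exists lam : {finite_measure set T -> \bar R},
  forall A, lam A = variation A.
Proof.
pose m := isMeasure.Build _ _ _ variation variation0 variation_ge0 variation_semi_sigma_additive.
pose M : {measure set T -> \bar R} := HB.pack variation m.
have fin : fin_num_fun M.
  by move=> A mA; rewrite ge0_fin_numE ?variation_lty ?variation_ge0.
pose f := Measure_isFinite.Build _ _ _ M fin.
pose L : {finite_measure set T -> \bar R} := HB.pack (M : set T -> \bar R) m f.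
by exists L.
Qed.

Lemma norm_le_variation A : measurable A -> (`|nu A|%:E <= variation A)%E.
Proof.
move=> mA; apply: le_trans (cell_variation_le (P := [::]) A _) => //.
by rewrite /cell_variation big_seq1 setTI.
Qed.

End variation.

(** * Construction of the density *)

Lemma nneseries_geometric_le (R : realType) (u : nat -> \bar R) (c : R) :
  (forall k, (0 <= u k)%E) -> (forall k, (u k <= (c / 2 ^+ k)%:E)%E) ->
  (\sum_(0 <= k <oo) u k <= (2 * c)%:E)%E.
Proof.
move=> u0 uc; have c0 : 0 <= c.
  by have := le_trans (u0 0%N) (uc 0%N); rewrite lee_fin expr0 divr1.
apply: lime_le; first exact: is_cvg_nneseries.
near=> n; apply: (@le_trans _ _ (\sum_(0 <= k < n) (c / 2 ^+ k)%:E)%E).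
  by apply: lee_sum => k _; exact: uc.
rewrite sumEFin lee_fin.
suff -> : \sum_(0 <= k < n) c / 2 ^+ k = 2 * c - 2 * c / 2 ^+ n.
  by rewrite lerBlDr lerDl divr_ge0 ?mulr_ge0// exprn_ge0.
elim: (n) => [|m IH]; first by rewrite big_nil expr0 divr1 subrr.
rewrite big_nat_recr//= IH exprS; field.
by rewrite expf_neq0.
Unshelve. all: by end_near. Qed.

(** * Limits of rapidly Cauchy sequences of simple functions *)

Section simple_limit.
Context d (T : measurableType d) (R : realType) (X : completeNormedModType R).
Variable mu : {finite_measure set T -> \bar R}.
Variables (s_ : nat -> T -> X) (c : R).
Hypothesis ss : forall n, simple_function (s_ n).
Hypothesis sc : forall n, (\int[mu]_t (`|s_ n.+1 t - s_ n t|)%:E <= (c / 2 ^+ n)%:E)%E.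

Let tail n t : \bar R := (\sum_(0 <= k <oo) (`|s_ (n + k).+1 t - s_ (n + k)%N t|)%:E)%E.

Let mdiff n m : measurable_fun setT (fun t => (`|s_ n t - s_ m t|)%:E).
Proof.
by apply/measurable_EFinP; exact: (measurable_simple2 (fun x y => `|x - y|) (ss n) (ss m)).
Qed.

Let integral_tail n : (\int[mu]_t tail n t <= (2 * (c / 2 ^+ n))%:E)%E.
Proof.
rewrite /tail integral_nneseries//.
apply: nneseries_geometric_le => k; first by apply: integral_ge0 => t _; rewrite lee_fin.
by apply: le_trans (sc (n + k)%N) _; rewrite exprD invfM mulrA.
Qed.

Let g t : X := lim (s_ n t @[n --> \oo]).

(** A finite tail means that the telescoping series converges absolutely; this is where completeness
    of [X] enters. *)
Let tail_cvg n t : (tail n t < +oo)%E ->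
  s_ k t @[k --> \oo] --> g t /\ ((`|g t - s_ n t|)%:E <= tail n t)%E.
Proof.
move=> tfin.
pose u k := s_ (n + k).+1 t - s_ (n + k)%N t.
have seriesE m : series u m = s_ (n + m)%N t - s_ n t.
  rewrite /series/=; elim: m => [|m IH]; first by rewrite big_nil addn0 subrr.
  by rewrite big_nat_recr//= IH /u addnS addrC addrA subrK.
have partial m : ((\sum_(0 <= k < m) `|u k|)%:E <= tail n t)%E.
  rewrite -sumEFin; apply: nneseries_lim_ge => k _ _.
  by rewrite lee_fin.
have tfn : tail n t \is a fin_num.
  by rewrite ge0_fin_numE//; apply: nneseries_ge0 => k _ _; rewrite lee_fin.
have ucvg : cvgn (series u).
  apply: normed_cvg; apply: nondecreasing_is_cvgn.
    by apply: nondecreasing_series => k _ _; exact: normr_ge0.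
  exists (fine (tail n t)) => _ [m _ <-].
  by rewrite -lee_fin fineK//; exact: partial.
have scvg : cvgn (fun k => s_ k t).
  have /cvg_ex[y hy] := ucvg.
  apply/cvg_ex; exists (y + s_ n t); rewrite -(cvg_shiftn n).
  rewrite (_ : [sequence _]_ _ = (fun m => series u m + s_ n t)).
    by apply: cvgD => //; exact: cvg_cst.
  by apply/funext => m; rewrite seriesE subrK /= addnC.
split; first exact: scvg.
have gcvg : `|s_ (n + m)%N t - s_ n t| @[m --> \oo] --> `|g t - s_ n t|.
  apply: cvg_norm; apply: cvgB; last exact: cvg_cst.
  have := scvg; rewrite -(cvg_shiftn n); under eq_fun do rewrite addnC; exact.
rewrite -(fineK tfn) lee_fin; apply: (cvgr_to_le gcvg); near=> m.
rewrite -lee_fin fineK// -seriesE; apply: le_trans (partial m).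
by rewrite lee_fin; exact: ler_norm_sum.
Unshelve. all: by end_near. Qed.

(** The distance from [g] to [s_ n] need not be measurable, so it is controlled through a measurable
    majorant, the sum of the later increments. *)
Lemma simple_limit : exists g : T -> X,
  {ae mu, forall t, s_ n t @[n --> \oo] --> g t} /\
  forall n, exists h : T -> \bar R, [/\ measurable_fun setT h,
    forall t, (0 <= h t)%E, forall t, ((`|g t - s_ n t|)%:E <= h t)%E &
    (\int[mu]_t h t <= (2 * (c / 2 ^+ n))%:E)%E].
Proof.
have mtail n : measurable_fun setT (tail n).
  by apply: ge0_emeasurable_sum => k *; [rewrite lee_fin|exact: mdiff].
have tail0 n t : (0 <= tail n t)%E by apply: nneseries_ge0 => k _ _; rewrite lee_fin.
exists g; split.
  have it : mu.-integrable setT (tail 0%N).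
    apply/integrableP; split => //; under eq_integral do rewrite gee0_abs//.
    exact: le_lt_trans (integral_tail 0%N) (ltry _).
  have := integrable_ae measurableT it; apply: filterS => t /(_ I) tfin.
  by have [] := @tail_cvg 0%N t; rewrite -?ge0_fin_numE.
move=> n; exists (tail n); split => // t.
have [tfin|] := ltP (tail n t) +oo%E; first by have [] := tail_cvg tfin.
by rewrite leye_eq => /eqP ->; rewrite leey.
Qed.

End simple_limit.

Section density_approximation.
Context d (T : measurableType d) (R : realType) (mu : {finite_measure set T -> \bar R}).
Import HBNNSimple.

(** The integral of [phi] is the supremum of the integrals of the simple functions below it; [psi]
    nearly attains it. *)
Lemma nnsfun_below (phi : T -> R) (e : R) : (forall t, 0 <= phi t) ->
  mu.-integrable setT (EFin \o phi) -> 0 < e ->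
  exists psi : {nnsfun T >-> R}, (forall t, psi t <= phi t) /\
    (\int[mu]_t (phi t - psi t)%:E <= e%:E)%E.
Proof.
move=> phi0 iphi e0.
have mphi : measurable_fun setT phi by apply/measurable_EFinP; exact: measurable_int iphi.
have phi0E t : (0 <= (EFin \o phi) t)%E by rewrite lee_fin.
have E := ge0_integralTE mu phi0E.
have Ifin : (\int[mu]_t (phi t)%:E)%E \is a fin_num by exact: integrable_fin_num.
have Sfin := Ifin; rewrite [X in X \is a fin_num]E in Sfin.
have [_ [h hphi <-] hS] := ub_ereal_sup_adherent e0 Sfin.
rewrite -E in hS.
have hle t : h t <= phi t by have := hphi t; rewrite lee_fin.
exists h; split => //.
have mh : measurable_fun setT h by [].
have mB : measurable_fun setT (fun t => phi t - h t) by exact: measurable_funB.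
have split : (\int[mu]_t (phi t)%:E = \int[mu]_t (phi t - h t)%:E + \int[mu]_t (h t)%:E)%E.
  rewrite -ge0_integralD//.
  - by apply: eq_integral => t _; rewrite -EFinD subrK.
  - by move=> t _; rewrite lee_fin subr_ge0.
  - exact/measurable_EFinP.
  - by move=> t _; rewrite lee_fin.
  - exact/measurable_EFinP.
have hE : (\int[mu]_t (h t)%:E = sintegral mu h)%E by exact: integralT_nnsfun.
have B0 : (0 <= \int[mu]_t (phi t - h t)%:E)%E.
  by apply: integral_ge0 => t _; rewrite lee_fin subr_ge0.
have H0 : (0 <= sintegral mu h)%E by exact: sintegral_ge0.
have Ilty : (\int[mu]_t (phi t)%:E < +oo)%E by rewrite ltey_eq Ifin.
have hfin : sintegral mu h \is a fin_num.
  by rewrite ge0_fin_numE//; apply: le_lt_trans Ilty; rewrite split hE leeDr.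
have Bfin : (\int[mu]_t (phi t - h t)%:E)%E \is a fin_num.
  by rewrite ge0_fin_numE//; apply: le_lt_trans Ilty; rewrite split hE leeDl.
move: hS; rewrite [X in (X - _)%E]split hE -(fineK Bfin) -(fineK hfin).
by rewrite -!EFinD lte_fin lee_fin; lra.
Qed.

End density_approximation.

Section step_function.
Context d (T : measurableType d) (R : realType) (X : normedModType R).
Variable mu : {finite_measure set T -> \bar R}.
Variables (lam : {finite_measure set T -> \bar R}) (phi : T -> R) (nu : set T -> X).
Hypothesis phi0 : forall t, 0 <= phi t.
Hypothesis iphi : mu.-integrable setT (EFin \o phi).
Hypothesis lamE : forall A, measurable A -> lam A = (\int[mu]_(t in A) (phi t)%:E)%E.
Hypothesis nu_add : finitely_additive nu.
Hypothesis nu_lam : forall A, measurable A -> (`|nu A|%:E <= lam A)%E.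
Implicit Types (P S : seq (set T)) (A C : set T).
Import HBNNSimple.

Let l A := fine (lam A).

Let l_ge0 A : measurable A -> 0 <= l A.
Proof. by move=> mA; apply: fine_ge0. Qed.

Let lK A : measurable A -> (l A)%:E = lam A.
Proof. by move=> mA; rewrite fineK//; exact: fin_num_measure. Qed.

Lemma fine_measure_finitely_additive : finitely_additive l.
Proof.
move=> A C mA mC; have mAC := measurableI _ _ mA mC.
have mAC' := measurableI _ _ (measurableC mA) mC.
apply: EFin_inj; rewrite EFinD !lK// -measureU//; last by rewrite setIACA setICr set0I.
by rewrite -setIUl setUv setTI.
Qed.

Let nu_l A : measurable A -> `|nu A| <= l A.
Proof. by move=> mA; rewrite -lee_fin lK//; exact: nu_lam. Qed.

Local Notation x := (density l nu).

Definition step P t : X := \sum_(C <- cells P) (\1_C t : R) *: x C.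

Lemma simple_function_cst (a : X) : simple_function (fun _ : T => a).
Proof.
split=> [|z]; first by apply: (sub_finite_set _ (finite_set1 a)) => _ [t _ <-].
have [->|az] := eqVneq a z.
  by rewrite (_ : _ @^-1` _ = setT)//; apply/seteqP; split.
rewrite (_ : _ @^-1` _ = set0)//; apply/seteqP; split => // t /= /eqP.
by rewrite (negbTE az).
Qed.

Lemma simple_step P : all_measurable P -> simple_function (step P).
Proof.
move=> mP; rewrite /step; have : {in cells P, forall C, measurable C}.
  by move=> C; exact: measurable_cells.
elim: (cells P) => [|C s IH] ms.
  by under eq_fun do rewrite big_nil; exact: simple_function_cst.
under eq_fun do rewrite big_cons.
apply: (simple_function2 (fun a b : X => a + b)); last first.
  by apply: IH => B Bs; apply: ms; rewrite inE Bs orbT.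
rewrite (_ : (fun t => _) = (fun t => if t \in ~` C then 0 else x C)).
  apply: simple_function_restrict; last exact: simple_function_cst.
  by apply: measurableC; apply: ms; rewrite mem_head.
apply/funext => t; rewrite indicE in_setC; case: (t \in C); last by rewrite scale0r.
by rewrite scale1r.
Qed.

Let step_refine P S t : all_measurable P -> all_measurable S ->
  step P t = \sum_(C <- cells P) \sum_(D <- cells S) (\1_(D `&` C) t : R) *: x C.
Proof.
move=> mP mS; apply: eq_bigr => C _; rewrite -scaler_suml; congr (_ *: _).
rewrite -[LHS]mul1r -[X in X * _](sum_cells_indic R t mS) mulr_suml.
by apply: eq_bigr => D _; rewrite !indicE in_setI; case: (t \in D); rewrite /= ?mul1r ?mul0r.
Qed.

Lemma step_catC P S t : step (S ++ P) t = step (P ++ S) t.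
Proof.
rewrite /step !big_cells_cat exchange_big; apply: eq_bigr => C _.
by apply: eq_bigr => D _; rewrite [C `&` D]setIC.
Qed.

Lemma norm_step_le1 P t : all_measurable P -> `|step P t| <= 1.
Proof.
move=> mP; rewrite -(sum_cells_indic R t mP) /step.
apply: le_trans (ler_norm_sum _ _ _) _.
rewrite big_seq [leRHS]big_seq; apply: ler_sum => C CP.
rewrite normrZ ger0_norm ?indicE// ler_piMr//.
by apply: density_le1 => //; exact: measurable_cells CP.
Qed.

(** Since [phi] integrates to [l (D]&[C)] over [D]&[C], the gap is the integral of a sum of cellwise
    distances that dominates the integrand by the triangle inequality. *)
Lemma integral_step_refine P S : all_measurable P -> all_measurable S ->
  (\int[mu]_t (phi t * `|step (S ++ P) t - step P t|)%:E <= (gap l nu S P)%:E)%E.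
Proof.
move=> mP mS.
have mphi : measurable_fun setT phi by apply/measurable_EFinP; exact: measurable_int iphi.
have mDC C D : C \in cells P -> D \in cells S -> measurable (D `&` C).
  move=> CP DS; apply: measurableI.
  - exact: measurable_cells DS.
  - exact: measurable_cells CP.
pose h C D t : \bar R := (`|x (D `&` C) - x C|%:E * ((\1_(D `&` C) t)%:E * (phi t)%:E))%E.
have h0 C D t : (0 <= h C D t)%E.
  by rewrite /h !mule_ge0// lee_fin// indicE.
have ih C D : C \in cells P -> D \in cells S ->
    measurable_fun setT (h C D) /\
    (\int[mu]_t h C D t = (l (D `&` C) * `|x (D `&` C) - x C|)%:E)%E.
  move=> CP DS; have m := mDC _ _ CP DS.
  have mh : measurable_fun setT (fun t => (\1_(D `&` C) t)%:E * (phi t)%:E)%E.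
    by apply: emeasurable_funM; apply/measurable_EFinP.
  split; first by apply: emeasurable_funM.
  rewrite /h ge0_integralZl//; last by move=> t _; rewrite mule_ge0// lee_fin// indicE.
  rewrite [RHS]EFinM [in RHS]lK// lamE// muleC; congr (_ * _)%E.
  rewrite [RHS]integral_mkcond; apply: eq_integral => t _.
  by rewrite patchE indicE; case: ifP => _; rewrite ?mul1e ?mul0e.
apply: (@le_trans _ _ (\int[mu]_t \sum_(C <- cells P) \sum_(D <- cells S) h C D t)%E).
  apply: ge0_le_integral_nonmeasurable => t; first by rewrite lee_fin mulr_ge0.
  rewrite (step_refine t mP mS) /step big_cells_cat -sumrB.
  have -> : (\sum_(C <- cells P) \sum_(D <- cells S) h C D t =
      (\sum_(C <- cells P) \sum_(D <- cells S)
        `|x (D `&` C) - x C| * (\1_(D `&` C) t * phi t))%:E)%E.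
    by rewrite -sumEFin; apply: eq_bigr => C _; rewrite -sumEFin.
  rewrite lee_fin.
  apply: (@le_trans _ _ (phi t * \sum_(C <- cells P) \sum_(D <- cells S)
    \1_(D `&` C) t * `|x (D `&` C) - x C|)).
    rewrite ler_wpM2l//; apply: le_trans (ler_norm_sum _ _ _) _.
    apply: ler_sum => C _; rewrite -sumrB; apply: le_trans (ler_norm_sum _ _ _) _.
    by apply: ler_sum => D _; rewrite -scalerBr normrZ ger0_norm ?indicE.
  rewrite mulr_sumr; apply: ler_sum => C _; rewrite mulr_sumr; apply: ler_sum => D _.
  by rewrite mulrA mulrC [phi t * _]mulrC.
pose c i := tnth (in_tuple (cells P)) i; pose e j := tnth (in_tuple (cells S)) j.
have ihce i j := ih (c i) (e j) (mem_tnth _ _) (mem_tnth _ _).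
rewrite (eq_integral (fun t => \sum_i \sum_j h (c i) (e j) t)%E); last first.
  by move=> t _; rewrite big_tnth; apply: eq_bigr => i _; rewrite big_tnth.
rewrite ge0_integral_sum//; last 2 first.
- by move=> i; apply: emeasurable_sum => j; exact: (ihce i j).1.
- by move=> i t _; apply: sume_ge0.
rewrite /gap [X in (_ <= X%:E)%E]big_tnth -sumEFin; apply: lee_sum => i _.
rewrite ge0_integral_sum//; last by move=> j; exact: (ihce i j).1.
by rewrite [X in (_ <= X%:E)%E]big_tnth -sumEFin; apply: lee_sum => j _; rewrite (ihce i j).2.
Qed.

End step_function.

Lemma Rintegral_weighted_step d (T : measurableType d) (R : realType)
    (mu : {measure set T -> \bar R}) (phi : T -> R) (A : set T) (I : Type) (s : seq I)
    (B : I -> set T) (a : I -> R) :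
  measurable A -> (forall i, measurable (B i)) -> mu.-integrable setT (EFin \o phi) ->
  \int[mu]_(t in A) (phi t * \sum_(i <- s) (\1_(B i) t * a i)) =
  \sum_(i <- s) a i * \int[mu]_(t in A `&` B i) phi t.
Proof.
move=> mA mB iphi.
have ires i : mu.-integrable A (EFin \o (phi \_ (B i))).
  have : mu.-integrable (A `&` B i) (EFin \o phi).
    by apply: integrableS iphi => //; exact: measurableI.
  move=> /(integrable_mkcond _ (measurableI _ _ mA (mB i))) h.
  apply: (integrableS measurableT mA) => //.
  have : mu.-integrable (B i) (EFin \o phi) by exact: integrableS iphi.
  by move=> /(integrable_mkcond _ (mB i)); rewrite restrict_EFin.
have E t : phi t * \sum_(i <- s) (\1_(B i) t * a i) = \sum_(i <- s) a i * (phi \_ (B i)) t.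
  rewrite mulr_sumr; apply: eq_bigr => i _; rewrite indicE patchE.
  by case: ifP => _; rewrite ?mul1r ?mul0r ?mulr0 1?mulrC.
under eq_Rintegral do rewrite E.
rewrite [LHS]/Rintegral; under eq_integral do rewrite -sumEFin.
have iZ i : mu.-integrable A (fun t => (a i * (phi \_ (B i)) t)%:E).
  exact: (integrableZl mA (a i) (ires i)).
rewrite integral_sum// -sum_fine => [|i _]; last exact: integrable_fin_num.
apply: eq_bigr => i _; rewrite -[LHS]/(\int[mu]_(t in A) (a i * (phi \_ (B i)) t)).
by rewrite RintegralZl// [A `&` _]setIC Rintegral_mkcondl.
Qed.

Section simple_integral.
Context d (T : measurableType d) (R : realType) (X : normedModType R).
Variable mu : {finite_measure set T -> \bar R}.

(** Reduces estimates of vector integrals to real ones. The range is listed without repetition, so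
    that each point meets exactly one fibre. *)
Lemma simple_integral_dual (F : {linear X -> R^o}) (A : set T) (s : T -> X) :
  measurable A -> simple_function s ->
  F (simple_integral mu A s) = \int[mu]_(t in A) (F (s t) : R).
Proof.
move=> mA [/finite_seqP[r0 rE] ms].
pose r := undup r0; have ur : uniq r := undup_uniq r0.
have {}rE : range s = [set` r].
  by rewrite rE; apply/seteqP; split => x /=; rewrite mem_undup.
rewrite /simple_integral rE -fsbig_seq// linear_sum.
have mP x : measurable (s @^-1` [set x]) by exact: ms.
transitivity (\int[mu]_(t in A) (1 * \sum_(x <- r) (\1_(s @^-1` [set x]) t * (F x : R)))).
  rewrite Rintegral_weighted_step//; last exact: finite_measure_integrable_cst.
  apply: eq_bigr => x _; rewrite linearZ/= Rintegral_cst ?mul1r; last exact: measurableI.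
  by rewrite mulrC.
apply: eq_Rintegral => t _; rewrite mul1r.
have str : [set` r] (s t) by rewrite -rE; exists t.
rewrite (bigD1_seq _ str ur)/= indicE mem_set// mul1r big1 ?addr0// => x xst.
by rewrite indicE memNset ?mul0r//= => /esym/eqP; rewrite (negbTE xst).
Qed.

End simple_integral.

Section weighted_step.
Context d (T : measurableType d) (R : realType) (X : completeNormedModType R).
Variables mu lam : {finite_measure set T -> \bar R}.
Variables (phi : T -> R) (nu : set T -> X).
Hypothesis phi0 : forall t, 0 <= phi t.
Hypothesis iphi : mu.-integrable setT (EFin \o phi).
Hypothesis lamE : forall A, measurable A -> lam A = (\int[mu]_(t in A) (phi t)%:E)%E.
Hypothesis nu_add : finitely_additive nu.
Hypothesis nu_lam : forall A, measurable A -> (`|nu A|%:E <= lam A)%E.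
Implicit Types (P S : seq (set T)) (A C : set T).
Import HBNNSimple.
Implicit Types psi : {nnsfun T >-> R}.

Let l A := fine (lam A).
Let xi P := step lam nu P.

Let l_ge0 A : measurable A -> 0 <= l A.
Proof. by move=> mA; apply: fine_ge0. Qed.

Let nu_l A : measurable A -> `|nu A| <= l A.
Proof. by move=> mA; rewrite -lee_fin fineK ?nu_lam//; exact: fin_num_measure. Qed.

Let mphi : measurable_fun setT phi.
Proof. by apply/measurable_EFinP; exact: measurable_int iphi. Qed.

Let simple_nnsfun psi : @simple_function _ T R R^o psi.
Proof. by split=> [|x]; [exact: fimfunP|exact: measurable_sfunP]. Qed.

Lemma simple_weighted_step psi P : all_measurable P ->
  simple_function (fun t => psi t *: xi P t).
Proof.
move=> mP; apply: (simple_function2 (fun (a : R^o) (b : X) => (a : R) *: b)).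
  exact: simple_nnsfun.
exact: simple_step.
Qed.

Let norm_step t P : all_measurable P -> `|xi P t| <= 1.
Proof. by move=> mP; exact: norm_step_le1. Qed.

(** With [A] among the generators, the cells outside [A] drop out and [phi] times the step function
    integrates over [A] exactly to [nu A], seen through a functional norming the difference. The
    only error is the replacement of [phi] by [psi]. *)
Lemma simple_integral_weighted_step psi P A e : all_measurable P -> measurable A ->
  (forall t, psi t <= phi t) -> (\int[mu]_t (phi t - psi t)%:E <= e%:E)%E ->
  `|simple_integral mu A (fun t => psi t *: xi (A :: P) t) - nu A| <= e.
Proof.
move=> mP mA psi_le ephi; have mAP : all_measurable (A :: P).
  by move=> B; rewrite inE => /predU1P[->|/mP].
set v := _ - _.
have [F [F_le Fv]] := dual_of_seminorm v (seminorm_normr X) (fun x => lexx _).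
rewrite -Fv linearB simple_integral_dual//; last exact: simple_weighted_step.
pose y t : R := F (xi (A :: P) t).
have y1 t : `|y t| <= 1 by apply: le_trans (F_le _) (norm_step t mAP).
have my : measurable_fun setT y.
  exact: (@measurable_simple _ _ _ _ (fun x => F x : R) _ (simple_step lam nu mAP)).
pose c i := tnth (in_tuple (cells (A :: P))) i.
have mc i : measurable (c i) by apply: (measurable_cells mAP); exact: mem_tnth.
have ibound (h : T -> R) : measurable_fun setT h -> (forall t, `|h t| <= phi t) ->
    mu.-integrable A (EFin \o h).
  move=> mh hphi; apply: (le_integrable mA) (integrableS measurableT mA _ iphi) => //.
    by apply/measurable_EFinP; exact: measurable_funS mh.
  by move=> t _ /=; rewrite lee_fin (ger0_norm (phi0 t)).
have iphiy : mu.-integrable A (EFin \o (fun t => phi t * y t)).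
  apply: ibound => [|t]; first exact: measurable_funM.
  by rewrite normrM ger0_norm// ler_piMr.
have ipsiy : mu.-integrable A (EFin \o (fun t => psi t * y t)).
  apply: ibound => [|t]; first exact: measurable_funM.
  by rewrite normrM ger0_norm//; apply: le_trans (psi_le t); rewrite ler_piMr.
have nuE : F (nu A) = \int[mu]_(t in A) (phi t * y t).
  have yE t : y t = \sum_i (\1_(c i) t * (F (density l nu (c i)) : R)).
    rewrite /y /xi /step linear_sum [LHS]big_tnth.
    by apply: eq_bigr => i _; rewrite linearZ.
  under [RHS]eq_Rintegral do rewrite yE.
  rewrite Rintegral_weighted_step//.
  transitivity (\sum_i (F (density l nu (c i)) : R) * l (A `&` c i)).
    rewrite -(big_tnth _ _ (cells (A :: P)) xpredT
      (fun C => (F (density l nu C) : R) * l (A `&` C))).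
    rewrite /= big_cat/= !big_map [X in _ + X]big1 ?addr0 => [|C _]; last first.
      by rewrite setIA setICr set0I /l measure0 mulr0.
    rewrite -[in LHS](sum_cells nu_add mP mA) linear_sum; apply: eq_big_seq => C CP.
    have mAC : measurable (A `&` C) by apply: measurableI => //; exact: measurable_cells CP.
    by rewrite setIA setIid [C `&` A]setIC -[in LHS](densityE nu_l mAC) linearZ/= mulrC.
  apply: eq_bigr => i _; congr (_ * _); rewrite /l lamE//; exact: measurableI.
rewrite nuE (@eq_Rintegral _ _ _ mu A (fun t => psi t * y t)); last by move=> t _; rewrite linearZ.
rewrite -RintegralB//; apply: le_trans (ler_norm _) _.
have iB : mu.-integrable A (EFin \o (fun t => psi t * y t - phi t * y t)).
  exact: (integrableB mA ipsiy iphiy).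
apply: le_trans (le_normr_Rintegral mA iB) _.
rewrite -lee_fin fineK; last by apply: integrable_fin_num => //; exact: integrable_norm.
apply: le_trans ephi; rewrite integral_mkcond; apply: ge0_le_integral_nonmeasurable => t.
  by rewrite patchE; case: ifP => // _; rewrite lee_fin.
have pB : 0 <= phi t - psi t by rewrite subr_ge0.
rewrite patchE; case: ifP => _; rewrite lee_fin// -mulrBl normrM distrC (ger0_norm pB).
by rewrite ler_piMr.
Qed.

Lemma weighted_step_diff psi psi' P P' e e' g : all_measurable P -> all_measurable P' ->
  (forall t, psi t <= phi t) -> (forall t, psi' t <= phi t) ->
  (\int[mu]_t (phi t - psi t)%:E <= e%:E)%E ->
  (\int[mu]_t (phi t - psi' t)%:E <= e'%:E)%E ->
  (\int[mu]_t (phi t * `|xi P' t - xi P t|)%:E <= g%:E)%E ->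
  (\int[mu]_t (`|psi' t *: xi P' t - psi t *: xi P t|)%:E <= (e' + e + g)%:E)%E.
Proof.
move=> mP mP' le_psi le_psi' he he' hg.
have mB (h : {nnsfun T >-> R}) : measurable_fun setT (fun t => (phi t - h t)%:E).
  by apply/measurable_EFinP; exact: measurable_funB.
have mg : measurable_fun setT (fun t => (phi t * `|xi P' t - xi P t|)%:E).
  apply/measurable_EFinP; apply: measurable_funM => //.
  exact: (measurable_simple2 (fun a b => `|a - b|) (simple_step lam nu mP') (simple_step lam nu mP)).
apply: (@le_trans _ _ (\int[mu]_t ((phi t - psi' t)%:E + (phi t - psi t)%:E +
    (phi t * `|xi P' t - xi P t|)%:E))%E).
  apply: ge0_le_integral_nonmeasurable => t; first by rewrite lee_fin.
  rewrite -!EFinD lee_fin; set a := xi P t; set b := xi P' t.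
  have -> : psi' t *: b - psi t *: a =
      - ((phi t - psi' t) *: b) + (phi t - psi t) *: a + phi t *: (b - a).
    rewrite !scalerBl scalerBr opprB; set u := phi t *: a; set w := phi t *: b.
    by rewrite addrAC [_ + (w - u)]addrA subrK addrA subrK.
  apply: le_trans (ler_normD _ _) _; rewrite normrZ (ger0_norm (phi0 t)) lerD2r.
  apply: le_trans (ler_normD _ _) _; rewrite normrN !normrZ.
  by apply: lerD; rewrite ger0_norm ?subr_ge0// ler_piMr ?subr_ge0//; exact: norm_step.
rewrite ge0_integralD//; last 3 first.
- by move=> t _; rewrite adde_ge0// lee_fin subr_ge0.
- exact: emeasurable_funD.
- by move=> t _; rewrite lee_fin mulr_ge0.
rewrite ge0_integralD//; last 2 first.
- by move=> t _; rewrite lee_fin subr_ge0.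
- by move=> t _; rewrite lee_fin subr_ge0.
by rewrite 2!EFinD; apply: leeD => //; exact: leeD.
Qed.

(** [P] and [P'] need not be comparable, so both are compared with their common refinement, whose
    step function does not depend on the order of concatenation. *)
Let step_diff P P' : all_measurable P -> all_measurable P' ->
  (\int[mu]_t (phi t * `|xi P' t - xi P t|)%:E <=
    (gap l nu P P' + gap l nu P' P)%:E)%E.
Proof.
move=> mP mP'; have mc S S' : all_measurable S -> all_measurable S' ->
    measurable_fun setT (fun t => (phi t * `|xi S t - xi S' t|)%:E).
  move=> mS mS'; apply/measurable_EFinP; apply: measurable_funM => //.
  exact: (measurable_simple2 (fun a b => `|a - b|) (simple_step lam nu mS) (simple_step lam nu mS')).
have mPP := all_measurable_cat mP mP'; have mPP' := all_measurable_cat mP' mP.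
apply: (@le_trans _ _ (\int[mu]_t ((phi t * `|xi (P ++ P') t - xi P' t|)%:E +
    (phi t * `|xi (P' ++ P) t - xi P t|)%:E))%E).
  apply: ge0_le_integral_nonmeasurable => t; first by rewrite lee_fin mulr_ge0.
  rewrite -EFinD lee_fin -mulrDr ler_wpM2l// /xi (step_catC lam nu P' P).
  by rewrite (distrC (step lam nu (P' ++ P) t) (step lam nu P' t)); exact: ler_distD.
rewrite ge0_integralD//; last 4 first.
- by move=> t _; rewrite lee_fin mulr_ge0.
- exact: mc.
- by move=> t _; rewrite lee_fin mulr_ge0.
- exact: mc.
by rewrite EFinD; apply: leeD; exact: integral_step_refine.
Qed.

Lemma density_of_small_gap :
  (forall e, 0 < e -> exists2 P, all_measurable P &
    forall S, all_measurable S -> gap l nu S P <= e) ->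
  exists g : T -> X, bochner_integrable mu g /\
    forall A, measurable A -> is_bochner_integral mu A g (nu A).
Proof.
move=> small; pose e n : R := (2 ^+ n)^-1.
have e0 n : 0 < e n by rewrite invr_gt0 exprn_gt0.
have /choice[P_ hP] n : exists P, all_measurable P /\
    forall S, all_measurable S -> gap l nu S P <= e n.
  by have [P mP h] := small _ (e0 n); exists P.
have /choice[psi_ hpsi] n := nnsfun_below phi0 iphi (e0 n).
have mP n : all_measurable (P_ n) := (hP n).1.
have psi_le n := (hpsi n).1; have psi_int n := (hpsi n).2.
pose s_ n t := psi_ n t *: xi (P_ n) t.
have ss n : simple_function (s_ n) by apply: simple_weighted_step; exact: (mP n).
have eS n : e n.+1 <= e n.
  by rewrite /e exprS invfM ler_piMl ?invr_ge0 ?exprn_ge0// invf_le1 ?ler1n.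
(* Four terms, each at most [e n]: the defects of [psi_ n] and [psi_ n.+1], and the gaps of [P_ n]
   and [P_ n.+1] towards their common refinement. *)
have sc n : (\int[mu]_t (`|s_ n.+1 t - s_ n t|)%:E <= (4 / 2 ^+ n)%:E)%E.
  have := weighted_step_diff (mP n) (mP n.+1) (psi_le n) (psi_le n.+1)
    (psi_int n) (psi_int n.+1) (step_diff (mP n) (mP n.+1)).
  move=> /le_trans; apply; rewrite lee_fin -/(e n).
  have := (hP n).2 _ (mP n.+1); have := (hP n.+1).2 _ (mP n); have := eS n; lra.
have [g [sg gh]] := simple_limit ss sc.
exists g; split.
  split; first by exists s_.
  have [h [mh h0 gs hi]] := gh 0%N.
  apply: (@le_lt_trans _ _ (\int[mu]_t (h t + (phi t)%:E))%E).
    apply: ge0_le_integral_nonmeasurable => t; first by rewrite lee_fin.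
    apply: (@le_trans _ _ ((`|g t - s_ 0%N t|)%:E + (`|s_ 0%N t|)%:E)%E).
      by rewrite -EFinD lee_fin -{1}(subrK (s_ 0%N t) (g t)) ler_normD.
    apply: leeD => //; rewrite lee_fin normrZ ger0_norm//.
    by apply: le_trans (psi_le 0%N t); rewrite ler_piMr//; apply: norm_step; exact: (mP 0%N).
  rewrite ge0_integralD//; last 2 first.
  - by move=> t _; rewrite lee_fin.
  - exact/measurable_EFinP.
  apply: lte_add_pinfty; first exact: le_lt_trans hi (ltry _).
  by rewrite ltey_eq integrable_fin_num.
move=> A mA.
have mAP n : all_measurable (A :: P_ n).
  by move=> B; rewrite inE => /predU1P[->//|]; exact: mP.
(* The approximating sequence depends on [A]: adding [A] to the generators makes the integral over
   [A] accurate, and it moves the step function by at most the gap of [P_ n]. *)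
pose s' n t := psi_ n t *: xi (A :: P_ n) t.
have ss' n : simple_function (s' n) by apply: simple_weighted_step; exact: (mAP n).
have e_cvg (c : R) : c * e n @[n --> \oo] --> 0.
  have : geometric c 2^-1 n @[n --> \oo] --> (0 : R).
    by apply: cvg_geometric; rewrite ger0_norm ?invr_ge0// invf_lt1// ltr1n.
  by under eq_fun do rewrite /geometric/= exprVn.
(* Here 11 is 8 + 3: the limit is within [2 * 4 * e n] of [s_ n], and [s' n] is within [3 * e n] of
   [s_ n], twice the defect of [psi_ n] plus one gap. *)
have s'_cvg n : (\int[mu]_(t in A) (`|g t - s' n t|)%:E <= (11 * e n)%:E)%E.
  have [h [mh h0 gs hi]] := gh n.
  have mA1 : all_measurable [:: A] by move=> B; rewrite inE => /eqP ->.
  have h1 : (\int[mu]_t (phi t * `|xi (A :: P_ n) t - xi (P_ n) t|)%:E <= (e n)%:E)%E.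
    have := integral_step_refine nu phi0 iphi lamE (@mP n) mA1.
    by move=> /le_trans; apply; rewrite lee_fin; exact: (hP n).2.
  have h2 := weighted_step_diff (mP n) (mAP n) (psi_le n) (psi_le n) (psi_int n) (psi_int n) h1.
  have md : measurable_fun setT (fun t => (`|s' n t - s_ n t|)%:E).
    by apply/measurable_EFinP; exact: (measurable_simple2 (fun a b => `|a - b|) (ss' n) (ss n)).
  apply: (@le_trans _ _ (\int[mu]_t (h t + (`|s' n t - s_ n t|)%:E))%E).
    rewrite integral_mkcond; apply: ge0_le_integral_nonmeasurable => t.
      by rewrite patchE; case: ifP => // _; rewrite lee_fin.
    rewrite patchE; case: ifP => _; last by rewrite adde_ge0// lee_fin.
    apply: (@le_trans _ _ ((`|g t - s_ n t|)%:E + (`|s' n t - s_ n t|)%:E)%E).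
      by rewrite -EFinD lee_fin [X in _ <= _ + X]distrC ler_distD.
    exact: leeD.
  rewrite ge0_integralD//.
  apply: le_trans (leeD hi h2) _.
  by rewrite -EFinD lee_fin /e; lra.
exists s'; split => //.
- apply: (@squeeze_cvge _ _ _ _ (cst 0%E) _ (fun n => (11 * e n)%:E)).
  + near=> n; rewrite s'_cvg andbT; apply: integral_ge0 => t _; rewrite lee_fin//.
  + exact: cvg_cst.
  + by apply: cvg_EFin; [near=> n|exact: e_cvg].
- apply/cvgrPdist_le => eps eps0.
  have /cvgrPdist_le/(_ _ eps0) h := e_cvg 1.
  near=> n.
  rewrite distrC; apply: le_trans (simple_integral_weighted_step (mP n) mA (psi_le n) (psi_int n)) _.
  have : `|0 - 1 * e n| <= eps by near: n.
  by rewrite sub0r normrN mul1r ger0_norm// (ltW (e0 n)).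
Unshelve. all: by end_near. Qed.

End weighted_step.

Theorem corollary3p9 (R : realType) (X : completeNormedModType R) :
  graphon_representation_property X -> radon_nikodym_property X.
Proof.
move=> GRP d T mu nu nu_ca nu_bv nu_ac.
have nu_add := countably_additive_finitely nu_ca.
have [lam lamE] := variation_measure nu_ca nu_bv.
have nu_lam A : measurable A -> (`|nu A|%:E <= lam A)%E.
  by move=> mA; rewrite lamE; exact: norm_le_variation.
(* If [A] is null for [mu], so is its trace on every cell, and each term of the variation of [nu] on
   [A] vanishes. *)
have lam_mu : lam `<< mu.
  apply/null_content_dominatesP => A mA muA; rewrite lamE.
  apply/eqP; rewrite eq_le -lamE measure_ge0 andbT lamE.
  apply: ge_ereal_sup => _ [P mP <-]; rewrite lee_fin /cell_variation.
  rewrite big_seq big1// => C CP; have mC := measurable_cells mP CP.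
  rewrite nu_ac ?normr0//; first exact: measurableI.
  exact: (subset_measure0 (measurableI _ _ mC mA) mA (@subIsetr _ _ _) muA).
have [f [f0 ffin fint fE]] := radon_nikodym_sigma_finite lam_mu.
(* The scalar density [f] is finite everywhere, so passing to real values loses nothing. *)
pose phi t := fine (f t).
have phiE : EFin \o phi = f by apply/funext => t /=; rewrite fineK.
apply: (@density_of_small_gap _ _ _ _ mu lam phi) => //.
- by move=> t; exact: fine_ge0.
- by rewrite phiE.
- by move=> A mA; rewrite fE//; apply: eq_integral => t _; rewrite -phiE.
- move=> e; apply: small_gap => //.
  + exact: fine_measure_finitely_additive.
  + by move=> A mA; exact: fine_ge0.
  + by move=> A mA; rewrite -lee_fin fineK ?nu_lam//; exact: fin_num_measure.
Qed.
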